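(* Let $n=1$, $q\geq 2$, $\omega\geq 1$ and $b>0$. If $$b\geq \mathcal{D}_{\omega,q}:=\frac{2^q-1}{2}\,\omega^{1+\frac q2}-\frac12\,\omega^{-\frac q2},$$ then there exists a ground state solution $(u,v)\in E_{rd}$ of the system $$-u''+u=|u|^{2q-2}u+b|v|^q|u|^{q-2}u,\qquad -v''+\omega^2 v=|v|^{2q-2}v+b|u|^q|v|^{q-2}v\quad\text{in }\mathbb{R}$$ with $u>0$ and $v>0$.
   Context: All functions are real-valued on $\mathbb{R}$, and $\|\cdot\|_p$ is the standard $L^p(\mathbb{R})$ norm; $|s|^{q-2}s$ is understood as $0$ at $s=0$. Let $E=H^1(\mathbb{R})\times H^1(\mathbb{R})$ and, for $(u,v)\in E$, set $$\|(u,v)\|_{\dot\omega}^2=\|u\|_2^2+\|u'\|_2^2+\omega^2\|v\|_2^2+\|v'\|_2^2.$$ The energy functional associated to the system is $$I(u,v)=\tfrac12\|(u,v)\|_{\dot\omega}^2-\tfrac1{2q}\left(\|u\|_{2q}^{2q}+\|v\|_{2q}^{2q}+2b\|uv\|_q^q\right),\qquad (u,v)\in E.$$ Its critical points in $E$ are exactly the (weak) solutions of the system in $E$. A ground state solution is a solution $(u,v)\in E\setminus\{(0,0)\}$ of the system that minimizes $I$ among all solutions of the system in $E\setminus\{(0,0)\}$. $E_{rd}$ denotes the cone of pairs $(u,v)\in E$ such that both $u$ and $v$ are non-negative, radially symmetric (i.e. even) and radially decreasing (that is, nonincreasing as functions of $|x|$). *)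

(* Defs.v *)
From HB Require Import structures.
From mathcomp Require Export all_boot all_order all_algebra.
From mathcomp Require Export all_classical all_reals all_analysis.
Export Order.TTheory GRing.Theory Num.Theory.
Export numFieldNormedType.Exports.

Set Implicit Arguments.
Unset Strict Implicit.
Unset Printing Implicit Defensive.

Local Open Scope classical_set_scope.
Local Open Scope ring_scope.

Section Sobolev.
Context {R : realType}.
Implicit Types u v g phi psi : R -> R.

Local Notation mu := (@lebesgue_measure R).

Definition test_function phi : Prop :=
  (forall (n : nat) (x : R), derivable (derive1n n phi) x 1) /\
  compact (closure [set x | phi x != 0]).

Definition is_weak_derivative u g : Prop :=
  forall phi, test_function phi ->
    \int[mu]_x (u x * derive1 phi x) = - \int[mu]_x (g x * phi x).

(* Elements of H^1 are handled through representatives: a function here stands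
   for its class modulo equality almost everywhere. *)
Definition H1 u : Prop :=
  u \in Lfun mu 2%:E /\
  exists2 g : R -> R, g \in Lfun mu 2%:E & is_weak_derivative u g.

(* Determined up to a null set for u in H^1; junk value 0 outside H^1. *)
Definition weak_derivative u : R -> R :=
  xget (cst 0) [set g : R -> R | g \in Lfun mu 2%:E /\ is_weak_derivative u g].

(* Real-valued L^p norm; faithful only for functions in L^p, since fine
   sends +oo to 0. *)
Definition normL (p : R) u : R := fine ('N[mu]_(p%:E)[EFin \o u]).

Definition E_space (w : (R -> R) * (R -> R)) : Prop := H1 w.1 /\ H1 w.2.

Definition E_zero (w : (R -> R) * (R -> R)) : Prop :=
  w.1 = cst 0 %[ae mu] /\ w.2 = cst 0 %[ae mu].

Definition sqnorm_omega (omega : R) (w : (R -> R) * (R -> R)) : R :=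
  normL 2 w.1 ^+ 2 + normL 2 (weak_derivative w.1) ^+ 2 +
  omega ^+ 2 * normL 2 w.2 ^+ 2 + normL 2 (weak_derivative w.2) ^+ 2.

Definition energy (omega q b : R) (w : (R -> R) * (R -> R)) : R :=
  2^-1 * sqnorm_omega omega w -
  (2 * q)^-1 * (normL (2 * q) w.1 `^ (2 * q) + normL (2 * q) w.2 `^ (2 * q) +
                2 * b * normL q (w.1 \* w.2) `^ q).

(* |s|^(r-2) s; it vanishes at s = 0 for every r. *)
Definition signed_pow (r s : R) : R := `|s| `^ (r - 2) * s.

(* u and v weakly solve
     - u'' + u         = |u|^(2q-2) u + b |v|^q |u|^(q-2) u,
     - v'' + omega^2 v = |v|^(2q-2) v + b |u|^q |v|^(q-2) v. *)
Definition weak_solution (omega q b : R) (w : (R -> R) * (R -> R)) : Prop :=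
  let: (u, v) := w in
  forall phi, H1 phi ->
    \int[mu]_x (weak_derivative u x * weak_derivative phi x + u x * phi x) =
    \int[mu]_x ((signed_pow (2 * q) (u x)
                 + b * `|v x| `^ q * signed_pow q (u x)) * phi x) /\
    \int[mu]_x (weak_derivative v x * weak_derivative phi x
                + omega ^+ 2 * v x * phi x) =
    \int[mu]_x ((signed_pow (2 * q) (v x)
                 + b * `|u x| `^ q * signed_pow q (v x)) * phi x).

Definition nontrivial_solution (omega q b : R) (w : (R -> R) * (R -> R)) :=
  [/\ E_space w, ~ E_zero w & weak_solution omega q b w].

Definition ground_state (omega q b : R) (w : (R -> R) * (R -> R)) : Prop :=
  nontrivial_solution omega q b w /\
  forall z, nontrivial_solution omega q b z ->
    energy omega q b w <= energy omega q b z.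

Definition nonneg_radially_decreasing u : Prop :=
  [/\ forall x, 0 <= u x, forall x, u (- x) = u x &
      forall x y, `|x| <= `|y| -> u y <= u x].

Definition E_rd (w : (R -> R) * (R -> R)) : Prop :=
  [/\ E_space w, nonneg_radially_decreasing w.1
    & nonneg_radially_decreasing w.2].

Definition D_threshold (omega q : R) : R :=
  (2 `^ q - 1) / 2 * omega `^ (1 + q / 2) - 2^-1 * omega `^ (- (q / 2)).

End Sobolev.

(* Main.v *)
Require Import Defs.
From mathcomp Require Import measurable_realfun zify ring lra.

(* The ground state is obtained from the best constant S in
   S (int G(u, v))^(1/q) <= N(u, v), where N is the squared norm and G the
   homogeneous coupling of degree 2q.  No compactness in H^1 is used: on a
   cycle of 2K+1 sites with mesh h the problem is finite dimensional, a
   minimiser exists, and polarisation makes it decreasing in the distance to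
   the origin.  Its Euler-Lagrange equation gives equicontinuity of the
   profiles and of their difference quotients, so that a subsequence (picked by
   an ultrafilter) converges to an even decreasing C^2 pair solving
   - u'' + a u = S f(u, v), with int G <= 1 by Fatou.  Sampling arbitrary
   absolutely continuous pairs on the lattice shows that the limit S is sharp,
   which forces int G = 1.  A minimiser (u, 0) is excluded for b above the
   threshold by comparison with the pair (u, omega^(-1/2) u(omega x)), except
   when omega = 1 and b is at the threshold, where u can be split evenly
   between the components.  Scaling turns the minimiser into a solution, and
   testing with itself shows that every nontrivial solution has at least its
   energy. *)

Set Implicit Arguments.
Unset Strict Implicit.
Unset Printing Implicit Defensive.

Local Open Scope classical_set_scope.
Local Open Scope ring_scope.

(* For polynomials this notation denotes the formal derivative. *)
Local Notation "f ^` ()" := (derive1 f) : ring_scope.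

(** * Smooth steps *)

Section Smooth.
Context {R : realType}.
Implicit Types (f g : R -> R) (P : {poly R}).

(** Translations destroy compactness on the line. The lattice minimisers are monotone about a fixed
    origin, and there [1 <= (1 + b) B ^ (2q - 2) (S / al + S / be)], with [B] the sum of the two
    values at the origin; this bound survives the limit and excludes both [S = 0] and a vanishing
    pair. Fatou still gives only m = int G <= 1. Testing the limit equations with the pair itself
    gives N = S m, while sharpness gives S m^(1/q) <= N; hence m^(1/q) <= m, so that m = 1.

    Polarisation orders only sites at different distances and does not yield evenness. The right
    half of the lattice minimiser is kept and then reflected; at the origin its equation is replaced
    by a one-sided estimate, which makes the limiting slope vanish there.

    The threshold is where the comparison breaks even. Let int u^(2q) = 1. Since u is decreasing and
    omega >= 1, int u^q u(omega x)^q >= 1 / omega, so the comparison pair has mass at least 1 +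
    (omega^(-q) + 2 b omega^(-q/2)) / omega, whereas squared norm 2 S allows at most 2^q. The two
    values coincide for [b = D_threshold omega q]. *)

Lemma is_derive_eps f (x l : R) :
  (forall e, 0 < e -> exists2 d, 0 < d &
     forall y, `|y - x| < d -> `|f y - f x - (y - x) * l| <= e * `|y - x|) ->
  is_derive x 1 f l.
Proof.
move=> H.
suff cv : (fun h => h^-1 *: (f (h *: 1 + x) - f x)) @ 0^' --> l.
  by apply: DeriveDef; [apply/cvg_ex; exists l | apply/cvg_lim].
apply/cvgrPdist_le => /= e e0; have [d d0 Hd] := H e e0.
near=> h.
have h0 : h != 0 by near: h; exact: nbhs_dnbhs_neq.
have hd : `|h| < d by near: h; apply: dnbhs0_lt.
have -> : (h *: 1 + x : R) = x + h by rewrite /GRing.scale/= mulr1 addrC.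
have := Hd (x + h); rewrite addrAC subrr add0r => /(_ hd) {}Hd.
have -> : l - h^-1 *: (f (x + h) - f x) = - (h^-1 * (f (x + h) - f x - h * l)).
  by rewrite /GRing.scale/=; field.
by rewrite normrN normrM normfV mulrC ler_pdivrMr ?normr_gt0.
Unshelve. all: by end_near. Qed.

Lemma is_derive_sq f (x l C : R) :
  (forall y, `|f y - f x - (y - x) * l| <= C * `|y - x| ^+ 2) -> is_derive x 1 f l.
Proof.
move=> H; apply: is_derive_eps => e e0.
have C1 : 0 < `|C| + 1 by rewrite ltr_wpDl.
exists (e / (`|C| + 1)); first by rewrite divr_gt0.
move=> y yx; apply: le_trans (H y) _; rewrite expr2 mulrA.
apply: ler_wpM2r => //; move: yx; rewrite ltr_pdivlMr// => /ltW.
apply: le_trans; rewrite mulrC; apply: ler_wpM2l => //.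
by rewrite (le_trans (ler_norm _))// lerDl.
Qed.

(** The recursion peels off the innermost derivative, whereas [derive1n] adds an outermost one.
    Closure under sums, products and inverses is then an induction on [n] with the function
    generalised. [Ck n] means n + 1 derivatives. *)
Fixpoint Ck n f : Prop :=
  if n is n'.+1 then (forall x, derivable f x 1) /\ Ck n' f^`()
  else forall x, derivable f x 1.

Definition smooth f := forall n x, derivable (derive1n n f) x 1.

Lemma smoothP f : smooth f <-> forall n, Ck n f.
Proof.
split=> [H n|H n]; last first.
  elim: n f H => [|n IH] f H; first exact: (H 0%N).
  rewrite derive1Sn; apply: IH => m; exact: (H m.+1).2.
elim: n f H => [|n IH] f H; first exact: (H 0%N).
split; first exact: (H 0%N).
by apply: IH => m x; have := H m.+1 x; rewrite derive1Sn.
Qed.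

Lemma Ck_weaken n f : Ck n.+1 f -> Ck n f.
Proof. elim: n f => [|n IH] f [df Hf]; first exact: df.
by split; [exact: df|exact: IH Hf]. Qed.

Lemma CkD n f g : Ck n f -> Ck n g -> Ck n (f \+ g).
Proof.
elim: n f g => [|n IH] f g.
  by move=> df dg x; exact: derivableD (df x) (dg x).
move=> [df Hf] [dg Hg]; split.
  by move=> x; exact: derivableD (df x) (dg x).
suff -> : (f \+ g)^`() = f^`() \+ g^`() by exact: IH.
apply/funext => x; rewrite derive1E /= !derive1E.
exact: deriveD (df x) (dg x).
Qed.

Lemma CkM n f g : Ck n f -> Ck n g -> Ck n (f \* g).
Proof.
elim: n f g => [|n IH] f g.
  by move=> df dg x; exact: derivableM (df x) (dg x).
move=> /[dup] Cf [df Hf] /[dup] Cg [dg Hg]; split.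
  by move=> x; exact: derivableM (df x) (dg x).
have -> : (f \* g)^`() = (f \* g^`()) \+ (g \* f^`()).
  apply/funext => x; rewrite derive1E /= !derive1E.
  exact: deriveM (df x) (dg x).
apply: CkD; [exact: IH (Ck_weaken Cf) Hg|exact: IH (Ck_weaken Cg) Hf].
Qed.

Lemma Ck_cst n (c : R) : Ck n (cst c).
Proof.
have d : forall c x, derivable (cst c : R -> R) x 1.
  by move=> c' x; exact: derivable_cst.
elim: n c => [|n IH] c; first exact: d.
split; first exact: d.
suff -> : (cst c : R -> R)^`() = cst 0 by exact: IH.
by apply/funext => x; rewrite derive1E derive_cst.
Qed.

Lemma CkV n f : (forall x, f x != 0) -> Ck n f -> Ck n (fun x => (f x)^-1).
Proof.
move=> f0; elim: n => [|n IH].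
  by move=> df x; apply: derivableV.
move=> /[dup] Cf [df Hf]; split; first by move=> x; apply: derivableV.
have -> : (fun x => (f x)^-1)^`() =
    (cst (-1) \* f^`()) \* ((fun x => (f x)^-1) \* (fun x => (f x)^-1)).
  apply/funext => x; rewrite /= derive1E deriveV// -derive1E /GRing.scale/=.
  by field; exact: f0.
have If := IH (Ck_weaken Cf).
by apply: CkM; [apply: CkM => //; exact: Ck_cst | exact: CkM].
Qed.

Lemma is_derive1_affine f (a b x : R) : derivable f (a * x + b) 1 ->
  is_derive x 1 (fun x => f (a * x + b)) (a * f^`() (a * x + b)).
Proof.
move=> df.
have da : is_derive x 1 (fun x => a * x + b) a.
  have -> : (fun x => a * x + b) = a \*: id + cst b by [].
  by apply: is_derive_eq; rewrite addr0 /GRing.scale/= mulr1.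
have df' : is_derive (a * x + b) 1 f (f^`() (a * x + b)).
  by rewrite derive1E; exact/derivableP.
have := @is_derive1_comp _ f (fun x => a * x + b) _ _ _ df' da.
by rewrite /GRing.scale/= mulrC.
Qed.

Lemma Ck_affine n f (a b : R) : Ck n f -> Ck n (fun x => f (a * x + b)).
Proof.
elim: n f => [|n IH] f.
  move=> df x; have := is_derive1_affine (df (a * x + b)).
  by case.
move=> [df Hf]; split.
  by move=> x; have [] := is_derive1_affine (df (a * x + b)).
have -> : (fun x => f (a * x + b))^`() = cst a \* (fun x => f^`() (a * x + b)).
  apply/funext => x; rewrite /= derive1E.
  by have [_ ->] := is_derive1_affine (df (a * x + b)).
by apply: CkM; [exact: Ck_cst | exact: IH].
Qed.

(* These functions are closed under differentiation, hence smooth at 0. *)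
Definition flat P (x : R) : R := if 0 < x then P.[x^-1] * expR (- x^-1) else 0.

(** With s = 1 / x, the inequality s^(i+2) / (i+2)! <= exp s bounds every monomial s^i exp(-s) by a
    multiple of x^2. A quadratic bound is what [is_derive_sq] needs to differentiate at 0. *)
Lemma flat_bound P : exists C, forall x : R, `|flat P x| <= C * `|x| ^+ 2.
Proof.
exists (\sum_(i < size P) `|P`_i| * (i.+2)`!%:R) => x; rewrite /flat.
case: ifPn => x0; last first.
  by rewrite normr0 mulr_ge0// sumr_ge0// => i _; rewrite mulr_ge0.
have s0 : 0 < x^-1 by rewrite invr_gt0.
rewrite (gtr0_norm x0) -ler_pdivrMr ?exprn_gt0//.
rewrite -exprVn; set s := x^-1 in s0 *.
rewrite normrM (gtr0_norm (expR_gt0 _)) expRN mulrAC ler_pdivrMr ?expR_gt0//.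
rewrite horner_coef.
apply: (@le_trans _ _ ((\sum_(i < size P) `|P`_i * s ^+ i|) * s ^+ 2)).
  by apply: ler_wpM2r; [rewrite exprn_ge0// ltW|exact: ler_norm_sum].
rewrite !mulr_suml; apply: ler_sum => i _.
rewrite normrM -!mulrA; apply: ler_wpM2l => //.
rewrite ger0_norm; last by rewrite exprn_ge0// ltW.
rewrite -exprD addn2 mulrC -ler_pdivrMr; last by rewrite ltr0n fact_gt0.
by apply: le_trans (expR_ge1Dxn i.+1 (ltW s0)); rewrite lerDr.
Qed.

Lemma is_derive_horner P (x : R) : is_derive x 1 (horner P) (deriv P).[x].
Proof.
elim/poly_ind: P => [|P c IH].
  have -> : horner (0 : {poly R}) = cst 0 by apply/funext => y; rewrite horner0.
  by rewrite deriv0 horner0; exact: is_derive_cst.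
have -> : horner (P * 'X + c%:P) = horner P * id + cst c.
  by apply/funext => y; rewrite hornerMXaddC.
apply: is_derive_eq.
rewrite derivMXaddC !hornerE /GRing.scale/=; ring.
Qed.

(** For x > 0 this is the chain rule with s = 1 / x and ds / dx = - s^2; the factor ['X^2] is that
    s^2. *)
Lemma is_derive_flat P (x : R) :
  is_derive x 1 (flat P : R -> R) (flat ('X^2 * (P - deriv P)) x).
Proof.
have [x0|x0|->] := ltrgtP x 0.
- rewrite {2}/flat ltNge (ltW x0)/=.
  apply: (@near_eq_is_derive _ _ _ (cst 0)).
    near=> y; rewrite /flat ltNge.
    suff -> : y <= 0 by [].
    by near: y; apply: filterS (lt_nbhsl x0) => z /ltW.
- rewrite {2}/flat x0.
  pose g := (horner P \o (fun y : R => y^-1)) * (expR \o (fun y : R => - y^-1)).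
  apply: (@near_eq_is_derive _ _ _ g).
  + near=> y; rewrite /flat.
    suff -> : 0 < y by [].
    by near: y; exact: lt_nbhsr.
  + have xn0 : x != 0 by rewrite gt_eqF.
    have dV : is_derive x 1 (fun y : R => y^-1) (- x ^- 2).
      have := @is_deriveV _ (@id R) x 1 1 xn0 (is_derive_id x 1).
      by rewrite /GRing.scale/= mulr1.
    have d1 := @is_derive1_comp _ (horner P) _ _ _ _ (is_derive_horner P x^-1) dV.
    have d2 : is_derive x 1 (fun y => - y^-1) (x ^- 2).
      by have := is_deriveN dV; rewrite opprK.
    have d3 := @is_derive1_comp _ (@expR R) (fun y : R => - y^-1) _ _ _ (is_derive_expR (- x^-1)) d2.
    apply: is_derive_eq.
    transitivity (P.[x^-1] * (expR (- x^-1) * x ^- 2) +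
      expR (- x^-1) * ((deriv P).[x^-1] * - x ^- 2)); first by [].
    by rewrite hornerM hornerXn hornerD hornerN exprVn; ring.
- rewrite {2}/flat ltxx; have [C HC] := flat_bound P.
  apply: (@is_derive_sq _ _ _ C) => y.
  by rewrite {2}/flat ltxx !subr0 mulr0 subr0.
Unshelve. all: by end_near. Qed.

Lemma Ck_flat n P : Ck n (flat P).
Proof.
elim: n P => [|n IH] P; first by move=> x; have [] := is_derive_flat P x.
split; first by move=> x; have [] := is_derive_flat P x.
have -> : (flat P)^`() = flat ('X^2 * (P - deriv P)).
  by apply/funext => x; rewrite derive1E; have [_ ->] := is_derive_flat P x.
exact: IH.
Qed.

Let e := flat 1.

Lemma flat1_gt0 (x : R) : 0 < x -> 0 < e x.
Proof. by move=> x0; rewrite /e /flat x0 hornerE mul1r expR_gt0. Qed.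

Lemma flat1_le0 (x : R) : x <= 0 -> e x = 0.
Proof. by move=> x0; rewrite /e /flat ltNge x0. Qed.

Lemma flat1_ge0 (x : R) : 0 <= e x.
Proof. by have [/flat1_le0 ->//|/flat1_gt0/ltW] := leP x 0. Qed.

(** The classical smooth transition e(x) / (e(x) + e(1 - x)), with 1 - x written in the affine form
    expected by [Ck_affine]. *)
Definition step (x : R) : R := e x * (e x + e (-1 * x + 1))^-1.

Let den_gt0 (x : R) : 0 < e x + e (-1 * x + 1).
Proof.
have [x0|x0] := ltP 0 x; first by rewrite ltr_pwDl ?flat1_gt0 ?flat1_ge0.
by rewrite ltr_wpDl ?flat1_ge0// flat1_gt0//; lra.
Qed.

Lemma Ck_step n : Ck n step.
Proof.
have -> : step = e \* (fun x => ((e \+ (fun x => e (-1 * x + 1))) x)^-1) by [].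
apply: CkM; first exact: Ck_flat.
apply: CkV; first by move=> x; rewrite gt_eqF//; exact: den_gt0.
apply: CkD; first exact: Ck_flat.
apply: Ck_affine; exact: Ck_flat.
Qed.

Lemma step_le0 (x : R) : x <= 0 -> step x = 0.
Proof. by move=> /flat1_le0 h; rewrite /step h mul0r. Qed.

Lemma step_ge1 (x : R) : 1 <= x -> step x = 1.
Proof.
move=> x1; rewrite /step (@flat1_le0 (-1 * x + 1)); last by lra.
by rewrite addr0 divff// gt_eqF// flat1_gt0// (lt_le_trans _ x1).
Qed.

Lemma step_itv (x : R) : 0 <= step x <= 1.
Proof.
have d0 := den_gt0 x.
rewrite /step mulr_ge0 ?flat1_ge0 ?invr_ge0 ?(ltW d0)//=.
by rewrite ler_pdivrMr// mul1r lerDl flat1_ge0.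
Qed.

Lemma derivable_step (x : R) : derivable step x 1.
Proof. exact: (Ck_step 0). Qed.

Lemma continuous_dstep : continuous (step^`()).
Proof.
move=> x; apply: differentiable_continuous.
by apply/derivable1_diffP; exact: (Ck_step 1).2.
Qed.

End Smooth.

(** * Square-integrable functions and mollification *)

Section L2.
Context {R : realType}.
Implicit Types (f g u v : R -> R).
Local Notation mu := (@lebesgue_measure R).

Definition L2 u := measurable_fun setT u /\
  mu.-integrable setT (EFin \o (fun x => u x ^+ 2)).

Lemma L2P u : u \in Lfun mu 2%:E <-> L2 u.
Proof.
split=> [Lu|[mu_ iu]].
  split; last exact: Lfun2_integrable_sqr.
  by move: Lu; rewrite inE => /andP[+ _]; rewrite inE.
rewrite inE; apply/andP; split; rewrite inE//=.
rewrite /finite_norm unlock /=.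
apply: poweR_lty; move/integrableP : iu => [_].
apply: le_lt_trans; rewrite le_eqVlt; apply/orP; left; apply/eqP.
apply: eq_integral => x _ /=.
by rewrite powR_mulrn// -normrX.
Qed.

Lemma integrable_le f g : measurable_fun setT f ->
  mu.-integrable setT (EFin \o g) -> (forall x, `|f x| <= g x) ->
  mu.-integrable setT (EFin \o f).
Proof.
move=> mf ig fg; apply: (le_integrable _ _ _ ig) => //; first exact/measurable_EFinP.
by move=> x _ /=; rewrite lee_fin (le_trans (fg x))// ler_norm.
Qed.

Lemma intgD (D : set R) f g : measurable D -> mu.-integrable D (EFin \o f) ->
  mu.-integrable D (EFin \o g) -> mu.-integrable D (EFin \o (fun x => f x + g x)).
Proof. by move=> mD i1 i2; apply: (@integrableD _ _ _ _ _ _ _ _ i1 i2). Qed.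

Lemma intgZ (D : set R) (c : R) f : measurable D -> mu.-integrable D (EFin \o f) ->
  mu.-integrable D (EFin \o (fun x => c * f x)).
Proof. by move=> mD i1; apply: (@integrableZl _ _ _ _ _ _ c _ i1). Qed.

Lemma intgB (D : set R) f g : measurable D -> mu.-integrable D (EFin \o f) ->
  mu.-integrable D (EFin \o g) -> mu.-integrable D (EFin \o (fun x => f x - g x)).
Proof. by move=> mD i1 i2; apply: (@integrableB _ _ _ _ _ _ _ _ i1 i2). Qed.

Lemma intgS (D E : set R) f : measurable D -> measurable E -> D `<=` E ->
  mu.-integrable E (EFin \o f) -> mu.-integrable D (EFin \o f).
Proof. by move=> mD mE DE; apply: integrableS. Qed.

Lemma intg_cst (a b c : R) : mu.-integrable `[a, b] (EFin \o (fun=> c)).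
Proof.
apply: continuous_compact_integrable; first exact: segment_compact.
by apply: continuous_subspaceT => x; exact: cvg_cst.
Qed.

Lemma intg_cont f a b : continuous f -> mu.-integrable `[a, b] (EFin \o f).
Proof.
move=> cf; apply: continuous_compact_integrable; first exact: segment_compact.
exact: continuous_subspaceT.
Qed.

Lemma L2_integrableM u v : L2 u -> L2 v ->
  mu.-integrable setT (EFin \o (fun x => u x * v x)).
Proof. by move=> /L2P Lu /L2P Lv; apply/Lfun1_integrable; exact: Lfun2_mul_Lfun1. Qed.

Lemma L2_integrable_itv u a b : L2 u -> mu.-integrable `[a, b] (EFin \o u).
Proof.
move=> [mu_ iu].
have i3 : mu.-integrable `[a, b] (EFin \o (fun x => 1 + u x ^+ 2)).
  by apply: intgD => //; [exact: intg_cst|exact: intgS iu].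
apply: (le_integrable _ _ _ i3) => //.
  by apply/measurable_EFinP; exact: measurable_funTS.
move=> x _ /=; rewrite lee_fin -[leRHS]/(`|1 + u x ^+ 2|).
rewrite [leRHS]ger0_norm; last by rewrite addr_ge0// sqr_ge0.
by rewrite -real_normK ?num_real//; have := normr_ge0 (u x); nra.
Qed.

Lemma L2_locally_integrable u : L2 u -> locally_integrable setT u.
Proof.
move=> Lu; split => //; [by case: Lu|exact: openT|].
move=> K _ cK; have [M [Mr HM]] := compact_bounded cK.
have KM : K `<=` `[- (M + 1), M + 1].
  move=> x Kx; have := HM (M + 1) _ x Kx; rewrite ltrDl => /(_ ltr01) /=.
  by rewrite ler_norml in_itv.
have [_] := integrableP _ _ _ (L2_integrable_itv (- (M + 1)) (M + 1) Lu).
apply: le_lt_trans; apply: ge0_subset_integral => //.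
  exact: compact_measurable.
apply/measurable_EFinP; apply: measurableT_comp => //.
by apply: measurable_funTS; case: Lu.
Qed.

Lemma L2Z (c : R) u : L2 u -> L2 (fun x => c * u x).
Proof.
move=> [mu_ iu]; split; first by apply: measurable_funM => //; exact: measurable_cst.
have := integrableZl measurableT (c ^+ 2) iu; apply: eq_integrable => //.
by move=> x _ /=; rewrite -EFinM exprMn.
Qed.

Lemma L2D u v : L2 u -> L2 v -> L2 (fun x => u x + v x).
Proof.
move=> [mu_ iu] [mv iv]; split; first exact: measurable_funD.
apply: (@integrable_le _ (fun x => 2 * u x ^+ 2 + 2 * v x ^+ 2)).
- by apply: measurable_funX; exact: measurable_funD.
- by apply: intgD => //; exact: intgZ.
- move=> x; rewrite ger0_norm ?sqr_ge0//.
  by have := sqr_ge0 (u x - v x); nra.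
Qed.

Lemma L2_le u v : measurable_fun setT u -> L2 v ->
  (forall x, `|u x| <= `|v x|) -> L2 u.
Proof.
move=> mu_ [mv iv] uv; split=> //; apply: (integrable_le _ iv).
  exact: measurable_funX.
move=> x; rewrite normrX -(real_normK (num_real (v x))).
by apply: lerXn2r; rewrite ?nnegrE.
Qed.

Lemma Rintegral_support (D : set R) f : (forall s, ~ D s -> f s = 0) ->
  \int[mu]_s f s = \int[mu]_(s in D) f s.
Proof.
move=> f0; rewrite [RHS]Rintegral_mkcond; apply: eq_Rintegral => s _.
by rewrite patchE; case: ifPn => // /negP; rewrite inE => /f0.
Qed.

Lemma integrable_support (D : set R) f : measurable D -> (forall s, ~ D s -> f s = 0) ->
  mu.-integrable D (EFin \o f) -> mu.-integrable setT (EFin \o f).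
Proof.
move=> mD f0 /integrable_mkcond => /(_ mD); apply: eq_integrable => // s _.
by rewrite patchE; case: ifPn => // /negP; rewrite inE => /f0 /= ->.
Qed.

End L2.

(** * Rescaled steps and the test functions built from them *)

Section Ramp.
Context {R : realType}.
Implicit Types (f g u v : R -> R) (x y d s : R).
Local Notation mu := (@lebesgue_measure R).

Lemma dstep0 (t : R) : t < 0 \/ 1 < t -> step^`() t = 0.
Proof.
move=> [t0|t1]; rewrite derive1E.
  have -> : 'D_1 step t = 'D_1 (cst 0 : R -> R) t.
    apply: near_eq_derive; near=> s; rewrite step_le0//.
    by near: s; apply: filterS (lt_nbhsl t0) => z /ltW.
  by rewrite derive_cst.
have -> : 'D_1 step t = 'D_1 (cst 1 : R -> R) t.
  apply: near_eq_derive; near=> s; rewrite step_ge1//.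
  by near: s; apply: filterS (lt_nbhsr t1) => z /ltW.
by rewrite derive_cst.
Unshelve. all: by end_near. Qed.

Lemma dstep_bound : exists2 M : R, 0 < M & forall t : R, `|step^`() t| <= M.
Proof.
have [|c _ Hc] := @EVT_max R (fun t => `|step^`() t|) 0 1 ler01.
  apply: continuous_subspaceT => t.
  by apply: continuous_comp; [exact: continuous_dstep|exact: norm_continuous].
exists (`|step^`() c| + 1); first by rewrite ltr_wpDl.
move=> t; have [t01|t01] := boolP (t \in `[0, 1]).
  by rewrite (le_trans (Hc t t01))// lerDl.
rewrite dstep0 ?normr0 ?addr_ge0//.
by move: t01; rewrite in_itv/= negb_and -!ltNge => /orP[]; [left|right].
Qed.

(** A transition from 0 to 1 across [x, x + d]. Its derivative has integral 1 and serves as a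
    one-sided mollifier at x. *)
Definition ramp x d s := step (d^-1 * s + - (d^-1 * x)).

Lemma is_derive_ramp x d s :
  is_derive s 1 (ramp x d : R -> R) (d^-1 * step^`() (d^-1 * s + - (d^-1 * x))).
Proof. by apply: is_derive1_affine; exact: derivable_step. Qed.

Lemma dramp x d s : (ramp x d)^`() s = d^-1 * step^`() (d^-1 * s + - (d^-1 * x)).
Proof. by rewrite derive1E; have [_ ->] := is_derive_ramp x d s. Qed.

Lemma continuous_dramp x d : continuous (ramp x d)^`().
Proof.
have -> : (ramp x d)^`() = cst d^-1 * (step^`() \o (fun s => d^-1 * s + - (d^-1 * x))).
  by apply/funext => s; rewrite dramp.
move=> s; apply: cvgM; first exact: cvg_cst.
apply: continuous_comp; last exact: continuous_dstep.
apply: cvgD; last exact: cvg_cst.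
by apply: cvgM; [exact: cvg_cst|exact: cvg_id].
Qed.

Let rampE x d s : 0 < d -> d^-1 * s + - (d^-1 * x) = (s - x) / d.
Proof. by move=> d0; rewrite -mulrBr mulrC. Qed.

Lemma ramp_le x d s : 0 < d -> s <= x -> ramp x d s = 0.
Proof.
move=> d0 sx; rewrite /ramp rampE// step_le0//.
by rewrite pmulr_lle0 ?invr_gt0// subr_le0.
Qed.

Lemma ramp_ge x d s : 0 < d -> x + d <= s -> ramp x d s = 1.
Proof.
move=> d0 sx; rewrite /ramp rampE// step_ge1//.
by rewrite ler_pdivlMr// mul1r lerBrDl.
Qed.

Lemma dramp0 x d s : 0 < d -> s < x \/ x + d < s -> (ramp x d)^`() s = 0.
Proof.
move=> d0 H; rewrite dramp dstep0 ?mulr0//.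
rewrite rampE//; case: H => H; [left|right].
  by rewrite pmulr_llt0 ?invr_gt0// subr_lt0.
by rewrite ltr_pdivlMr// mul1r ltrBrDl.
Qed.

Lemma ramp_itv x d s : 0 <= ramp x d s <= 1.
Proof. exact: step_itv. Qed.

Lemma ramp_test x y d : x < y -> 0 < d ->
  test_function (ramp x d \- ramp y d).
Proof.
move=> xy d0; split.
  have H : smooth (ramp x d \- ramp y d).
    apply/smoothP => n.
    have -> : ramp x d \- ramp y d = ramp x d \+ (cst (-1) \* ramp y d).
      by apply/funext => s; rewrite /= mulN1r.
    apply: CkD; first by apply: Ck_affine; exact: Ck_step.
    apply: CkM; first exact: Ck_cst.
    by apply: Ck_affine; exact: Ck_step.
  exact: H.
have cS : closure [set s | (ramp x d \- ramp y d) s != 0] `<=` `[x, y + d].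
  apply: (@subset_trans _ (closure `[x, y + d])).
    apply: closureS => s /=; rewrite in_itv/= => H.
    have [sx|xs] := ltP s x.
      by move: H; rewrite !ramp_le ?subrr ?eqxx// ltW// (lt_trans sx).
    have [ys|ys] := ltP (y + d) s; last by [].
    by move: H; rewrite !ramp_ge ?subrr ?eqxx ?(ltW ys)// (le_trans _ (ltW ys))// lerD2r ltW.
  have cl : closed (`[x, y + d] : set R) by exact: interval_closed.
  by move: cl => /closure_id <-.
apply: (subclosed_compact _ _ cS); first exact: closed_closure.
exact: segment_compact.
Qed.

Lemma Rintegral_dramp x d : 0 < d -> \int[mu]_(s in `[x, x + d]) (ramp x d)^`() s = 1.
Proof.
move=> d0; rewrite /Rintegral (@continuous_FTC2 _ _ (ramp x d)).
- by rewrite ramp_ge// ramp_le// -EFinB subr0.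
- by rewrite ltrDl.
- by apply: continuous_subspaceT; exact: continuous_dramp.
- split.
  + by move=> s _; have [] := is_derive_ramp x d s.
  + apply: cvg_at_right_filter; apply: differentiable_continuous.
    by apply/derivable1_diffP; have [] := is_derive_ramp x d x.
  + apply: cvg_at_left_filter; apply: differentiable_continuous.
    by apply/derivable1_diffP; have [] := is_derive_ramp x d (x + d).
- by [].
Qed.

End Ramp.

(** * Mollification at Lebesgue points *)

Section Mollify.
Context {R : realType}.
Implicit Types (f g u v : R -> R).
Local Notation mu := (@lebesgue_measure R).

Lemma lebesgue_pt_mollify f (x : R) :
  (forall a b, mu.-integrable `[a, b] (EFin \o f)) -> lebesgue_pt f x ->
  (fun n => \int[mu]_s (f s * (ramp x n.+1%:R^-1)^`() s)) @ \oo --> f x.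
Proof.
move=> If lf; have [M M0 HM] := @dstep_bound R.
have davgE (d : R) : 0 < d -> davg f x (2 * d) =
    ((4 * d)^-1 * \int[mu]_(s in ball x (2 * d)%R) `|f s - f x|)%:E.
  move=> d0; rewrite /davg /iavg lebesgue_measure_ball; last by rewrite mulr_ge0// ltW.
  rewrite inver (_ : (2 * d *+ 2) = 4 * d); last by rewrite -mulr_natl; ring.
  rewrite gt_eqF ?mulr_gt0// EFinM; congr (_ * _)%E.
  rewrite /Rintegral fineK//; apply: integrable_fin_num => //.
    exact: measurable_ball.
  have /= := @integrable_norm _ _ _ mu (ball x (2 * d)) (fun s => f s - f x).
  apply; apply: (@intgS _ _ `[x - 2 * d, x + 2 * d]) => //.
  - exact: measurable_ball.
  - by rewrite ball_itv; apply: subset_itv_oo_cc.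
  - by apply: intgB => //; exact: intg_cst.
(* The open ball of radius 2 d contains the closed interval [x, x + d]; its length 4 d accounts for
   the factor 4. *)
have key (d : R) : 0 < d ->
    `|\int[mu]_s (f s * (ramp x d)^`() s) - f x| <= 4 * M * fine (davg f x (2 * d)).
  move=> d0; rewrite (@Rintegral_support _ `[x, x + d]); last first.
    move=> s /=; rewrite in_itv/= => /negP; rewrite negb_and -!ltNge => /orP H.
    by rewrite dramp0 ?mulr0.
  have Ib : mu.-integrable `[x, x + d] (EFin \o (fun s => (ramp x d)^`() s)).
    by apply: intg_cont; exact: continuous_dramp.
  have dM s : `|(ramp x d)^`() s| <= d^-1 * M.
    rewrite dramp normrM gtr0_norm ?invr_gt0//.
    by apply: ler_wpM2l; [rewrite invr_ge0 ltW|exact: HM].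
  have Ibf (h : R -> R) : mu.-integrable `[x, x + d] (EFin \o h) ->
     mu.-integrable `[x, x + d] (EFin \o (fun s => h s * (ramp x d)^`() s)).
    move=> ih; have ic := intgZ (d^-1 * M) (measurable_itv _) (integrable_norm ih).
    apply: (le_integrable _ _ _ ic) => //.
      apply/measurable_EFinP; apply: measurable_funM.
        by have /integrableP[/measurable_EFinP] := ih.
      by have /integrableP[/measurable_EFinP] := Ib.
    move=> s _ /=; rewrite lee_fin normrM mulrC (le_trans _ (ler_norm _))//.
    exact: ler_wpM2r.
  have -> : f x = \int[mu]_(s in `[x, x + d]) (f x * (ramp x d)^`() s).
    by rewrite RintegralZl// Rintegral_dramp// mulr1.
  rewrite -RintegralB//; [|exact: Ibf|by apply: intgZ].
  have If' : mu.-integrable `[x, x + d] (EFin \o (fun s => f s - f x)).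
    by apply: intgB => //; exact: intg_cst.
  under eq_Rintegral do rewrite -mulrBl.
  apply: le_trans (le_normr_Rintegral _ _) _ => //; first exact: Ibf.
  rewrite davgE//= mulrA.
  have -> : 4 * M * (4 * d)^-1 = d^-1 * M.
    by field; rewrite gt_eqF.
  apply: (@le_trans _ _ (\int[mu]_(s in `[x, x + d]) (d^-1 * M * `|f s - f x|))).
    apply: le_Rintegral => //.
    - by have /= := integrable_norm (Ibf _ If').
    - by apply: intgZ => //; have /= := integrable_norm If'.
    - by move=> s _; rewrite normrM mulrC; exact: ler_wpM2r.
  rewrite RintegralZl//; last by have /= := integrable_norm If'.
  apply: ler_wpM2l; first by rewrite mulr_ge0 ?invr_ge0 ?ltW.
  have Ibig : mu.-integrable (ball x (2 * d)%R) (EFin \o (fun s => `|f s - f x|)).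
    have /= := @integrable_norm _ _ _ mu (ball x (2 * d)) (fun s => f s - f x).
    apply; apply: (@intgS _ _ `[x - 2 * d, x + 2 * d]) => //.
    - exact: measurable_ball.
    - by rewrite ball_itv; apply: subset_itv_oo_cc.
    - by apply: intgB => //; exact: intg_cst.
  rewrite /Rintegral fine_le//.
  - by apply: integrable_fin_num => //; have /= := integrable_norm If'.
  - by apply: integrable_fin_num => //; exact: measurable_ball.
  - apply: ge0_subset_integral => //.
    + exact: measurable_ball.
    + by have /integrableP[] := Ibig.
    + rewrite ball_itv => s /=; rewrite !in_itv/= => /andP[h1 h2].
      by apply/andP; split; lra.
apply/cvgrPdist_le => /= e e0.
have := lf => /fine_cvgP[_] /cvgrPdist_le /(_ (e / (4 * M))) /=.
rewrite divr_gt0 ?mulr_gt0// => /(_ isT) [d /= d0 Hd].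
have d2 : 0 < d / 2 by rewrite divr_gt0.
near=> n.
have n0 : 0 < n.+1%:R^-1 :> R by rewrite invr_gt0.
rewrite distrC (le_trans (key _ n0))//.
rewrite mulrC -ler_pdivlMr ?mulr_gt0//.
have := Hd (2 * n.+1%:R^-1).
rewrite /ball_ /= !sub0r !normrN mulr_gt0// gtr0_norm ?mulr_gt0// => H.
rewrite (le_trans (ler_norm _))// H//.
rewrite mulrC -ltr_pdivlMr//.
by near: n; exact: (near_infty_natSinv_lt (PosNum d2)).
Unshelve. all: by end_near. Qed.

End Mollify.

(** * Absolutely continuous representatives *)

Section Primitive.
Context {R : realType}.
Implicit Types (f g u v psi : R -> R).
Local Notation mu := (@lebesgue_measure R).

Lemma Rdominated_convergence (D : set R) (f_ : nat -> R -> R) f g :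
  measurable D -> (forall n, measurable_fun D (f_ n)) ->
  (forall s, D s -> (f_ ^~ s) @ \oo --> f s) ->
  mu.-integrable D (EFin \o g) -> (forall n s, D s -> `|f_ n s| <= g s) ->
  mu.-integrable D (EFin \o f) /\
  (fun n => \int[mu]_(s in D) f_ n s) @ \oo --> \int[mu]_(s in D) f s.
Proof.
move=> mD mf cf ig fg.
have mf0 : measurable_fun D f by exact: measurable_fun_cvg cf.
have [| | | | |i0 _ cv] := @dominated_convergence _ _ _ mu D mD
  (fun n => EFin \o f_ n) (EFin \o f) (EFin \o g).
- by move=> n; apply/measurable_EFinP; exact: mf.
- exact/measurable_EFinP.
- by apply: aeW => s Ds /=; apply: cvg_EFin; [exact: nearW|exact: cf].
- exact: ig.
- by apply: aeW => s n Ds /=; rewrite lee_fin; exact: fg.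
split => //; move: cv => /= cv; rewrite /Rintegral.
have fin : (\int[mu]_(s in D) (f s)%:E)%E \is a fin_num by exact: integrable_fin_num.
by apply: fine_cvg; rewrite fineK.
Qed.

Lemma intg_split f (a b c : R) : mu.-integrable `[a, c] (EFin \o f) ->
  a <= b -> b <= c ->
  \int[mu]_(s in `[a, c]) f s = \int[mu]_(s in `[a, b]) f s + \int[mu]_(s in `[b, c]) f s.
Proof.
move=> If ab bc.
have := @Rintegral_itvB _ f (BLeft a) (BRight c) b If; rewrite !bnd_simp => /(_ ab bc).
rewrite Rintegral_itv_obnd_cbnd; first by move=> <-; rewrite addrCA subrr addr0.
apply: (@intgS _ _ `[a, c]) => // s /=; rewrite !in_itv/= => /andP[h ->].
by rewrite andbT (le_trans ab)// ltW.
Qed.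

Lemma Rintegral_itv_cst (a b c : R) : a <= b -> \int[mu]_(s in `[a, b]) c = c * (b - a).
Proof.
rewrite le_eqVlt => /predU1P[<-|ab].
  by rewrite set_itv1 Rintegral_set1 subrr mulr0.
transitivity (c * fine (lebesgue_measure (`[a, b] : set R)%classic)).
  by apply: Rintegral_cst; exact: measurable_itv.
by rewrite lebesgue_measure_itv/= lte_fin ab.
Qed.

(** Nonnegativity of the integral of (g - m)^2, where m is the mean of g. *)
Lemma CauchySchwarz_itv g (x y : R) : x <= y -> mu.-integrable `[x, y] (EFin \o g) ->
  mu.-integrable `[x, y] (EFin \o (fun s => g s ^+ 2)) ->
  (\int[mu]_(s in `[x, y]) g s) ^+ 2 <= (y - x) * \int[mu]_(s in `[x, y]) g s ^+ 2.
Proof.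
rewrite le_eqVlt => /predU1P[<- _ _|xy Ig Ig2].
  by rewrite set_itv1 !Rintegral_set1 subrr mul0r expr0n.
set I1 := Rintegral _ _ _; set I2 := Rintegral _ _ _.
set m := I1 / (y - x).
have d0 : 0 < y - x by rewrite subr_gt0.
have : 0 <= \int[mu]_(s in `[x, y]) (g s ^+ 2 + ((- 2 * m) * g s + m ^+ 2)).
  apply: Rintegral_ge0 => s _; have := sqr_ge0 (g s - m); nra.
have Im : mu.-integrable `[x, y] (EFin \o (fun s => -2 * m * g s)) by exact: intgZ.
have Ic : mu.-integrable `[x, y] (EFin \o (fun=> m ^+ 2)) by exact: intg_cst.
rewrite RintegralD//; last exact: intgD.
rewrite RintegralD// RintegralZl// Rintegral_itv_cst ?(ltW xy)// -/I1 -/I2.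
have -> : I1 = m * (y - x) by rewrite /m divfK// gt_eqF.
nra.
Qed.

Definition primitive u g :=
  forall x y, x <= y -> u y - u x = \int[mu]_(s in `[x, y]) g s.

(** The continuous representative of an H^1 class, with its derivative as an explicit parameter.
    [H1P] and [AC_H1] translate from and to [H1]. *)
Definition AC u g := [/\ L2 u, L2 g & primitive u g].

Lemma L2_sq_itv g (a b : R) : L2 g ->
  mu.-integrable `[a, b] (EFin \o (fun s => g s ^+ 2)).
Proof. by move=> [_ Ig]; exact: intgS Ig. Qed.

Lemma L2_norm g : L2 g -> L2 (fun s => `|g s|).
Proof.
move=> Lg; apply: (L2_le _ Lg); last by move=> x; rewrite normr_id.
by apply: measurableT_comp => //; case: Lg.
Qed.

Lemma intg_norm_le g (a b : R) : L2 g -> a <= b ->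
  (\int[mu]_(s in `[a, b]) `|g s|) ^+ 2 <= (b - a) * \int[mu]_(s in `[a, b]) (g s ^+ 2).
Proof.
move=> Lg ab; apply: le_trans (CauchySchwarz_itv ab _ _) _.
- by apply: L2_integrable_itv; exact: L2_norm.
- by apply: L2_sq_itv; exact: L2_norm.
- by under eq_Rintegral do rewrite real_normK ?num_real//.
Qed.

Lemma Rintegral_subset (D E : set R) f : measurable D -> measurable E -> D `<=` E ->
  mu.-integrable E (EFin \o f) -> (forall x, E x -> 0 <= f x) ->
  \int[mu]_(s in D) f s <= \int[mu]_(s in E) f s.
Proof.
move=> mD mE DE If f0; have IfD := intgS mD mE DE If.
rewrite /Rintegral fine_le//; [exact: integrable_fin_num|exact: integrable_fin_num|].
apply: ge0_subset_integral => //; last by have /integrableP[] := If.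
Qed.

Lemma primitive_le u g (x y : R) : L2 g -> primitive u g -> x <= y ->
  (u y - u x) ^+ 2 <= (y - x) * \int[mu]_(s in `[x, y]) (g s ^+ 2).
Proof.
move=> Lg P xy; rewrite P//; apply: CauchySchwarz_itv => //.
  exact: L2_integrable_itv.
exact: L2_sq_itv.
Qed.

Lemma primitive_holder u g (x y : R) : L2 g -> primitive u g ->
  (u y - u x) ^+ 2 <= `|y - x| * \int[mu]_s (g s ^+ 2).
Proof.
move=> Lg P.
wlog xy : x y / x <= y => [H|].
  have [/H//|/ltW/H] := leP x y.
  by rewrite distrC -sqrrN opprB.
apply: le_trans (primitive_le Lg P xy) _.
rewrite ger0_norm ?subr_ge0//; apply: ler_wpM2l; first by rewrite subr_ge0.
apply: Rintegral_subset => //; [by case: Lg|by move=> s _; exact: sqr_ge0].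
Qed.

Lemma primitive_continuous u g : L2 g -> primitive u g -> continuous u.
Proof.
move=> Lg P x; apply/cvgrPdist_le => /= e e0.
set G := \int[mu]_s (g s ^+ 2).
have G0 : 0 <= G by apply: Rintegral_ge0 => s _; exact: sqr_ge0.
have d0 : 0 < e ^+ 2 / (G + 1) by rewrite divr_gt0 ?exprn_gt0// ltr_wpDl.
exists (e ^+ 2 / (G + 1)); first exact: d0.
move=> y /ltW yx.
rewrite -ler_sqr ?nnegrE//; last exact: ltW.
rewrite real_normK ?num_real//; apply: le_trans (primitive_holder _ _ Lg P) _.
apply: (@le_trans _ _ (`|x - y| * (G + 1))).
  by apply: ler_wpM2l => //; rewrite lerDl.
by rewrite -ler_pdivlMr// ltr_wpDl.
Qed.

(** A localised Sobolev inequality: u(x)^2 <= 2 u(s)^2 + 2 (u(s) - u(x))^2, averaged over s in a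
    unit interval, the increment being bounded by Cauchy-Schwarz. Being local, it gives decay at
    infinity as well as boundedness. *)
Lemma AC_sq_le u g (x : R) : AC u g ->
  u x ^+ 2 <= 2 * \int[mu]_(s in `[x, x + 1]) (u s ^+ 2 + g s ^+ 2).
Proof.
move=> A; have [Lu Lg P] := A.
set G := \int[mu]_(s in `[x, x + 1]) (g s ^+ 2).
have G0 : 0 <= G by apply: Rintegral_ge0 => s _; exact: sqr_ge0.
have x1 : x <= x + 1 by rewrite lerDl.
have pt s : x <= s <= x + 1 -> u x ^+ 2 <= 2 * (u s ^+ 2 + G).
  move=> /andP[xs sx].
  have : (u s - u x) ^+ 2 <= G.
    apply: le_trans (primitive_le Lg P xs) _.
    apply: (@le_trans _ _ (1 * \int[mu]_(s in `[x, s]) (g s ^+ 2))).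
      apply: ler_wpM2r; last by rewrite lerBlDl.
      by apply: Rintegral_ge0 => t _; exact: sqr_ge0.
    rewrite mul1r; apply: Rintegral_subset => //.
    - by move=> t /=; rewrite !in_itv/= => /andP[-> /le_trans ->].
    - exact: L2_sq_itv.
    - by move=> t _; exact: sqr_ge0.
  have := sqr_ge0 (2 * u s - u x); nra.
have Iu := L2_sq_itv x (x + 1) Lu; have Ig := L2_sq_itv x (x + 1) Lg.
have len (c : R) : \int[mu]_(s in `[x, x + 1]) c = c.
  by rewrite Rintegral_itv_cst// addrAC subrr add0r mulr1.
rewrite RintegralD// -[leLHS]len.
have -> : 2 * (\int[mu]_(s in `[x, x + 1]) (u s ^+ 2) + G) =
  \int[mu]_(s in `[x, x + 1]) (2 * (u s ^+ 2 + G)).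
  rewrite RintegralZl//; last by apply: intgD => //; exact: intg_cst.
  by rewrite RintegralD ?len//; exact: intg_cst.
apply: le_Rintegral => //; first exact: intg_cst.
by apply: intgZ => //; apply: intgD => //; exact: intg_cst.
Qed.

Lemma AC_bounded u g : AC u g -> exists B, forall x, `|u x| <= B.
Proof.
move=> A; have [Lu Lg P] := A.
set B := 2 * \int[mu]_s (u s ^+ 2 + g s ^+ 2).
exists (B + 1) => x.
have Bx : u x ^+ 2 <= B.
  apply: le_trans (AC_sq_le x A) _; rewrite ler_pM2l//.
  apply: Rintegral_subset => //.
    by apply: intgD => //; [case: Lu|case: Lg].
  by move=> s _; rewrite addr_ge0// sqr_ge0.
have B0 : 0 <= B by exact: le_trans (sqr_ge0 _) Bx.
by move: Bx; rewrite -(real_normK (num_real (u x))); have := normr_ge0 (u x); nra.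
Qed.

Lemma Rintegral_tail f : mu.-integrable setT (EFin \o f) -> (forall x, 0 <= f x) ->
  forall e : R, 0 < e -> exists2 A : R, 0 < A &
  forall x y : R, A <= x \/ y <= - A -> x <= y -> \int[mu]_(s in `[x, y]) f s <= e.
Proof.
move=> If f0 e e0.
have mf : measurable_fun setT f by have /integrableP[/measurable_EFinP] := If.
have /cvgrPdist_le /(_ e e0) [N _ /(_ N (leqnn N))] :
   (fun n => \int[mu]_(s in `[- n%:R, n%:R]) f s) @ \oo --> \int[mu]_s f s.
  under eq_fun do rewrite Rintegral_mkcond.
  apply: (proj2 (@Rdominated_convergence setT (fun n => f \_ `[- n%:R, n%:R]) f f
    measurableT _ _ If _)).
  - by move=> n; apply/measurable_restrict => //; exact: measurable_funTS.
  - move=> s _; apply: cvg_near_cst; near=> n.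
    rewrite patchE mem_set//= in_itv/= -ler_norml.
    by near: n; exact: nbhs_infty_ger.
  - move=> n s _; rewrite patchE; case: ifPn => _; rewrite ?normr0 ?ger0_norm//.
move=> /=; rewrite ger0_norm; last first.
  by rewrite subr_ge0; apply: Rintegral_subset.
(* The margin 1 makes [x, y] disjoint from the closed interval [-N, N], so that the two integrals
   add up to at most the total. *)
move=> HN; exists (N%:R + 1); first by rewrite ltr_wpDl.
move=> x y xy lexy; apply: le_trans HN; rewrite lerBrDl.
rewrite -Rintegral_setU//.
- by apply: Rintegral_subset => //; exact: measurableU.
- by apply: (@intgS _ _ setT) => //; exact: measurableU.
- rewrite disj_set2E; apply/eqP; rewrite -subset0 => s [] /=; rewrite !in_itv/=.
  have : 0 <= N%:R :> R by [].
  by move=> ? /andP[? ?] /andP[? ?]; case: xy => ?; lra.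
Unshelve. all: by end_near. Qed.

Lemma AC_vanish u g : AC u g ->
  forall e : R, 0 < e -> exists2 A : R, 0 < A & forall x, A <= `|x| -> `|u x| <= e.
Proof.
move=> A e e0; have [Lu Lg P] := A.
have [| | |B B0 HB] := @Rintegral_tail (fun s => u s ^+ 2 + g s ^+ 2) _ _ (e ^+ 2 / 2).
- by apply: intgD => //; [case: Lu|case: Lg].
- by move=> x; rewrite addr_ge0// sqr_ge0.
- by rewrite divr_gt0// exprn_gt0.
exists (B + 1); first by rewrite addr_gt0.
move=> x Bx; rewrite -ler_sqr ?nnegrE ?(ltW e0)// real_normK ?num_real//.
apply: le_trans (AC_sq_le x A) _; rewrite mulrC -ler_pdivlMr//.
apply: HB; last by rewrite lerDl.
by move: Bx; rewrite ler_normr => /orP[] ?; [left|right]; lra.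
Qed.

Lemma ramp_cvg (x s : R) :
  (fun n => ramp x n.+1%:R^-1 s) @ \oo --> ((x < s)%R%:R : R).
Proof.
apply: cvg_near_cst; have [sx|xs] := leP s x.
  by apply: nearW => n; rewrite ramp_le// invr_gt0.
have d0 : 0 < s - x by rewrite subr_gt0.
near=> n; rewrite ramp_ge ?invr_gt0// -lerBrDl ltW//.
by near: n; exact: (near_infty_natSinv_lt (PosNum d0)).
Unshelve. all: by end_near. Qed.

Lemma continuous_ramp (x d : R) : continuous (ramp x d).
Proof.
move=> s; apply: differentiable_continuous; apply/derivable1_diffP.
by have [] := is_derive_ramp x d s.
Qed.

Lemma L2_intg_cont u psi a b : L2 u -> continuous psi ->
  mu.-integrable `[a, b] (EFin \o (fun s => u s * psi s)).
Proof.
move=> Lu cpsi.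
have Ip := intg_cont a b (f := fun s => psi s ^+ 2).
have {}Ip : mu.-integrable `[a, b] (EFin \o (fun s => psi s ^+ 2)).
  by apply: Ip => x; apply: cvgM; exact: cpsi.
have Is := intgD (measurable_itv _) (L2_sq_itv a b Lu) Ip.
apply: (le_integrable _ _ _ Is) => //.
  apply/measurable_EFinP; apply: measurable_funM.
    by apply: measurable_funTS; case: Lu.
  by apply: measurable_funTS; exact: continuous_measurable_fun.
move=> s _ /=; rewrite lee_fin.
rewrite [leRHS]ger0_norm; last by rewrite addr_ge0// sqr_ge0.
rewrite normrM -(real_normK (num_real (u s))) -(real_normK (num_real (psi s))).
by have := sqr_ge0 (`|u s| - `|psi s|); have := normr_ge0 (u s);
  have := normr_ge0 (psi s); nra.
Qed.

(* The test functions are differences of mollified steps at [x] and [y]. *)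
Lemma weak_derivative_lebesgue_pt u g (x y : R) : L2 u -> L2 g ->
  is_weak_derivative u g -> lebesgue_pt u x -> lebesgue_pt u y -> x < y ->
  u y - u x = \int[mu]_(s in `[x, y]) g s.
Proof.
move=> Lu Lg W lx ly xy.
have Iu a b : mu.-integrable `[a, b] (EFin \o u) by exact: L2_integrable_itv.
pose d n : R := n.+1%:R^-1.
have d0 n : 0 < d n by rewrite invr_gt0.
have d1 n : d n <= 1 by rewrite invf_le1// ler1n.
pose phi n := ramp x (d n) \- ramp y (d n).
have Idr z n : mu.-integrable setT (EFin \o (fun s => u s * (ramp z (d n))^`() s)).
  apply: (@integrable_support _ `[z, z + d n]) => //.
    move=> s /=; rewrite in_itv/= => /negP; rewrite negb_and -!ltNge => /orP H.
    by rewrite dramp0 ?mulr0.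
  by apply: L2_intg_cont => //; exact: continuous_dramp.
have dphi n s : (phi n)^`() s = (ramp x (d n))^`() s - (ramp y (d n))^`() s.
  rewrite !derive1E; apply: deriveB.
    by have [] := is_derive_ramp x (d n) s.
  by have [] := is_derive_ramp y (d n) s.
have cl : (fun n => \int[mu]_s (u s * (phi n)^`() s)) @ \oo --> u x - u y.
  have -> : (fun n => \int[mu]_s (u s * (phi n)^`() s)) =
    (fun n => \int[mu]_s (u s * (ramp x (d n))^`() s) -
              \int[mu]_s (u s * (ramp y (d n))^`() s)).
    apply/funext => n; rewrite -RintegralB//; apply: eq_Rintegral => s _.
    by rewrite dphi mulrBr.
  by apply: cvgB; apply: lebesgue_pt_mollify.
have cr : (fun n => \int[mu]_s (g s * phi n s)) @ \oo --> \int[mu]_(s in `[x, y]) g s.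
  have supp n s : ~ `[x, y + 1]%classic s -> g s * phi n s = 0.
    move=> /=; rewrite in_itv/= => /negP; rewrite negb_and -!ltNge => /orP[sx|ys].
      by rewrite /phi /= !ramp_le ?subrr ?mulr0// ltW// (lt_trans sx).
    have := d1 n; have := d0 n => ? ?.
    by rewrite /phi /= !ramp_ge ?subrr ?mulr0//; lra.
  have -> : (fun n => \int[mu]_s (g s * phi n s)) =
            (fun n => \int[mu]_(s in `[x, y + 1]) (g s * phi n s)).
    by apply/funext => n; exact: Rintegral_support (supp n).
  (* The test functions tend to 0 at s = x and to 1 at s = y, that is, to the indicator of the
     half-open interval ]x, y]. *)
  have -> : \int[mu]_(s in `[x, y]) g s =
      \int[mu]_(s in `[x, y + 1]) (g s * ((x < s)%R%:R - (y < s)%R%:R)).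
    transitivity (\int[mu]_(s in `]x, y]) g s).
      rewrite Rintegral_itv_obnd_cbnd//; apply: (@intgS _ _ `[x, y]) => //.
        exact: subset_itv_oc_cc.
      exact: L2_integrable_itv.
    rewrite (_ : (`]x, y] : set R) = `[x, y + 1] `&` `]x, y])%classic; last first.
      apply/seteqP; split => s /=; rewrite !in_itv/=; last by case.
      by move=> /andP[h1 h2]; rewrite h1 h2 (ltW h1)/= (le_trans h2)// lerDl.
    rewrite Rintegral_mkcondr; apply: eq_Rintegral => s.
    rewrite inE/= in_itv/= => /andP[xs ys]; rewrite patchE.
    case: ifPn => [|]; rewrite ?notin_setE ?inE /= in_itv/=.
      by move=> /andP[-> h]; rewrite ltNge h subr0 mulr1.
    move=> /negP; rewrite negb_and -leNgt -ltNge => /orP[h|h].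
      have -> : s = x by apply/le_anti/andP.
      by rewrite ltxx ltNge (ltW xy) subrr mulr0.
    by rewrite h (lt_trans xy h) subrr mulr0.
  apply: (proj2 (@Rdominated_convergence `[x, y + 1] _ _ (fun s => `|g s|) _ _ _ _ _)) => //.
  - move=> n; apply: measurable_funTS; apply: measurable_funM; first by case: Lg.
    by apply: measurable_funB; apply: continuous_measurable_fun; exact: continuous_ramp.
  - move=> s _; apply: cvgM; first exact: cvg_cst.
    by apply: cvgB; exact: ramp_cvg.
  - by apply: L2_integrable_itv; exact: L2_norm.
  - move=> n s _; rewrite normrM ler_piMr//.
    have /andP[? ?] := ramp_itv x (d n) s; have /andP[? ?] := ramp_itv y (d n) s.
    by rewrite /phi /= ler_norml; apply/andP; split; lra.
have E : (fun n => \int[mu]_s (u s * (phi n)^`() s)) =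
         (fun n => - \int[mu]_s (g s * phi n s)).
  by apply/funext => n; apply: W; exact: ramp_test.
rewrite E in cl.
have := cvg_unique (@Rhausdorff R) cl (cvgN cr) => H.
by rewrite -opprB H opprK.
Qed.

Lemma ae_exists (P : R -> Prop) : (\forall x \ae mu, P x) -> exists x, P x.
Proof.
move=> [N [mN N0 PN]]; apply: contrapT => nP.
have : mu (`[0, 1] : set R)%classic = 0.
  apply: (subset_measure0 _ mN _ N0) => //.
  by move=> x _; apply: PN => Px; apply: nP; exists x.
move: (@lebesgue_measure_itv R `[0, 1]); rewrite /= lte_fin ltr01 => ->.
by move=> /eqP; rewrite -EFinB subr0 eqe oner_eq0.
Qed.

Lemma aeS (P Q : R -> Prop) : (forall x, P x -> Q x) ->
  (\forall x \ae mu, P x) -> \forall x \ae mu, Q x.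
Proof. by move=> PQ; apply: filterS; first exact: (ae_filter_ringOfSetsType mu). Qed.

Lemma aeI (P Q : R -> Prop) : (\forall x \ae mu, P x) -> (\forall x \ae mu, Q x) ->
  \forall x \ae mu, P x /\ Q x.
Proof. by move=> aP aQ; apply: filterI; first exact: (ae_filter_ringOfSetsType mu). Qed.

Lemma ae_integral f g : measurable_fun setT f -> measurable_fun setT g ->
  f = g %[ae mu] -> (\int[mu]_x (f x)%:E = \int[mu]_x (g x)%:E)%E.
Proof.
move=> mf mg fg; apply: ae_eq_integral => //; [exact/measurable_EFinP..|].
by apply: aeS fg => x /= h _; rewrite h.
Qed.

Lemma ae_Rintegral f g : measurable_fun setT f -> measurable_fun setT g ->
  f = g %[ae mu] -> \int[mu]_x f x = \int[mu]_x g x.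
Proof. by move=> mf mg fg; rewrite /Rintegral (ae_integral mf mg fg). Qed.

Lemma intg_ae f g : measurable_fun setT f -> mu.-integrable setT (EFin \o g) ->
  f = g %[ae mu] -> mu.-integrable setT (EFin \o f).
Proof.
move=> mf /integrableP[/measurable_EFinP mg ig] fg; apply/integrableP; split.
  exact/measurable_EFinP.
apply: le_lt_trans ig; rewrite le_eqVlt; apply/orP; left; apply/eqP.
apply: (@ae_integral (fun x => `|f x|) (fun x => `|g x|)).
- exact: measurableT_comp.
- exact: measurableT_comp.
- by apply: aeS fg => x /= h _; rewrite h.
Qed.

(** The primitive of g that agrees with u at one Lebesgue point agrees with u at all of them, hence
    almost everywhere. *)
Lemma H1_AC u g : L2 u -> L2 g -> is_weak_derivative u g ->
  exists2 U, AC U g & U = u %[ae mu].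
Proof.
move=> Lu Lg W.
have ael := lebesgue_differentiation (L2_locally_integrable Lu).
have [x0 lx0] := ae_exists ael.
have Ig a b : mu.-integrable `[a, b] (EFin \o g) by exact: L2_integrable_itv.
(* One of the two integrals is over an empty or one-point interval, which spares a case distinction
   on the order of [x0] and [y]. *)
pose U y := u x0 + (\int[mu]_(s in `[x0, y]) g s - \int[mu]_(s in `[y, x0]) g s).
have Rge (a b : R) : b <= a -> \int[mu]_(s in `[a, b]) g s = 0.
  rewrite le_eqVlt => /predU1P[->|ba]; first by rewrite set_itv1 Rintegral_set1.
  by rewrite set_itv_ge ?Rintegral_set0// bnd_simp -ltNge.
have PU : primitive U g.
  move=> x y xy; rewrite /U opprD addrACA subrr add0r.
  have [x0x|xx0] := leP x0 x.
    rewrite (Rge y x0); last exact: le_trans xy.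
    rewrite (Rge x x0)// !subr0.
    by rewrite (@intg_split _ x0 x y)// addrAC subrr add0r.
  have [yx0|x0y] := leP y x0.
    rewrite (Rge x0 y)// (Rge x0 x) ?(ltW xx0)// !sub0r opprK.
    by rewrite (@intg_split _ x y x0)//; ring.
  rewrite (Rge y x0) ?(ltW x0y)// (Rge x0 x) ?(ltW xx0)// subr0 sub0r opprK.
  by rewrite (@intg_split _ x x0 y) ?ltW// addrC.
have aeU : U = u %[ae mu].
  apply: aeS ael => y ly _; rewrite /U.
  have [x0y|yx0|<-] := ltgtP x0 y.
  - by rewrite (Rge y x0) ?ltW// subr0 -(weak_derivative_lebesgue_pt Lu Lg W lx0 ly x0y) addrCA subrr addr0.
  - rewrite (Rge x0 y) ?ltW// sub0r -(weak_derivative_lebesgue_pt Lu Lg W ly lx0 yx0).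
    by rewrite opprB addrCA subrr addr0.
  - by rewrite set_itv1 Rintegral_set1 subrr addr0.
exists U => //; split => //.
have mU : measurable_fun setT U.
  by apply: continuous_measurable_fun; exact: primitive_continuous Lg PU.
split => //; have [mu_ iu2] := Lu.
apply: (@intg_ae _ (fun x => u x ^+ 2)) => //; first exact: measurable_funX.
by apply: aeS aeU => y; rewrite /= => + _ => ->.
Qed.

Definition C1 psi := (forall x, derivable psi x 1) /\ continuous psi^`().

Lemma C1_continuous psi : C1 psi -> continuous psi.
Proof.
by move=> [d _] x; apply: differentiable_continuous; exact/derivable1_diffP.
Qed.

Lemma C1_primitive psi : C1 psi -> primitive psi psi^`().
Proof.
move=> [d c] x y; rewrite le_eqVlt => /predU1P[<-|xy].
  by rewrite set_itv1 Rintegral_set1 subrr.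
have cp := C1_continuous (conj d c).
have LR : derivable_oo_LRcontinuous psi x y.
  split; first by move=> z _; exact: d.
    by apply: cvg_at_right_filter; exact: cp.
  by apply: cvg_at_left_filter; exact: cp.
have cw : {within `[x, y], continuous psi^`()} by exact: continuous_subspaceT.
by rewrite /Rintegral (continuous_FTC2 xy cw LR (fun z _ => erefl _)).
Qed.

Lemma Rintegral_norm_le f (x y K : R) : x <= y -> mu.-integrable `[x, y] (EFin \o f) ->
  (forall s, x <= s <= y -> `|f s| <= K) -> `|\int[mu]_(s in `[x, y]) f s| <= K * (y - x).
Proof.
move=> xy If fK; apply: le_trans (le_normr_Rintegral _ If) _ => //.
rewrite -Rintegral_itv_cst//; apply: le_Rintegral => //.
- by have := integrable_norm If.
- exact: intg_cst.
Qed.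

Lemma continuous_bound f (a b : R) : continuous f ->
  exists2 K, 0 <= K & forall s, a <= s <= b -> `|f s| <= K.
Proof.
move=> cf; have [ab|ba] := leP a b; last first.
  by exists 0 => // s /andP[h1 h2]; have := le_lt_trans (le_trans h1 h2) ba; rewrite ltxx.
have [|c _ Hc] := @EVT_max R (fun t => `|f t|) a b ab.
  apply: continuous_subspaceT => t.
  by apply: continuous_comp; [exact: cf|exact: norm_continuous].
by exists `|f c| => // s sab; apply: Hc; rewrite in_itv.
Qed.

(** The hypothesis is Hölder continuity with exponent 3/2 > 1, which forces a zero derivative.
    Composing with the projection onto [a, b] extends [F] to the line, where [is_derive_0_is_cst]
    applies. *)
Lemma clamp_cst (F : R -> R) (a b C : R) : a <= b -> 0 <= C ->
  (forall x y, a <= x -> x <= y -> y <= b -> (F y - F x) ^+ 2 <= C * (y - x) ^+ 3) ->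
  F a = F b.
Proof.
move=> ab C0 H.
pose cl t : R := Num.max a (Num.min b t).
have cla : cl a = a by rewrite /cl (min_idPr ab) maxxx.
have clb : cl b = b by rewrite /cl minxx (max_idPr ab).
rewrite -cla -clb; apply: (@is_derive_0_is_cst _ (F \o cl)) => x.
have lip s t : s <= t -> [/\ a <= cl s, cl s <= cl t, cl t <= b & cl t - cl s <= t - s].
  move=> st; rewrite /cl; have [h1|h1] := leP b s; have [h2|h2] := leP b t;
  rewrite ?(max_idPr ab); try (have [h3|h3] := leP a s); try (have [h4|h4] := leP a t);
  split; lra.
have main s t : s <= t -> (F (cl t) - F (cl s)) ^+ 2 <= C * (t - s) ^+ 3.
  move=> /lip[h1 h2 h3 h4]; apply: le_trans (H _ _ h1 h2 h3) _.
  by apply: ler_wpM2l => //; apply: lerXn2r; rewrite ?nnegrE; lra.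
apply: is_derive_eps => e e0; exists (e ^+ 2 / (C + 1)).
  by rewrite divr_gt0 ?exprn_gt0// ltr_wpDl.
move=> y; rewrite ltr_pdivlMr ?ltr_wpDl// => yx.
rewrite mulr0 subr0 /= -ler_sqr ?nnegrE ?mulr_ge0 ?(ltW e0)//.
rewrite real_normK ?num_real//.
apply: (@le_trans _ _ (C * `|y - x| ^+ 3)).
  have [xy|/ltW yx'] := leP x y.
    by rewrite ger0_norm ?subr_ge0//; exact: main.
  by rewrite distrC -sqrrN opprB ger0_norm ?subr_ge0//; exact: main.
have n0 := normr_ge0 (y - x); rewrite exprMn exprSr mulrA mulrAC.
apply: ler_wpM2r; first exact: exprn_ge0.
nra.
Qed.

(** Since g is only square integrable, u psi has no pointwise product rule. Instead, the defect F of
    the formula has increments of order (y - x) int |g| over [x, y], which is O((y - x)^(3/2)), and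
    [clamp_cst] makes it constant. *)
Lemma integration_by_parts_primitive u g psi (a b : R) : L2 g -> primitive u g -> C1 psi ->
  a <= b ->
  \int[mu]_(s in `[a, b]) (u s * psi^`() s) =
    u b * psi b - u a * psi a - \int[mu]_(s in `[a, b]) (g s * psi s).
Proof.
move=> Lg Pu psi1 ab; have [dpsi cdpsi] := psi1.
have cu := primitive_continuous Lg Pu; have cpsi := C1_continuous psi1.
have Ppsi := C1_primitive psi1.
have Iup x y : mu.-integrable `[x, y] (EFin \o (fun s => u s * psi^`() s)).
  by apply: intg_cont => s; apply: cvgM; [exact: cu|exact: cdpsi].
have Igp x y : mu.-integrable `[x, y] (EFin \o (fun s => g s * psi s)).
  exact: L2_intg_cont.
have Ig x y : mu.-integrable `[x, y] (EFin \o g) by exact: L2_integrable_itv.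
have Ipsi x y : mu.-integrable `[x, y] (EFin \o psi^`()) by exact: intg_cont.
pose h s := u s * psi^`() s + g s * psi s.
have Ih x y : mu.-integrable `[x, y] (EFin \o h) by apply: intgD.
pose F y := \int[mu]_(s in `[a, y]) h s - u y * psi y.
have [K K0 HK] := continuous_bound a b cdpsi.
pose G := \int[mu]_s (g s ^+ 2).
have G0 : 0 <= G by apply: Rintegral_ge0 => s _; exact: sqr_ge0.
suff FE : F a = F b.
  move: FE; rewrite /F set_itv1 Rintegral_set1 sub0r /h RintegralD// => FE.
  by apply/eqP; rewrite -subr_eq0; apply/eqP; lra.
apply: (@clamp_cst F a b (4 * K ^+ 2 * G)) => //.
  by rewrite !mulr_ge0// exprn_ge0.
move=> x y ax xy yb.
set J := \int[mu]_(s in `[x, y]) `|g s|.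
have In x' y' : mu.-integrable `[x', y'] (EFin \o (fun s => `|g s|)).
  by have := integrable_norm (Ig x' y').
have J0 : 0 <= J by apply: Rintegral_ge0.
have JG : J ^+ 2 <= (y - x) * G.
  apply: le_trans (intg_norm_le Lg xy) _; apply: ler_wpM2l; first by rewrite subr_ge0.
  by apply: Rintegral_subset => //; [case: Lg|move=> s _; exact: sqr_ge0].
suff HF : `|F y - F x| <= 2 * K * (y - x) * J.
  have yx0 : 0 <= y - x by rewrite subr_ge0.
  rewrite -(real_normK (num_real (F y - F x))).
  apply: (@le_trans _ _ ((2 * K * (y - x) * J) ^+ 2)).
    by apply: lerXn2r; rewrite ?nnegrE// !mulr_ge0.
  rewrite [leLHS](_ : _ = 4 * K ^+ 2 * (y - x) ^+ 2 * J ^+ 2); last by ring.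
  rewrite [leRHS](_ : _ = 4 * K ^+ 2 * (y - x) ^+ 2 * ((y - x) * G)); last by ring.
  by apply: ler_wpM2l => //; rewrite !mulr_ge0// exprn_ge0.
have Iu1 : mu.-integrable `[x, y] (EFin \o (fun s => u x * psi^`() s)) by exact: intgZ.
have Ig1 : mu.-integrable `[x, y] (EFin \o (fun s => psi y * g s)) by exact: intgZ.
(* The increment of u psi splits exactly as u(x) (psi(y) - psi(x)) + psi(y) (u(y) - u(x)), so that
   the remaining integrand contains only products of small factors. *)
have E : F y - F x = \int[mu]_(s in `[x, y]) (h s - (u x * psi^`() s + psi y * g s)).
  rewrite RintegralB//; last exact: intgD.
  have -> : \int[mu]_(s in `[x, y]) (u x * psi^`() s + psi y * g s) =
      u x * (psi y - psi x) + psi y * (u y - u x).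
    by rewrite RintegralD// !RintegralZl// -(Ppsi x y xy) -(Pu x y xy).
  by rewrite /F (@intg_split _ a x y)//; ring.
have Id : mu.-integrable `[x, y] (EFin \o (fun s => h s - (u x * psi^`() s + psi y * g s))).
  by apply: intgB => //; exact: intgD.
rewrite E; apply: le_trans (le_normr_Rintegral _ Id) _ => //.
have -> : 2 * K * (y - x) * J = \int[mu]_(s in `[x, y]) (J * K + (K * (y - x)) * `|g s|).
  rewrite RintegralD ?Rintegral_itv_cst ?RintegralZl//; [|exact: intg_cst|exact: intgZ].
  by rewrite -/J; ring.
apply: le_Rintegral => //.
- by have := integrable_norm Id.
- by apply: intgD => //; [exact: intg_cst|exact: intgZ].
move=> s; rewrite /= in_itv/= => /andP[xs sy].
have -> : h s - (u x * psi^`() s + psi y * g s) =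
  (u s - u x) * psi^`() s + g s * (psi s - psi y) by rewrite /h; ring.
have sab : a <= s <= b by rewrite (le_trans ax xs) (le_trans sy yb).
apply: le_trans (ler_normD _ _) _; apply: lerD; rewrite normrM.
  apply: ler_pM => //; last exact: HK.
  rewrite Pu//; apply: le_trans (le_normr_Rintegral _ (Ig _ _)) _ => //.
  apply: Rintegral_subset => // t /=; rewrite !in_itv/= => /andP[-> h2].
  by rewrite (le_trans h2).
rewrite mulrC; apply: ler_wpM2r => //; rewrite distrC (Ppsi s y sy).
apply: (@le_trans _ _ (K * (y - s))).
  apply: Rintegral_norm_le => // t /andP[st ty]; apply: HK.
  by case/andP: sab => as_ _; rewrite (le_trans as_ st) (le_trans ty yb).
by apply: ler_wpM2l => //; lra.
Qed.

Lemma test_C1 phi : test_function phi -> C1 phi.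
Proof.
move=> [H _]; split; first exact: (H 0%N).
by move=> x; apply: differentiable_continuous; apply/derivable1_diffP; exact: (H 1%N).
Qed.

Lemma test_support phi : test_function phi ->
  exists2 A : R, 0 <= A & forall s, A <= `|s| -> phi s = 0 /\ phi^`() s = 0.
Proof.
move=> [H cphi]; have [M [Mr HM]] := compact_bounded cphi.
have HM0 s : `|M| + 1 < `|s| -> phi s = 0.
  move=> Ms; apply/eqP; apply: contrapT => /negP ps.
  have := HM (`|M| + 1) _ s; rewrite (le_lt_trans (ler_norm M)) ?ltrDl// => /(_ isT) /=.
  move=> /(_ (@subset_closure _ _ s ps)).
  by rewrite leNgt Ms.
exists (`|M| + 2); first by rewrite addr_ge0.
move=> s Ms; have Ms1 : `|M| + 1 < `|s| by lra.
split; first exact: HM0.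
rewrite derive1E.
have -> : 'D_1 phi s = 'D_1 (cst 0 : R -> R) s.
  apply: near_eq_derive; near=> t; apply: HM0.
  near: t; apply: (cvgr_gt (`|s|)) => //.
  exact: norm_continuous.
by rewrite derive_cst.
Unshelve. all: by end_near. Qed.

Lemma AC_weak u g : AC u g -> is_weak_derivative u g.
Proof.
move=> [Lu Lg Pu] phi tphi; have [A A0 HA] := test_support tphi.
have out s : ~ `[- A, A]%classic s -> A <= `|s|.
  by rewrite /= in_itv/= -ler_norml => /negP; rewrite -ltNge => /ltW.
rewrite (@Rintegral_support _ `[- A, A]); last first.
  by move=> s /out /HA[_ ->]; rewrite mulr0.
rewrite (@Rintegral_support _ `[- A, A] (fun s => g s * phi s)); last first.
  by move=> s /out /HA[-> _]; rewrite mulr0.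
rewrite (integration_by_parts_primitive Lg Pu (test_C1 tphi)); last by lra.
have [-> _] := HA A (ler_norm A); have [-> _] : phi (- A) = 0 /\ phi^`() (- A) = 0.
  by apply: HA; rewrite normrN ler_norm.
by rewrite !mulr0 subrr sub0r.
Qed.

Lemma dramp_test (x d : R) : 0 < d -> test_function (ramp x d)^`().
Proof.
move=> d0; split.
  have H : smooth (ramp x d) by apply/smoothP => n; apply: Ck_affine; exact: Ck_step.
  by move=> n t; rewrite -derive1Sn; exact: H.
have cS : closure [set s | (ramp x d)^`() s != 0] `<=` `[x, x + d].
  apply: (@subset_trans _ (closure `[x, x + d])).
    apply: closureS => s /=; rewrite in_itv/=; apply: contraNT.
    by rewrite negb_and -!ltNge => /orP H; rewrite dramp0.
  have cl : closed (`[x, x + d] : set R) by exact: interval_closed.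
  by move: cl => /closure_id <-.
apply: (subclosed_compact _ _ cS); first exact: closed_closure.
exact: segment_compact.
Qed.

(** The mollifying kernels are themselves test functions. At a Lebesgue point of g1 - g2 the
    mollified values are all 0 and converge to the value there. *)
Lemma weak_unique u g1 g2 : L2 g1 -> L2 g2 -> is_weak_derivative u g1 ->
  is_weak_derivative u g2 -> g1 = g2 %[ae mu].
Proof.
move=> L1 L2' W1 W2.
have [L3 _] : L2 (fun s => g1 s - g2 s) /\ True.
  split=> //; have := L2D L1 (L2Z (-1) L2').
  by under [X in L2 X -> _]funext do rewrite mulN1r.
have := lebesgue_differentiation (L2_locally_integrable L3).
apply: aeS => x lx _; apply/eqP; rewrite -subr_eq0; apply/eqP.
have cv := lebesgue_pt_mollify (fun a b => L2_integrable_itv a b L3) lx.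
apply: (cvg_unique (@Rhausdorff R) cv).
rewrite (_ : (fun n => _) = cst 0); first exact: cvg_cst.
apply/funext => n /=; have d0 : 0 < n.+1%:R^-1 :> R by rewrite invr_gt0.
have t := dramp_test x d0.
have Ii g : L2 g -> mu.-integrable setT (EFin \o (fun s => g s * (ramp x n.+1%:R^-1)^`() s)).
  move=> Lg; apply: (@integrable_support _ `[x, x + n.+1%:R^-1]) => //.
    move=> s /=; rewrite in_itv/= => /negP; rewrite negb_and -!ltNge => /orP H.
    by rewrite dramp0 ?mulr0.
  by apply: L2_intg_cont => //; exact: continuous_dramp.
under eq_Rintegral do rewrite mulrBl.
rewrite RintegralB//; [|exact: Ii..].
by apply/eqP; rewrite subr_eq0 -eqr_opp -W1// -W2.
Qed.

Lemma H1P u : H1 u -> exists2 U, AC U (weak_derivative u) & U = u %[ae mu].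
Proof.
move=> [/L2P Lu [g Lg Wg]].
have [/L2P Lw Ww] := @xgetPex _ (cst 0 : R -> R)
  [set g : R -> R | g \in Lfun mu 2%:E /\ is_weak_derivative u g] (ex_intro _ g (conj Lg Wg)).
exact: H1_AC.
Qed.

(** [weak_derivative] is an arbitrary choice; uniqueness identifies it almost everywhere with the
    given derivative. *)
Lemma AC_H1 u g : AC u g -> H1 u /\ weak_derivative u = g %[ae mu].
Proof.
move=> A; have [Lu Lg Pu] := A; have Wg := AC_weak A.
have [/L2P Lw Ww] := @xgetPex _ (cst 0 : R -> R)
  [set g : R -> R | g \in Lfun mu 2%:E /\ is_weak_derivative u g]
  (ex_intro _ g (conj (proj2 (L2P g) Lg) Wg)).
split; first by split; [exact/L2P|exists g => //; exact/L2P].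
exact: weak_unique Lw Lg Ww Wg.
Qed.

End Primitive.

(** * Polarisation on a cycle *)

Section Cycle.
Variable K : nat.
Local Notation M := (K.*2).+1.
Local Notation T := 'I_M.
Implicit Types (x y c : T).

Definition dist0 x : nat := minn x (M - x).

Definition nxt x : T := x + Zp1.

Definition rfl c x : T := c - x.

Lemma val_rfl c x : rfl c x = (if x <= c then c - x else c + M - x)%N :> nat.
Proof.
rewrite /rfl /= modnDmr; have := ltn_ord x; have := ltn_ord c => cM xM.
case: leqP => xc.
  have -> : (c + (M - x) = (c - x) + M)%N by lia.
  by rewrite modnDr modn_small//; lia.
by rewrite modn_small; lia.
Qed.

Lemma rfl_cases c x : (x <= c /\ rfl c x = c - x :> nat \/
  c < x /\ rfl c x = c + M - x :> nat)%N.
Proof. by rewrite val_rfl; case: leqP => h; [left|right]. Qed.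

Hypothesis K0 : (0 < K)%N.

Lemma val_nxt x : nxt x = (if x.+1 < M then x.+1 else 0)%N :> nat.
Proof.
have := ltn_ord x => xM; rewrite /= (@modn_small 1); last by lia.
case: ltnP => h; first by rewrite modn_small; lia.
have -> : (x + 1 = M)%N by lia.
by rewrite modnn.
Qed.

Lemma nxt_cases x : (x.+1 < M /\ nxt x = x.+1 :> nat \/ x.+1 = M /\ nxt x = 0 :> nat)%N.
Proof.
rewrite val_nxt; have := ltn_ord x; case: (ltnP x.+1 M) => h ?; first by left.
by right; split => //; apply/eqP; rewrite eqn_leq h andbT.
Qed.

(** [dist0] identifies x only with -x, and c - x = -x would force c = 0. The reflection with c = 0
    fixes the origin and preserves all distances, hence its exclusion throughout. *)
Lemma dist0_eq c x : c != 0 -> dist0 x = dist0 (rfl c x) -> rfl c x = x.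
Proof.
move=> c0; have cv : (nat_of_ord c != 0)%N by apply: contra c0 => /eqP h; apply/eqP/ord_inj.
rewrite /dist0 => H; apply: ord_inj; move: H cv (rfl_cases c x) (ltn_ord x) (ltn_ord c).
move: (nat_of_ord (rfl c x)) (nat_of_ord x) (nat_of_ord c) => r x' c'.
by clear; lia.
Qed.

Lemma nxt_subT c x : nxt (rfl c (nxt x)) = rfl c x.
Proof. by rewrite /nxt /rfl opprD addrA subrK. Qed.

(** An edge leading directly from the half closer to the origin to the farther half straddles the
    mirror, so the reflection exchanges its ends. *)
Lemma dist0_cross c x : c != 0 ->
  (dist0 x < dist0 (rfl c x))%N -> (dist0 (rfl c (nxt x)) < dist0 (nxt x))%N ->
  nxt x = rfl c x.
Proof.
move=> c0; have cv : (nat_of_ord c != 0)%N by apply: contra c0 => /eqP h; apply/eqP/ord_inj.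
rewrite /dist0 => H1 H2; apply: ord_inj; move: H1 H2 cv.
move: (rfl_cases c x) (rfl_cases c (nxt x)) (nxt_cases x) (ltn_ord x) (ltn_ord c).
move: (nat_of_ord (rfl c (nxt x))) (nat_of_ord (rfl c x)) => r' r.
move: (nat_of_ord (nxt x)) (nat_of_ord x) (nat_of_ord c) => y' x' c'.
by clear -K0 => -[] [h1 ->] [] [h2 ->] [] [h3 e3]; rewrite ?e3 in h2 *; lia.
Qed.

Lemma dist0_cross' c x : c != 0 ->
  (dist0 (rfl c x) < dist0 x)%N -> (dist0 (nxt x) < dist0 (rfl c (nxt x)))%N ->
  nxt x = rfl c x.
Proof.
move=> c0; have cv : (nat_of_ord c != 0)%N by apply: contra c0 => /eqP h; apply/eqP/ord_inj.
rewrite /dist0 => H1 H2; apply: ord_inj; move: H1 H2 cv.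
move: (rfl_cases c x) (rfl_cases c (nxt x)) (nxt_cases x) (ltn_ord x) (ltn_ord c).
move: (nat_of_ord (rfl c (nxt x))) (nat_of_ord (rfl c x)) => r' r.
move: (nat_of_ord (nxt x)) (nat_of_ord x) (nat_of_ord c) => y' x' c'.
by clear -K0 => -[] [h1 ->] [] [h2 ->] [] [h3 e3]; rewrite ?e3 in h2 *; lia.
Qed.

Lemma subTK c : involutive (rfl c).
Proof. by move=> x; rewrite /rfl opprB addrC subrK. Qed.

Lemma nxt_bij : injective nxt.
Proof. by move=> x y; apply: addIr. Qed.

Section Polarization.
Context {R : realType}.
Implicit Types (u v : T -> R).

(* Polarisation across the reflection [rfl c]: the larger of the two values goes
   to the site closer to the origin. *)
Definition pol c u x :=
  if (dist0 x < dist0 (rfl c x))%N then Num.max (u x) (u (rfl c x))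
  else if (dist0 (rfl c x) < dist0 x)%N then Num.min (u x) (u (rfl c x)) else u x.

Lemma sum_reflect c (F : T -> R) : \sum_x F x = 2^-1 * \sum_x (F x + F (rfl c x)).
Proof.
have E : \sum_x F (rfl c x) = \sum_x F x by rewrite [RHS](reindex_inj (inv_inj (subTK c))).
rewrite big_split/= E.
by field.
Qed.

Lemma le_sum_reflect c (F G : T -> R) : (forall x, F x + F (rfl c x) <= G x + G (rfl c x)) ->
  \sum_x F x <= \sum_x G x.
Proof.
move=> H; rewrite (sum_reflect c) [leRHS](sum_reflect c).
by apply: ler_wpM2l; [rewrite invr_ge0|apply: ler_sum].
Qed.

Lemma pol_pair c u x : c != 0 ->
  [\/ [/\ (dist0 x < dist0 (rfl c x))%N, pol c u x = Num.max (u x) (u (rfl c x)) &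
        pol c u (rfl c x) = Num.min (u x) (u (rfl c x))],
      [/\ (dist0 (rfl c x) < dist0 x)%N, pol c u x = Num.min (u x) (u (rfl c x)) &
        pol c u (rfl c x) = Num.max (u x) (u (rfl c x))] |
      [/\ rfl c x = x, pol c u x = u x & pol c u (rfl c x) = u x]].
Proof.
move=> c0; rewrite /pol !subTK; case: ltngtP => [h|h|h].
- by apply: Or31; split => //; rewrite minC.
- by apply: Or32; split => //; rewrite maxC.
- apply: Or33; have := dist0_eq c0 h => e; split => //; by rewrite e.
Qed.

Lemma pol_sum c u (phi : R -> R) : c != 0 -> \sum_x phi (pol c u x) = \sum_x phi (u x).
Proof.
move=> c0; rewrite (sum_reflect c) [RHS](sum_reflect c); congr (_ * _).
apply: eq_bigr => x _; have [[_ -> ->]|[_ -> ->]|[-> -> _]//] := pol_pair u x c0.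
  by case: leP => // _; rewrite addrC.
by case: leP => // _; rewrite addrC.
Qed.

(** The two-point rearrangement inequality on each pair {x, rfl c x}: a sum of products is largest
    when both factors are ordered in the same way. *)
Lemma pol_coupling c u v (phi : R -> R) : c != 0 ->
  (forall x, 0 <= u x) -> (forall x, 0 <= v x) -> {in Num.nneg &, {homo phi : s t / s <= t}} ->
  \sum_x phi (u x) * phi (v x) <= \sum_x phi (pol c u x) * phi (pol c v x).
Proof.
move=> c0 u0 v0 phim; apply: (le_sum_reflect (c := c)) => x.
have ph s t : 0 <= s -> s <= t -> phi s <= phi t.
  by move=> s0 st; apply: phim; rewrite ?nnegrE// (le_trans s0).
have [[d -> ->]|[d -> ->]|[e -> ->]] := pol_pair u x c0;
have [[d' -> ->]|[d' -> ->]|[e' -> ->]] := pol_pair v x c0; try lia.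
- case: (leP (u x) (u (rfl c x))) => h1; case: (leP (v x) (v (rfl c x))) => h2.
  + by rewrite addrC.
  + have := ph _ _ (u0 x) h1; have := ph _ _ (v0 _) (ltW h2); nra.
  + have := ph _ _ (u0 _) (ltW h1); have := ph _ _ (v0 _) h2; nra.
  + by [].
- by move: d; rewrite e' ltnn.
- case: (leP (u x) (u (rfl c x))) => h1; case: (leP (v x) (v (rfl c x))) => h2.
  + by [].
  + have := ph _ _ (u0 x) h1; have := ph _ _ (v0 _) (ltW h2); nra.
  + have := ph _ _ (u0 _) (ltW h1); have := ph _ _ (v0 _) h2; nra.
  + by rewrite addrC.
- by move: d; rewrite e' ltnn.
- by move: d'; rewrite e ltnn.
- by move: d'; rewrite e ltnn.
- by rewrite e.
Qed.

Lemma two_point (a a' b b' : R) :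
  (Num.max b b' - Num.max a a') ^+ 2 + (Num.min b b' - Num.min a a') ^+ 2 <=
  (b - a) ^+ 2 + (b' - a') ^+ 2.
Proof. by case: (leP b b') => h1; case: (leP a a') => h2; nra. Qed.

(** Each edge is summed with its mirror image. When both ends lie in the same half this is
    [two_point]; a crossing edge is its own mirror image and keeps its squared difference; an end on
    the mirror keeps its value. *)
Lemma pol_edges c u : c != 0 ->
  \sum_x (pol c u (nxt x) - pol c u x) ^+ 2 <= \sum_x (u (nxt x) - u x) ^+ 2.
Proof.
move=> c0.
have edge (w : T -> R) : \sum_x (w (nxt x) - w x) ^+ 2 =
    2^-1 * \sum_x ((w (nxt x) - w x) ^+ 2 + (w (rfl c x) - w (rfl c (nxt x))) ^+ 2).
  rewrite big_split/=.
  have -> : \sum_x (w (rfl c x) - w (rfl c (nxt x))) ^+ 2 = \sum_x (w (nxt x) - w x) ^+ 2.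
    rewrite [RHS](reindex_inj (inv_inj (subTK c)))/= [RHS](reindex_inj nxt_bij)/=.
    by apply: eq_bigr => x _; rewrite nxt_subT.
  by field.
rewrite edge [leRHS]edge; apply: ler_wpM2l; first by rewrite invr_ge0.
apply: ler_sum => x _.
have tp := two_point (u x) (u (rfl c x)) (u (nxt x)) (u (rfl c (nxt x))).
have sw (s t : R) : (s - t) ^+ 2 = (t - s) ^+ 2 by rewrite -sqrrN opprB.
have [[d -> ->]|[d -> ->]|[e -> ->]] := pol_pair u x c0;
have [[d' -> ->]|[d' -> ->]|[e' -> ->]] := pol_pair u (nxt x) c0.
- by rewrite (sw (Num.min _ _)) (sw (u (rfl c x))).
- have E := dist0_cross c0 d d'; have E' : rfl c (nxt x) = x by rewrite E subTK.
  rewrite E' -E (minC (u (nxt x))) (maxC (u (nxt x))); case: (leP (u x)) => _; lra.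
- rewrite e'; case: (leP (u x)) => _; lra.
- have E := dist0_cross' c0 d d'; have E' : rfl c (nxt x) = x by rewrite E subTK.
  rewrite E' -E (minC (u (nxt x))) (maxC (u (nxt x))); case: (leP (u x)) => _; lra.
- rewrite (sw (u (rfl c x))) addrC (sw (Num.max (u x) _)).
  by rewrite addrC in tp *; rewrite addrC; lra.
- rewrite e'; case: (leP (u x)) => _; lra.
- rewrite e; case: (leP (u (nxt x))) => _; lra.
- rewrite e; case: (leP (u (nxt x))) => _; lra.
- rewrite e e'; lra.
Qed.

(** Since the weight is strictly larger on the closer half, moving the larger value there strictly
    increases the sum unless the two values are already in order. The equality case is what turns a
    maximiser of the weight into a monotone function. *)
Lemma pol_weight c u (w : T -> R) : c != 0 ->
  (forall x y, (dist0 x < dist0 y)%N -> w y < w x) ->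
  \sum_x w x * u x <= \sum_x w x * pol c u x ?= iff
  [forall x, (dist0 x < dist0 (rfl c x))%N ==> (u (rfl c x) <= u x)].
Proof.
move=> c0 wd.
have pt x : w x * u x + w (rfl c x) * u (rfl c x) <=
   w x * pol c u x + w (rfl c x) * pol c u (rfl c x) ?= iff
   ((dist0 x < dist0 (rfl c x))%N ==> (u (rfl c x) <= u x)) &&
   ((dist0 (rfl c x) < dist0 x)%N ==> (u x <= u (rfl c x))).
  have [[d -> ->]|[d -> ->]|[-> -> _]] := pol_pair u x c0.
  - rewrite d ltnNge (ltnW d)/= andbT; have := wd _ _ d => wxy.
    have [h|h] := leP (u x) (u (rfl c x)); last by split; rewrite ?lexx ?eqxx ?(ltW h).
    split; first by nra.
    apply/eqP/idP => [E|h']; last by have -> : u x = u (rfl c x) by apply/le_anti/andP.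
    rewrite leNgt; apply/negP => h'.
    have : 0 < (w x - w (rfl c x)) * (u (rfl c x) - u x) by rewrite mulr_gt0 ?subr_gt0.
    by nra.
  - rewrite d ltnNge (ltnW d)/=; have := wd _ _ d => wxy.
    have [h|h] := leP (u x) (u (rfl c x)); first by split; rewrite ?lexx ?eqxx.
    split; first by nra.
    apply/negbTE/negP => /eqP E.
    have : 0 < (w (rfl c x) - w x) * (u x - u (rfl c x)) by rewrite mulr_gt0 ?subr_gt0.
    by nra.
  - by rewrite ltnn; split => //; rewrite eqxx.
have := leif_sum (fun x (_ : true) => pt x).
rewrite !big_split/=.
have E (F : T -> R) : \sum_x F (rfl c x) = \sum_x F x.
  by rewrite [RHS](reindex_inj (inv_inj (subTK c))).
rewrite (E (fun x => w x * u x)) (E (fun x => w x * pol c u x)).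
rewrite -!mulr2n => -[H1 H2]; split.
  by move: H1; rewrite ler_pMn2r.
move: H2; rewrite eqr_pMn2r// => ->.
apply/forallP/forallP => H x; have := H x; last first.
  by move=> /= ->/=; have := H (rfl c x); rewrite subTK.
by move=> /andP[].
Qed.

End Polarization.
End Cycle.

(** * The discrete variational problem *)

Section Nonlinearity.
Context {R : realType}.
Variables (q b : R).
Hypotheses (q2 : 2 <= q) (b0 : 0 < b).
Implicit Types s t : R.

Definition coupling s t :=
  `|s| `^ (2 * q) + `|t| `^ (2 * q) + 2 * b * (`|s| `^ q * `|t| `^ q).

(** The partial derivative of [coupling] in s divided by 2 q, for s > 0 and t >= 0, and the
    right-hand side of the first equation for s >= 0 ([is_derive_coupling], [force_signed]). *)
Definition force s t := `|s| `^ (2 * q - 1) + b * `|t| `^ q * `|s| `^ (q - 1).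

Lemma continuous_norm_powR (p : R) : 0 < p -> continuous (fun s => `|s| `^ p).
Proof.
move=> p0 s; have [->|s0] := eqVneq s 0.
  apply/cvgrPdist_le => /= e e0; rewrite normr0 powR0 ?gt_eqF//.
  exists (e `^ p^-1); first by rewrite /= powR_gt0.
  move=> t /=; rewrite !sub0r !normrN => te.
  rewrite ger0_norm ?powR_ge0//.
  have -> : e = (e `^ p^-1) `^ p by rewrite -powRrM mulVf ?gt_eqF// powRr1// ltW.
  by apply: ge0_ler_powR; rewrite ?nnegrE ?powR_ge0//; exact: ltW.
apply: (@continuous_comp _ _ _ (fun s : R => `|s|) (fun s => s `^ p)).
  exact: norm_continuous.
apply: differentiable_continuous; apply/derivable1_diffP; apply: derivable_powR.
by rewrite in_itv/= andbT normr_gt0.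
Qed.

Let q0 : 0 < q. Proof. exact: lt_le_trans q2. Qed.
Let q20 : 0 < 2 * q. Proof. by rewrite mulr_gt0. Qed.
Let q1 : 0 < q - 1. Proof. by rewrite subr_gt0; apply: lt_le_trans q2; rewrite ltr1n. Qed.
Let q21 : 0 < 2 * q - 1. Proof. move: q2; lra. Qed.
Let q22 : 0 <= 2 * q - 2. Proof. move: q2; lra. Qed.
Let q2' : 0 <= q - 2. Proof. by rewrite subr_ge0. Qed.

Lemma coupling_ge0 s t : 0 <= coupling s t.
Proof. by rewrite /coupling !addr_ge0 ?mulr_ge0 ?powR_ge0// ltW. Qed.

Lemma couplingC s t : coupling s t = coupling t s.
Proof. by rewrite /coupling; ring. Qed.

Lemma coupling_le s t s' t' : `|s| <= `|s'| -> `|t| <= `|t'| ->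
  coupling s t <= coupling s' t'.
Proof.
move=> ss tt; have mono (p x y : R) : 0 <= p -> `|x| <= `|y| -> `|x| `^ p <= `|y| `^ p.
  by move=> p0 xy; apply: ge0_ler_powR.
rewrite /coupling; apply: lerD; first by apply: lerD; apply: mono => //; exact: ltW.
apply: ler_wpM2l; first by rewrite mulr_ge0// ltW.
by apply: ler_pM; rewrite ?powR_ge0//; apply: mono => //; exact: ltW.
Qed.

Lemma couplingZ (c s t : R) : 0 <= c -> coupling (c * s) (c * t) = c `^ (2 * q) * coupling s t.
Proof.
move=> c0; rewrite /coupling !normrM (ger0_norm c0) !powRM//.
have -> : c `^ (2 * q) = c `^ q * c `^ q by rewrite mulrC powRrM powR_mulrn ?powR_ge0.
by ring.
Qed.

Lemma coupling00 : coupling 0 0 = 0.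
Proof. by rewrite /coupling !normr0 !powR0 ?gt_eqF//; ring. Qed.

Lemma coupling_cvg (T : Type) (F : set_system T) (f g : T -> R) (s t : R) : Filter F ->
  f @ F --> s -> g @ F --> t -> (fun x => coupling (f x) (g x)) @ F --> coupling s t.
Proof.
move=> FF fs gt; have cp (p : R) (h : T -> R) (l : R) : 0 < p -> h @ F --> l ->
    (fun x => `|h x| `^ p) @ F --> `|l| `^ p.
  move=> p0 hl; apply: (@cvg_comp _ _ _ h (fun x => `|x| `^ p) _ _ _ hl).
    exact: continuous_norm_powR.
apply: cvgD; first by apply: cvgD; exact: cp.
apply: cvgM; first exact: cvg_cst.
by apply: cvgM; exact: cp.
Qed.

Lemma force_cvg (T : Type) (F : set_system T) (f g : T -> R) (s t : R) : Filter F ->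
  f @ F --> s -> g @ F --> t -> (fun x => force (f x) (g x)) @ F --> force s t.
Proof.
move=> FF fs gt; have cp (p : R) (h : T -> R) (l : R) : 0 < p -> h @ F --> l ->
    (fun x => `|h x| `^ p) @ F --> `|l| `^ p.
  move=> p0 hl; apply: (@cvg_comp _ _ _ h (fun x => `|x| `^ p) _ _ _ hl).
    exact: continuous_norm_powR.
apply: cvgD; first exact: cp.
apply: cvgM; last exact: cp.
by apply: cvgM; [exact: cvg_cst|exact: cp].
Qed.

Lemma force_ge0 s t : 0 <= force s t.
Proof. by rewrite /force addr_ge0 ?mulr_ge0 ?powR_ge0// ltW. Qed.

Lemma force_le s t s' t' : `|s| <= `|s'| -> `|t| <= `|t'| -> force s t <= force s' t'.
Proof.
move=> ss tt; have mono (p x y : R) : 0 <= p -> `|x| <= `|y| -> `|x| `^ p <= `|y| `^ p.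
  by move=> p0 xy; apply: ge0_ler_powR.
rewrite /force; apply: lerD; first by apply: mono => //; exact: ltW.
apply: ler_pM; rewrite ?mulr_ge0 ?powR_ge0 ?(ltW b0)//; last by apply: mono => //; exact: ltW.
by apply: ler_wpM2l; [exact: ltW|apply: mono => //; exact: ltW].
Qed.

Lemma force0 t : force 0 t = 0.
Proof. by rewrite /force normr0 !powR0 ?mulr0 ?addr0// gt_eqF. Qed.

(** Both terms contain a factor s, and the remaining exponents 2 q - 2 and q - 2 are nonnegative.
    The linear bound makes the source square integrable, feeds the positivity argument, and bounds
    amplitudes from below. *)
Lemma force_lin (B s t : R) : 0 <= s <= B -> 0 <= t <= B ->
  force s t <= (1 + b) * B `^ (2 * q - 2) * s.
Proof.
move=> /andP[s0 sB] /andP[t0 tB].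
have [->|sn0] := eqVneq s 0; first by rewrite force0 mulr0.
have sp : 0 < s by rewrite lt_neqAle eq_sym sn0.
rewrite /force !ger0_norm//.
have eS (p : R) : s `^ (p + 1) = s `^ p * s.
  by rewrite powRD ?(negbTE sn0) ?implybT// powRr1.
have e1 : s `^ (2 * q - 1) = s `^ (2 * q - 2) * s by rewrite -eS; congr (_ `^ _); ring.
have e2 : s `^ (q - 1) = s `^ (q - 2) * s by rewrite -eS; congr (_ `^ _); ring.
have Bp : 0 < B by exact: lt_le_trans sB.
have e3 : B `^ (2 * q - 2) = B `^ q * B `^ (q - 2).
  by rewrite -powRD; [congr (_ `^ _); ring|rewrite (gt_eqF Bp) implybT].
have h1 : s `^ (2 * q - 2) <= B `^ (2 * q - 2).
  by apply: ge0_ler_powR; rewrite ?nnegrE ?(ltW sp) ?(ltW Bp).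
have h2 : t `^ q <= B `^ q by apply: ge0_ler_powR; rewrite ?nnegrE ?(ltW q0) ?(ltW Bp).
have h3 : s `^ (q - 2) <= B `^ (q - 2).
  by apply: ge0_ler_powR; rewrite ?nnegrE ?(ltW sp) ?(ltW Bp).
rewrite e1 e2 mulrA -mulrDl; apply: ler_wpM2r => //.
rewrite [leRHS]mulrDl mul1r; apply: lerD => //.
rewrite e3 -mulrA; apply: ler_wpM2l; first exact: ltW.
by apply: ler_pM => //; exact: powR_ge0.
Qed.

Lemma is_derive_coupling s t : 0 < s -> 0 <= t ->
  is_derive s 1 (fun s => coupling s t) (2 * q * force s t).
Proof.
move=> s0 t0.
pose pw (p : R) : R -> R := fun x => x `^ p.
pose f : R -> R := pw (2 * q) + cst (t `^ (2 * q)) + (2 * b * t `^ q) \*: pw q.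
apply: (@near_eq_is_derive _ _ _ f).
  near=> x; have x0 : 0 <= x by near: x; apply: filterS (lt_nbhsr s0) => z /ltW.
  rewrite /f /coupling !ger0_norm// /GRing.scale/=.
  transitivity (x `^ (2 * q) + t `^ (2 * q) + 2 * b * t `^ q * x `^ q); first by [].
  by ring.
have d1 : is_derive s 1 (pw (2 * q)) _ := is_derive1_powR (2 * q) s0.
have d2 : is_derive s 1 (pw q) _ := is_derive1_powR q s0.
rewrite /f; apply: is_derive_eq.
rewrite /force (gtr0_norm s0) (ger0_norm t0) /GRing.scale/=.
transitivity (2 * q * s `^ (2 * q - 1) + 0 + 2 * b * t `^ q * (q * s `^ (q - 1))); first by [].
by ring.
Unshelve. all: by end_near. Qed.

End Nonlinearity.

Lemma local_min_derive {R : realType} (f : R -> R) (c D : R) : is_derive c 1 f D ->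
  (\forall y \near c, f c <= f y) -> D = 0.
Proof.
move=> [fd <-] [d /= d0 fm]; apply/eqP; rewrite eq_le; apply/andP; split.
  rewrite ['D_1 f c]cvg_at_leftE; last exact: fd.
  apply: limr_le.
    rewrite -(cvg_at_leftE (fun h => h^-1 *: ((f \o shift c) _ - f c)))//.
    apply: cvg_trans fd; apply: cvg_app => A [e e0 Ae]; exists e => // x xe x0.
    by apply: Ae => //; exact: ltr0_neq0.
  near=> h; apply: mulr_le0_ge0.
    by rewrite invr_le0; apply: ltW; near: h; exists 1 => /=.
  rewrite subr_ge0 [_%:A]mulr1 /=; apply: fm; rewrite /= opprD addrCA subrr addr0 normrN.
  by near: h; exists d => // z; rewrite /= sub0r normrN.
rewrite ['D_1 f c]cvg_at_rightE; last exact: fd.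
apply: limr_ge.
  rewrite -(cvg_at_rightE (fun h => h^-1 *: ((f \o shift c) _ - f c)))//.
  apply: cvg_trans fd; apply: cvg_app => A [e e0 Ae]; exists e => // x xe x0.
  by apply: Ae => //; exact: lt0r_neq0.
near=> h; apply: mulr_ge0.
  by rewrite invr_ge0; apply: ltW; near: h; exists 1 => /=.
rewrite subr_ge0 [_%:A]mulr1 /=; apply: fm; rewrite /= opprD addrCA subrr addr0 normrN.
by near: h; exists d => // z; rewrite /= sub0r normrN.
Unshelve. all: by end_near. Qed.

(** * Lattice energies, their Euler-Lagrange equation and a monotone minimiser *)

Section DiscreteProblem.
Context {R : realType}.
Variables (q b : R).
Hypotheses (q2 : 2 <= q) (b0 : 0 < b).
Variables (K : nat) (h : R).
Hypotheses (K0 : (0 < K)%N) (h0 : 0 < h).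
Local Notation M := (K.*2).+1.
Local Notation T := 'I_M.
Implicit Types (u v : T -> R) (a : R) (x : T).
Local Notation G := (coupling q b).

Definition prv x : T := x - Zp1.

Lemma nxtK : cancel (@nxt K) prv. Proof. by move=> x; rewrite /nxt /prv addrK. Qed.
Lemma prvK : cancel prv (@nxt K). Proof. by move=> x; rewrite /nxt /prv subrK. Qed.

Definition quad a u := h * \sum_x (a * u x ^+ 2) + h^-1 * \sum_x (u (nxt x) - u x) ^+ 2.

Definition Fh u v := h * \sum_x G (u x) (v x).

Lemma quad_ge0 a u : 0 <= a -> 0 <= quad a u.
Proof.
move=> a0; rewrite /quad addr_ge0// mulr_ge0 ?invr_ge0 ?(ltW h0)//; apply: sumr_ge0 => x _.
  by rewrite mulr_ge0// sqr_ge0.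
exact: sqr_ge0.
Qed.

Lemma Fh_ge0 u v : 0 <= Fh u v.
Proof. by rewrite mulr_ge0 ?(ltW h0)// sumr_ge0// => x _; exact: coupling_ge0. Qed.

Lemma FhC u v : Fh u v = Fh v u.
Proof. by rewrite /Fh; congr (_ * _); apply: eq_bigr => x _; exact: couplingC. Qed.

Lemma quadZ a (c : R) u : quad a (fun x => c * u x) = c ^+ 2 * quad a u.
Proof.
have E1 : \sum_x (a * (c * u x) ^+ 2) = c ^+ 2 * \sum_x (a * u x ^+ 2).
  by rewrite mulr_sumr; apply: eq_bigr => x _; ring.
have E2 : \sum_x (c * u (nxt x) - c * u x) ^+ 2 = c ^+ 2 * \sum_x (u (nxt x) - u x) ^+ 2.
  by rewrite mulr_sumr; apply: eq_bigr => x _; ring.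
by rewrite /quad E1 E2; ring.
Qed.

Lemma FhZ (c : R) u v : 0 <= c ->
  Fh (fun x => c * u x) (fun x => c * v x) = c `^ (2 * q) * Fh u v.
Proof.
move=> c0; rewrite /Fh mulrCA; congr (_ * _); rewrite mulr_sumr; apply: eq_bigr => x _.
exact: couplingZ.
Qed.

Lemma quad_sq_le a u x : 0 <= a -> h * a * u x ^+ 2 <= quad a u.
Proof.
move=> a0; rewrite /quad -mulrA (bigD1 x)//= mulrDr -addrA lerDl.
rewrite addr_ge0// mulr_ge0 ?invr_ge0 ?(ltW h0)//; apply: sumr_ge0 => y _.
  by rewrite mulr_ge0// sqr_ge0.
exact: sqr_ge0.
Qed.

Lemma pol_quad a c u : c != 0 -> quad a (pol c u) <= quad a u.
Proof.
move=> c0; rewrite /quad (pol_sum u (fun s => a * s ^+ 2) c0) lerD2l.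
by apply: ler_wpM2l; [rewrite invr_ge0 ltW|exact: pol_edges].
Qed.

Lemma pol_Fh c u v : c != 0 -> (forall x, 0 <= u x) -> (forall x, 0 <= v x) ->
  Fh u v <= Fh (pol c u) (pol c v).
Proof.
move=> c0 u0 v0; rewrite /Fh; apply: ler_wpM2l; first exact: ltW.
rewrite /coupling !big_split/= !(pol_sum _ (fun s => `|s| `^ (2 * q)) c0) lerD2l.
rewrite -!mulr_sumr; apply: ler_wpM2l; first by rewrite mulr_ge0// ltW.
apply: (@pol_coupling K K0 R c u v (fun s => `|s| `^ q)) => // s t; rewrite !nnegrE => s0 t0 st.
by rewrite !ger0_norm//; apply: ge0_ler_powR; rewrite ?nnegrE//; move: q2; lra.
Qed.

Lemma pol_ge0 c u : (forall x, 0 <= u x) -> forall x, 0 <= pol c u x.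
Proof.
move=> u0 x; rewrite /pol; case: ifP => _; first by rewrite le_max u0.
by case: ifP => _ //; rewrite le_min !u0.
Qed.

Definition bump x (t : R) : T -> R := fun y => t *+ (y == x).

Lemma quad_bump a u x t : quad a (fun y => u y + bump x t y) = quad a u +
  t * (2 * h * a * u x + 2 * h^-1 * (2 * u x - u (nxt x) - u (prv x))) + t ^+ 2 * quad a (bump x 1).
Proof.
have bE y : bump x t y = t * bump x 1 y by rewrite /bump; case: (y == x); rewrite ?mulr1 ?mulr0.
have E1 : \sum_y (a * (u y + bump x t y) ^+ 2) = \sum_y (a * u y ^+ 2) +
    t * (2 * a * u x) + t ^+ 2 * \sum_y (a * bump x 1 y ^+ 2).
  have -> : 2 * a * u x = \sum_y (2 * a * u y * bump x 1 y).
    rewrite (bigD1 x)//= big1 ?addr0; first by rewrite /bump eqxx mulr1.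
    by move=> y yx; rewrite /bump (negbTE yx) mulr0.
  rewrite !mulr_sumr -!big_split/=; apply: eq_bigr => y _; rewrite bE; ring.
have E2 : \sum_y (u (nxt y) + bump x t (nxt y) - (u y + bump x t y)) ^+ 2 =
   \sum_y (u (nxt y) - u y) ^+ 2 + t * (2 * (2 * u x - u (nxt x) - u (prv x))) +
   t ^+ 2 * \sum_y (bump x 1 (nxt y) - bump x 1 y) ^+ 2.
  have -> : 2 * (2 * u x - u (nxt x) - u (prv x)) =
     \sum_y (2 * (u (nxt y) - u y) * (bump x 1 (nxt y) - bump x 1 y)).
    have S1 : \sum_y ((u (nxt y) - u y) * bump x 1 (nxt y)) = u x - u (prv x).
      rewrite (bigD1 (prv x))//= big1 ?addr0; first by rewrite prvK /bump eqxx mulr1.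
      move=> y yx; rewrite /bump; case: eqP => [e|_]; last by rewrite mulr0.
      by move: yx; rewrite -e nxtK eqxx.
    have S2 : \sum_y ((u (nxt y) - u y) * bump x 1 y) = u (nxt x) - u x.
      rewrite (bigD1 x)//= big1 ?addr0; first by rewrite /bump eqxx mulr1.
      by move=> y yx; rewrite /bump (negbTE yx) mulr0.
    transitivity (2 * (\sum_y ((u (nxt y) - u y) * bump x 1 (nxt y)) -
                       \sum_y ((u (nxt y) - u y) * bump x 1 y))).
      by rewrite S1 S2; ring.
    by rewrite -sumrB mulr_sumr; apply: eq_bigr => y _; ring.
  rewrite !mulr_sumr -!big_split/=; apply: eq_bigr => y _; rewrite !(bE _); ring.
rewrite /quad E1 E2; ring.
Qed.

Lemma Fh_bump u v x t :
  Fh (fun y => u y + bump x t y) v = Fh u v + h * (G (u x + t) (v x) - G (u x) (v x)).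
Proof.
rewrite /Fh -mulrDr (bigD1 x)//= [in RHS](bigD1 x)//= {1}/bump eqxx mulr1n.
have -> : \sum_(i | i != x) G (u i + bump x t i) (v i) = \sum_(i | i != x) G (u i) (v i).
  by apply: eq_bigr => y yx; rewrite /bump (negbTE yx) mulr0n addr0.
by congr (_ * _); ring.
Qed.

(* A vertex where u vanishes only allows one-sided variations; there both sides of the
   equation vanish by the resulting sign conditions. *)
Lemma discrete_euler_lagrange a C S u v : 0 <= a -> 0 <= S ->
  (forall x, 0 <= u x) -> (forall x, 0 <= v x) -> Fh u v = 1 -> quad a u + C = S ->
  (forall u', (forall x, 0 <= u' x) -> S * Fh u' v `^ q^-1 <= quad a u' + C) ->
  forall x, u (nxt x) - 2 * u x + u (prv x) = h ^+ 2 * (a * u x - S * force q b (u x) (v x)).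
Proof.
move=> a0 S0 u0 v0 F1 QS Hmin x.
set L := 2 * h * a * u x + 2 * h^-1 * (2 * u x - u (nxt x) - u (prv x)).
have [ux0|uxn0] := eqVneq (u x) 0.
  have L0 : 0 <= L.
    rewrite leNgt; apply/negP => L0.
    have Q0 : 0 <= quad a (bump x 1) by exact: quad_ge0.
    (* With Q = [quad a (bump x 1)], this choice gives t L + t^2 Q = t L / 2 - t^2 < 0. As raising u
       at x from 0 cannot decrease [Fh], minimality is violated. *)
    pose t := - L / (quad a (bump x 1) + 1) / 2.
    have t0 : 0 < t by rewrite /t !divr_gt0 ?oppr_gt0// ltr_wpDl.
    have := Hmin (fun y => u y + bump x t y).
    rewrite quad_bump Fh_bump F1 -/L => H.
    have {}H : S <= quad a u + t * L + t ^+ 2 * quad a (bump x 1) + C.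
      apply: le_trans (H _); last first.
        by move=> y; rewrite addr_ge0// mulrn_wge0// ltW.
      rewrite -[leLHS]mulr1; apply: ler_wpM2l => //.
      rewrite -[leLHS](_ : 1 `^ q^-1 = 1 :> R); last by rewrite powR1.
      apply: ge0_ler_powR; rewrite ?nnegrE//.
      - by rewrite invr_ge0; move: q2; lra.
      - rewrite addr_ge0// mulr_ge0 ?(ltW h0)// subr_ge0 ux0 add0r.
        by apply: coupling_le => //; rewrite normr0.
      - rewrite lerDl mulr_ge0 ?(ltW h0)// subr_ge0 ux0 add0r.
        by apply: coupling_le => //; rewrite normr0.
    have tQ : t * (quad a (bump x 1) + 1) = - L / 2.
      by rewrite /t; field; rewrite gt_eqF// ltr_wpDl.
    have : t * (t * (quad a (bump x 1) + 1)) = t * (- L / 2) by rewrite tQ.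
    have := mulr_gt0 t0 t0; have : t * L < 0 by rewrite pmulr_rlt0.
    by nra.
  (* At u x = 0 the slope L is a negative multiple of the sum of the two neighbouring values, so
     both of these vanish. *)
  have := L0; rewrite /L ux0 !mulr0 add0r sub0r -opprD mulrN oppr_ge0.
  have h1 : 0 < 2 * h^-1 by rewrite mulr_gt0// invr_gt0.
  rewrite pmulr_rle0// => le0.
  have := u0 (nxt x); have := u0 (prv x) => p1 p2.
  have -> : u (nxt x) = 0 by lra.
  have -> : u (prv x) = 0 by lra.
  by rewrite force0// !mulr0 subrr mulr0; ring.
have ux : 0 < u x by rewrite lt_neqAle eq_sym uxn0 u0.
(* The deficit in the inequality along a variation at x: nonnegative near t = 0 and zero at t = 0.
   Positivity of u x leaves room for both signs of t. *)
pose phi := fun t : R => quad a (fun y => u y + bump x t y) + C -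
  S * Fh (fun y => u y + bump x t y) v `^ q^-1.
pose g := fun t : R => 1 + h * (G (u x + t) (v x) - G (u x) (v x)).
have phiE t : phi t = quad a u + t * L + t ^+ 2 * quad a (bump x 1) + C - S * g t `^ q^-1.
  by rewrite /phi quad_bump Fh_bump F1.
have dG : is_derive (0 : R) (1 : R) (fun t => G (u x + t) (v x)) (2 * q * force q b (u x) (v x)).
  have d1 : is_derive (0 : R) (1 : R) (fun t : R => u x + t) 1.
    have -> : (fun t : R => u x + t) = cst (u x) + id by [].
    by apply: is_derive_eq; rewrite add0r.
  have d2 := is_derive_coupling q b ux (v0 x).
  have := @is_derive1_comp _ (fun s => G s (v x)) (fun t : R => u x + t) 0 _ _ _ d1.
  by rewrite addr0 => /(_ _ d2); rewrite mulr1.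
have dg : is_derive (0 : R) (1 : R) g (h * (2 * q * force q b (u x) (v x))).
  have -> : g = cst 1 + h \*: ((fun t => G (u x + t) (v x)) - cst (G (u x) (v x))) by [].
  by apply: is_derive_eq; rewrite add0r subr0.
have g0 : g 0 = 1 by rewrite /g addr0 subrr mulr0 addr0.
have dp : is_derive (0 : R) (1 : R) (fun t => g t `^ q^-1)
    (q^-1 * (h * (2 * q * force q b (u x) (v x)))).
  have d3 : is_derive (g 0) (1 : R) (fun y : R => y `^ q^-1) (q^-1 * g 0 `^ (q^-1 - 1)).
    by apply: is_derive1_powR; rewrite g0.
  have := @is_derive1_comp _ (fun y : R => y `^ q^-1) g 0 _ _ d3 dg.
  by rewrite g0 powR1 mulr1.
have dphi : is_derive (0 : R) (1 : R) phi
   (L - S * (q^-1 * (h * (2 * q * force q b (u x) (v x))))).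
  have -> : phi = cst (quad a u + C) + L \*: id + quad a (bump x 1) \*: (id * id) -
      S \*: (fun t => g t `^ q^-1).
    apply/funext => t; rewrite phiE.
    transitivity (quad a u + C + L * t + quad a (bump x 1) * (t * t) - S * g t `^ q^-1);
      last by [].
    by ring.
  apply: is_derive_eq.
  rewrite /GRing.scale/=.
  transitivity (0 + L * 1 + quad a (bump x 1) * (0 * 1 + 0 * 1) -
    S * (q^-1 * (h * (2 * q * force q b (u x) (v x))))); first by [].
  by ring.
have phi_ge0 t : - u x < t -> 0 <= phi t.
  move=> ht; rewrite /phi subr_ge0; apply: Hmin => y.
  rewrite /bump; case: eqP => [->|_]; last by rewrite addr0.
  by rewrite mulr1n; lra.
have phi0 : phi 0 = 0 by rewrite phiE g0 powR1; rewrite -QS; ring.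
have D0 : L - S * (q^-1 * (h * (2 * q * force q b (u x) (v x)))) = 0.
  apply: (local_min_derive dphi); rewrite phi0.
  near=> t; apply: phi_ge0; near: t; apply: (lt_nbhsr (a := - u x)).
  by rewrite oppr_lt0.
move: D0; rewrite /L.
have -> : S * (q^-1 * (h * (2 * q * force q b (u x) (v x)))) = 2 * h * S * force q b (u x) (v x).
  by field; rewrite gt_eqF//; move: q2; lra.
move=> D0; have hn0 : h != 0 by rewrite gt_eqF.
have : h * (2 * h * a * u x + 2 / h * (2 * u x - u (nxt x) - u (prv x)) - 2 * h * S * force q b (u x) (v x)) = 0.
  by rewrite D0 mulr0.
have -> : h * (2 * h * a * u x + 2 / h * (2 * u x - u (nxt x) - u (prv x)) - 2 * h * S * force q b (u x) (v x)) =
  2 * (h ^+ 2 * (a * u x - S * force q b (u x) (v x)) - (u (nxt x) - 2 * u x + u (prv x))).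
  by field.
by move=> ?; lra.
Unshelve. all: by end_near. Qed.

Lemma dist0_rfl0 x : dist0 (rfl 0 x) = dist0 x.
Proof.
rewrite /dist0; have := rfl_cases 0 x; have := ltn_ord x; clear.
move: (nat_of_ord (rfl 0 x)) => r; rewrite [nat_of_ord 0]/=.
by move: (nat_of_ord x) => y; lia.
Qed.

Lemma half_exponent : - (2 * q)^-1 * 2 = - q^-1.
Proof. by have h2 := q2; field; rewrite gt_eqF//; lra. Qed.

Section Continuity.
Context {X : Type} (F : set_system X) {FF : Filter F}.
Implicit Types (U V : X -> T -> R).

Lemma sum2_cvg (f g : X -> R) (k l : R) : f @ F --> k -> g @ F --> l ->
  (fun z => f z + g z) @ F --> k + l.
Proof. by move=> fk gl; exact: cvgD. Qed.

Lemma bigsum_cvg (f : X -> T -> R) (k : T -> R) : (forall x, (f ^~ x) @ F --> k x) ->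
  (fun z => \sum_x f z x) @ F --> \sum_x k x.
Proof.
by move=> fk; apply: (@cvg_big _ _ +%R) => //; exact: add_continuous.
Qed.

Lemma Fh_cvg U V u v : (forall x, (U ^~ x) @ F --> u x) -> (forall x, (V ^~ x) @ F --> v x) ->
  (fun z => Fh (U z) (V z)) @ F --> Fh u v.
Proof.
move=> cU cV; apply: cvgM; first exact: cvg_cst.
by apply: bigsum_cvg => x; exact: coupling_cvg.
Qed.

Lemma weight_cvg w U u : (forall x, (U ^~ x) @ F --> u x) ->
  (fun z => \sum_x w x * U z x) @ F --> \sum_x w x * u x.
Proof.
by move=> cU; apply: bigsum_cvg => x; apply: cvgM => //; exact: cvg_cst.
Qed.

Lemma quad_cvg a U u : (forall x, (U ^~ x) @ F --> u x) ->
  (fun z => quad a (U z)) @ F --> quad a u.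
Proof.
move=> cU; apply: cvgD; (apply: cvgM; first exact: cvg_cst); apply: bigsum_cvg => x.
  by apply: cvgM; [exact: cvg_cst|apply: cvgM].
by apply: cvgM; apply: cvgB.
Qed.

End Continuity.

Section Minimizer.
Variables (al be : R).
Hypotheses (al0 : 0 < al) (be0 : 0 < be).

Let P := prod_topology (fun _ : bool * T => R).
Let U (f : P) : T -> R := fun x => f (true, x).
Let V (f : P) : T -> R := fun x => f (false, x).
Let N u v := quad al u + quad be v.

Let cvgp (i : bool * T) (f : P) : (fun g : P => g i) @ f --> f i.
Proof. exact: (@proj_continuous (bool * T)%type (fun=> R) i f). Qed.

Let contF : continuous (fun f : P => Fh (U f) (V f)).
Proof. by move=> f; apply: (@Fh_cvg P (nbhs f) _ U V) => x; exact: cvgp. Qed.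

Let contN : continuous (fun f : P => N (U f) (V f)).
Proof.
move=> f; apply: (@sum2_cvg P (nbhs f) _ (fun f => quad al (U f)) (fun f => quad be (V f))).
  by apply: (@quad_cvg P (nbhs f) _ al U) => x; exact: cvgp.
by apply: (@quad_cvg P (nbhs f) _ be V) => x; exact: cvgp.
Qed.

Let w (x : T) : R := (dist0 x).+1%:R^-1.

Let W u v := \sum_x w x * u x + \sum_x w x * v x.

Let contW : continuous (fun f : P => W (U f) (V f)).
Proof.
move=> f; apply: (@sum2_cvg P (nbhs f) _ (fun f => \sum_x w x * U f x)
  (fun f => \sum_x w x * V f x)).
  by apply: (@weight_cvg P (nbhs f) _ w U) => x; exact: cvgp.
by apply: (@weight_cvg P (nbhs f) _ w V) => x; exact: cvgp.
Qed.

(* A minimiser that also maximises a strictly decreasing weight is fixed by every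
   polarisation, which makes it decreasing in the distance to the origin. *)
Theorem discrete_minimizer : exists u v S, [/\
  (forall x, 0 <= u x) /\ (forall x, 0 <= v x), Fh u v = 1, quad al u + quad be v = S,
  (forall u' v', (forall x, 0 <= u' x) -> (forall x, 0 <= v' x) ->
    S * Fh u' v' `^ q^-1 <= quad al u' + quad be v') &
  forall x y, (dist0 x < dist0 y)%N -> u y <= u x /\ v y <= v x].
Proof.
have q0 : 0 < 2 * q by move: q2; lra.
(* A single site with this value already carries mass h c^(2q) = 1, so the constant pair is an
   admissible competitor and [N0] bounds the minimum. *)
pose c : R := h^-1 `^ (2 * q)^-1.
have cp : c `^ (2 * q) = h^-1.
  by rewrite /c -powRrM mulVf ?gt_eqF// powRr1// invr_ge0 ltW.
have c0 : 0 < c by rewrite powR_gt0// invr_gt0.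
pose N0 := N (fun=> c) (fun=> c).
have N_ge0 u v : 0 <= N u v by rewrite addr_ge0// quad_ge0 ?ltW.
(* From u^2 <= N0 / (h al) and 2 u <= 1 + u^2; the term c puts the constant competitor inside the
   box. *)
pose B := c + 1 + N0 / (h * al) + N0 / (h * be).
have ha : 0 < h * al by rewrite mulr_gt0.
have hb : 0 < h * be by rewrite mulr_gt0.
have Na0 : 0 <= N0 / (h * al) by rewrite divr_ge0 ?(ltW ha)//; exact: N_ge0.
have Nb0 : 0 <= N0 / (h * be) by rewrite divr_ge0 ?(ltW hb)//; exact: N_ge0.
have Fc : 1 <= Fh (fun=> c) (fun=> c).
  rewrite /Fh (bigD1 ord0)//= mulrDr ler_wpDr//.
    by rewrite mulr_ge0 ?(ltW h0)// sumr_ge0// => x _; exact: coupling_ge0.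
  rewrite mulrC -ler_pdivrMr// mul1r -cp /coupling (gtr0_norm c0) -addrA lerDl.
  by rewrite addr_ge0 ?mulr_ge0 ?powR_ge0// ltW.
have small u v : (forall x, 0 <= u x) -> (forall x, 0 <= v x) -> N u v <= N0 ->
    forall x, u x <= B /\ v x <= B.
  move=> u0 v0 NN x.
  have h1 : u x ^+ 2 <= N0 / (h * al).
    rewrite ler_pdivlMr// mulrC; apply: le_trans (quad_sq_le u x (ltW al0)) _.
    by apply: le_trans NN; rewrite lerDl quad_ge0// ltW.
  have h2 : v x ^+ 2 <= N0 / (h * be).
    rewrite ler_pdivlMr// mulrC; apply: le_trans (quad_sq_le v x (ltW be0)) _.
    by apply: le_trans NN; rewrite lerDr quad_ge0// ltW.
  by rewrite /B; split; [have := sqr_ge0 (u x - 1)|have := sqr_ge0 (v x - 1)]; nra.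
(* The constraint is relaxed to [Fh >= 1]; homogeneity restores equality at the minimiser and
   extends the inequality to all nonnegative pairs. *)
pose A : set P := [set f : P | forall i, f i \in `[0, B]] `&`
   [set f | 1 <= Fh (U f) (V f)].
have cA : compact A.
  apply: compact_closedI.
    have := @tychonoff (bool * T)%type (fun=> R) (fun=> `[0, B]%classic).
    by apply => i; exact: segment_compact.
  apply: (@preimage_closed _ _ _ [set t : R | 1 <= t]); last exact: closed_ge.
  by move=> f _; exact: contF.
have A0 : A !=set0.
  exists (fun=> c); split => //= i; rewrite in_itv/= ltW//= /B; lra.
have [z1 /set_mem Az1 Hz1] := compact_EVT_min A0 cA (continuous_subspaceT contN).
pose S := N (U z1) (V z1).
have mkz u v : exists2 z : P, U z = u & V z = v.
  by exists (fun i => if i.1 then u i.2 else v i.2).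
have Smin u v : (forall x, 0 <= u x) -> (forall x, 0 <= v x) -> 1 <= Fh u v -> S <= N u v.
  move=> u0 v0 F1; have SN0 : S <= N0.
    have [z Uz Vz] := mkz (fun=> c) (fun=> c).
    have -> : N0 = N (U z) (V z) by rewrite Uz Vz.
    apply: Hz1; apply/mem_set.
    have zc i : z i = c.
      by case: i => -[] x; [move: (congr1 (@^~ x) Uz)|move: (congr1 (@^~ x) Vz)].
    split; last by rewrite /= Uz Vz.
    by move=> i; rewrite zc in_itv/= ltW//= /B; lra.
  have [NN|/ltW NN] := leP (N u v) N0; last exact: le_trans SN0 NN.
  have uvB := small u v u0 v0 NN.
  have [z Uz Vz] := mkz u v; rewrite -Uz -Vz; apply: Hz1; apply/mem_set.
  split; last by rewrite /= Uz Vz.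
  by case=> -[] x; [have -> : z (true, x) = u x by rewrite -Uz|
    have -> : z (false, x) = v x by rewrite -Vz]; rewrite in_itv/= ?u0 ?v0 ?(uvB x).1 ?(uvB x).2.
pose A2 : set P := A `&` [set f | N (U f) (V f) <= S].
have cA2 : compact A2.
  apply: compact_closedI => //.
  apply: (@preimage_closed _ _ _ [set t : R | t <= S]); last exact: closed_le.
  by move=> f _; exact: contN.
have A20 : A2 !=set0 by exists z1; split => //=.
have [z /set_mem Az Hz] := compact_EVT_max A20 cA2 (continuous_subspaceT contW).
case: Az => -[zB zF] /= zS.
pose u := U z; pose v := V z.
have u0 x : 0 <= u x by have := zB (true, x); rewrite in_itv/= => /andP[].
have v0 x : 0 <= v x by have := zB (false, x); rewrite in_itv/= => /andP[].
have NS : N u v = S by apply/le_anti; rewrite zS Smin.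
have S0 : 0 <= S by rewrite -NS N_ge0.
have Fpos : 0 < Fh u v by exact: lt_le_trans zF.
have Sq u' v' : (forall x, 0 <= u' x) -> (forall x, 0 <= v' x) ->
    S * Fh u' v' `^ q^-1 <= N u' v'.
  move=> u'0 v'0; have [F0|F0] := eqVneq (Fh u' v') 0.
    by rewrite F0 powR0 ?mulr0// invr_neq0// gt_eqF//; move: q2; lra.
  have Fp : 0 < Fh u' v' by rewrite lt_neqAle eq_sym F0 Fh_ge0.
  pose e := Fh u' v' `^ (- (2 * q)^-1).
  have e0 : 0 < e by rewrite powR_gt0.
  have eF : e `^ (2 * q) * Fh u' v' = 1.
    by rewrite /e -powRrM mulNr mulVf ?gt_eqF// powR_inv1 ?(ltW Fp)// mulVf.
  have := Smin (fun x => e * u' x) (fun x => e * v' x).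
  rewrite FhZ ?(ltW e0)// eF lexx => H.
  have {}H : S <= e ^+ 2 * N u' v'.
    rewrite /N mulrDr -(quadZ al e u') -(quadZ be e v').
    by apply: H => // x; rewrite mulr_ge0// ltW.
  have -> : Fh u' v' `^ q^-1 = (e ^+ 2)^-1.
    by rewrite -powR_mulrn ?(ltW e0)// /e -powRrM -powRN half_exponent opprK.
  by rewrite ler_pdivrMr ?exprn_gt0// mulrC.
(* If [Fh u v > 1], the homogeneous inequality at the minimiser itself would read S Fh^(1/q) <= S
   with S > 0. *)
have F1 : Fh u v = 1.
  apply/le_anti; rewrite zF andbT leNgt; apply/negP => F1.
  have Spos : 0 < S.
    rewrite lt_neqAle S0 andbT; apply/eqP => S0'.
    have Q1 : quad al u = 0 /\ quad be v = 0.
      have := NS; rewrite /N -S0'; have := quad_ge0 u (ltW al0); have := quad_ge0 v (ltW be0).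
      by move=> ? ? ?; split; lra.
    have uz x : u x = 0.
      have := quad_sq_le u x (ltW al0); rewrite Q1.1 => H.
      by apply/eqP; rewrite -sqrf_eq0 eq_le sqr_ge0 andbT -(pmulr_rle0 _ ha).
    have vz x : v x = 0.
      have := quad_sq_le v x (ltW be0); rewrite Q1.2 => H.
      by apply/eqP; rewrite -sqrf_eq0 eq_le sqr_ge0 andbT -(pmulr_rle0 _ hb).
    move: F1; rewrite /Fh big1 ?mulr0 ?ltr10// => x _.
    by rewrite uz vz coupling00.
  have := Sq u v u0 v0; rewrite NS ger_pMr// leNgt => /negP; apply.
  rewrite -[ltLHS](_ : 1 `^ q^-1 = 1 :> R); last by rewrite powR1.
  by apply: gt0_ltr_powR; rewrite ?nnegrE ?invr_gt0 ?(ltW Fpos)//; move: q2; lra.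
exists u, v, S; split => //.
have wd x y : (dist0 x < dist0 y)%N -> w y < w x.
  by move=> d; rewrite /w ltf_pV2 ?posrE// ltr_nat.
(* The reflection with constant x + y exchanges x and y, so any two sites at different distances are
   compared by a single polarisation. *)
move=> x y dxy; pose cc := x + y.
have yE : y = rfl cc x by rewrite /rfl /cc addrC addrA addNr add0r.
have cc0 : cc != 0.
  by apply/eqP => cc0; move: dxy; rewrite yE cc0 dist0_rfl0 ltnn.
have [z' Uz' Vz'] := mkz (pol cc u) (pol cc v).
have Fpol : 1 <= Fh (pol cc u) (pol cc v) by rewrite -F1; exact: pol_Fh.
have Npol : N (pol cc u) (pol cc v) <= S.
  by rewrite -NS; apply: lerD; exact: pol_quad.
have SN0 : S <= N0.
  by apply: Smin => // _; exact: ltW.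
have pB := small _ _ (pol_ge0 cc u0) (pol_ge0 cc v0) (le_trans Npol SN0).
have := Hz z'; rewrite Uz' Vz' => H.
have {}H : W (pol cc u) (pol cc v) <= W u v.
  apply: H; apply/mem_set; split; last by rewrite /= Uz' Vz'.
  split; last by rewrite /= Uz' Vz'.
  case=> -[] t; [have -> : z' (true, t) = pol cc u t by rewrite -Uz'|
    have -> : z' (false, t) = pol cc v t by rewrite -Vz']; rewrite in_itv/=.
    by rewrite pol_ge0//= (pB t).1.
  by rewrite pol_ge0//= (pB t).2.
have [Wu eu] := pol_weight u cc0 wd; have [Wv ev] := pol_weight v cc0 wd.
have Eu : \sum_x w x * u x = \sum_x w x * pol cc u x by move: H; rewrite /W => H; lra.
have Ev : \sum_x w x * v x = \sum_x w x * pol cc v x by move: H; rewrite /W => H; lra.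
move: eu ev; rewrite Eu Ev !eqxx => /esym/forallP/(_ x) eu /esym/forallP/(_ x) ev.
by rewrite -yE dxy/= in eu ev.
Qed.

End Minimizer.

End DiscreteProblem.

(** * From the line to the lattice *)

Section Fatou.
Context {R : realType}.
Local Notation mu := (@lebesgue_measure R).
Implicit Types (f phi : R -> R).

Lemma limn_einf_le (u : (\bar R)^nat) (l : \bar R) :
  (\forall n \near \oo, (u n <= l)%E) -> (limn_einf u <= l)%E.
Proof.
move=> [N _ HN]; rewrite limn_einf_lim; apply: lime_le; first exact: is_cvg_einfs.
apply: nearW => n; apply: (@le_trans _ _ (u (maxn n N))).
  by apply: ereal_inf_lbound; exists (maxn n N) => //=; exact: leq_maxl.
by apply: HN; exact: leq_maxr.
Qed.

Lemma Rfatou (f_ : nat -> R -> R) phi (B_ : nat -> R) (B : R) :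
  (forall n, measurable_fun setT (f_ n)) -> (forall n x, 0 <= f_ n x) ->
  (forall x, (f_ ^~ x) @ \oo --> phi x) ->
  (forall n, (\int[mu]_x (f_ n x)%:E <= (B_ n)%:E)%E) -> B_ @ \oo --> B ->
  mu.-integrable setT (EFin \o phi) /\ \int[mu]_x phi x <= B.
Proof.
move=> mf f0 cf fB cB.
have mphi : measurable_fun setT phi by apply: measurable_fun_cvg => // x _; exact: cf.
have phi0 x : 0 <= phi x.
  apply: (@closed_cvg _ _ _ _ (f_ ^~ x) (fun y => 0 <= y) _ _ _ (cf x)).
    exact: closed_ge.
  exact: nearW.
have le_ : (\int[mu]_x (phi x)%:E <= B%:E)%E.
  apply/lee_addgt0Pr => e e0.
  have := @fatou _ _ _ mu setT measurableT (fun n x => (f_ n x)%:E).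
  have -> : (fun x => limn_einf (fun n => (f_ n x)%:E)) = (fun x => (phi x)%:E).
    apply/funext => x; have cE : (fun n => (f_ n x)%:E) @ \oo --> (phi x)%:E.
      by apply: cvg_EFin; [exact: nearW|exact: cf].
    by have [-> _] := cvg_limn_einf_sup cE.
  move=> H; apply: le_trans (H _ _) _.
  - by move=> n; apply/measurable_EFinP; exact: mf.
  - by move=> n x _; rewrite lee_fin.
  apply: limn_einf_le.
  have /cvgrPdist_le /(_ e e0) : B_ @ \oo --> B by [].
  apply: filterS => n Bn; apply: le_trans (fB n) _.
  by rewrite -EFinD lee_fin; move: Bn; rewrite ler_norml => /andP[]; lra.
have iphi : mu.-integrable setT (EFin \o phi).
  apply/integrableP; split; first exact/measurable_EFinP.
  apply: le_lt_trans (ltry B); apply: le_trans le_.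
  by apply: ge0_le_integral => //; try (by move=> x _ /=; rewrite ?lee_fin ?ger0_norm);
    do ?apply: measurableT_comp => //; exact/measurable_EFinP.
split => //; rewrite -lee_fin /Rintegral fineK//.
exact: integrable_fin_num.
Qed.

Definition stepf (o h : R) (K : nat) (c : nat -> R) (x : R) : R :=
  \sum_(k < K) c k * \1_(`[o + k%:R * h, o + k.+1%:R * h[) x.

Section Step.
Variables (o h : R) (K : nat) (c : nat -> R).
Hypotheses (h0 : 0 < h) (c0 : forall k, 0 <= c k).

Lemma measurable_stepf : measurable_fun setT (stepf o h K c).
Proof.
apply: measurable_sum => k; apply: measurable_funM; first exact: measurable_cst.
by apply: measurable_indic; exact: measurable_itv.
Qed.

Lemma stepf_ge0 x : 0 <= stepf o h K c x.
Proof. by apply: sumr_ge0 => k _; rewrite mulr_ge0// indicE. Qed.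

Lemma integral_stepf : (\int[mu]_x (stepf o h K c x)%:E = (h * \sum_(k < K) c k)%:E)%E.
Proof.
under eq_integral => x _ do rewrite /stepf -sumEFin.
rewrite ge0_integral_sum//=.
- rewrite mulr_sumr -sumEFin; apply: eq_bigr => k _.
  under eq_integral do rewrite EFinM.
  rewrite ge0_integralZl//=.
  + rewrite integral_indic//= setIT.
    rewrite [X in (_ * X)%E](_ : _ = h%:E); first by rewrite -EFinM mulrC.
    transitivity ((@lebesgue_measure R) (`[o + k%:R * h, o + k.+1%:R * h[)%classic) => //.
    rewrite lebesgue_measure_itv/= lte_fin ltrD2l ltr_pM2r// ltr_nat ltnSn -EFinB.
    by congr (_%:E); rewrite -natr1; ring.
  + by apply/measurable_EFinP; apply: measurable_indic; exact: measurable_itv.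
  + by rewrite lee_fin.
- move=> k; apply/measurable_EFinP; apply: measurable_funM; first exact: measurable_cst.
  by apply: measurable_indic; exact: measurable_itv.
- by move=> k x _; rewrite lee_fin mulr_ge0// indicE.
Qed.

Lemma stepfE k x : (k < K)%N -> o + k%:R * h <= x < o + k.+1%:R * h -> stepf o h K c x = c k.
Proof.
move=> kK /andP[kx xk]; rewrite /stepf (bigD1 (Ordinal kK))//= big1 ?addr0.
  by rewrite indicE mem_set ?mulr1//= in_itv/= kx xk.
move=> i ik; rewrite indicE memNset ?mulr0//= in_itv/= => /andP[h1 h2].
move/negP: ik; apply; apply/eqP/val_inj => /=; apply/eqP; rewrite eqn_leq.
apply/andP; split; rewrite -ltnS -(ltr_nat R) -(ltr_pM2r h0); lra.
Qed.

Lemma stepf_out x : x < o -> stepf o h K c x = 0.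
Proof.
move=> xo; rewrite /stepf big1// => i _; rewrite indicE memNset ?mulr0//= in_itv/= => /andP[h1 _].
have : 0 <= i%:R * h by rewrite mulr_ge0// ltW.
lra.
Qed.

End Step.

Lemma cell_index (o h x : R) : 0 < h -> o <= x ->
  o + (Num.truncn ((x - o) / h))%:R * h <= x < o + (Num.truncn ((x - o) / h)).+1%:R * h.
Proof.
move=> h0 ox; have : 0 <= (x - o) / h by rewrite divr_ge0 ?subr_ge0// ltW.
move=> /truncn_itv /andP[h1 h2].
rewrite -lerBrDl -ltrBlDl.
by rewrite -ler_pdivlMr// -ltr_pdivrMr// h1.
Qed.

End Fatou.

(** * Sampling an absolutely continuous function on a grid *)

Section Sampling.
Context {R : realType}.
Local Notation mu := (@lebesgue_measure R).
Implicit Types (u g z : R -> R) (h : R).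

Lemma sum_cells f (o h : R) (n : nat) : 0 <= h ->
  (forall a b, mu.-integrable `[a, b] (EFin \o f)) ->
  \sum_(k < n) \int[mu]_(s in `[o + k%:R * h, o + k.+1%:R * h]) f s =
  \int[mu]_(s in `[o, o + n%:R * h]) f s.
Proof.
move=> h0 If; elim: n => [|n IH].
  by rewrite big_ord0 mul0r addr0 set_itv1 Rintegral_set1.
rewrite big_ord_recr/= IH -intg_split//.
  by rewrite lerDl mulr_ge0.
by rewrite lerD2l ler_wpM2r// ler_nat.
Qed.

Variables (u g : R -> R).
Hypothesis A : AC u g.
Variables (o h : R) (n : nat).
Hypothesis h0 : 0 < h.
Local Notation x k := (o + k%:R * h).

Let h0' : 0 <= h. Proof. exact: ltW. Qed.
Let Lu : L2 u. Proof. by case: A. Qed.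
Let Lg : L2 g. Proof. by case: A. Qed.
Let xS (k : nat) : x k <= x k.+1.
Proof. by rewrite lerD2l ler_wpM2r// ler_nat. Qed.
Let xd (k : nat) : x k.+1 - x k = h.
Proof. by rewrite -natr1; ring. Qed.

Let sum_le f : mu.-integrable setT (EFin \o f) -> (forall s, 0 <= f s) ->
  \sum_(k < n) \int[mu]_(s in `[x k, x k.+1]) f s <= \int[mu]_s f s.
Proof.
move=> If f0; rewrite sum_cells//; last by move=> a b; exact: intgS If.
by apply: Rintegral_subset.
Qed.

Lemma sample_gradient : \sum_(k < n) (u (x k.+1) - u (x k)) ^+ 2 <= h * \int[mu]_s (g s ^+ 2).
Proof.
apply: (@le_trans _ _ (\sum_(k < n) h * \int[mu]_(s in `[x k, x k.+1]) (g s ^+ 2))).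
  apply: ler_sum => k _; have [_ _ P] := A.
  by apply: le_trans (primitive_le Lg P (xS k)) _; rewrite xd.
rewrite -mulr_sumr; apply: ler_wpM2l => //; apply: sum_le; first by case: Lg.
by move=> s; exact: sqr_ge0.
Qed.

(** On each cell d = u(s) - u(x_k) satisfies d^2 <= h int g^2 over the cell, and Young's inequality
    with weight h gives u(x_k)^2 <= (1 + h) u(s)^2 + (1 + 1/h) d^2. The error vanishes with h. *)
Lemma sample_mass : h * \sum_(k < n) u (x k) ^+ 2 <=
  (1 + h) * \int[mu]_s (u s ^+ 2) + (h ^+ 2 + h) * \int[mu]_s (g s ^+ 2).
Proof.
have cellle (k : nat) : h * u (x k) ^+ 2 <= (1 + h) * \int[mu]_(s in `[x k, x k.+1]) (u s ^+ 2) +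
   (h ^+ 2 + h) * \int[mu]_(s in `[x k, x k.+1]) (g s ^+ 2).
  set G := \int[mu]_(s in `[x k, x k.+1]) (g s ^+ 2).
  have Iu := L2_sq_itv (x k) (x k.+1) Lu; have Ig := L2_sq_itv (x k) (x k.+1) Lg.
  have -> : h * u (x k) ^+ 2 = \int[mu]_(s in `[x k, x k.+1]) (u (x k) ^+ 2).
    by rewrite Rintegral_itv_cst ?xS// xd mulrC.
  have -> : (1 + h) * \int[mu]_(s in `[x k, x k.+1]) (u s ^+ 2) + (h ^+ 2 + h) * G =
    \int[mu]_(s in `[x k, x k.+1]) ((1 + h) * u s ^+ 2 + (h + 1) * G).
    have I1 : mu.-integrable `[x k, x k.+1] (EFin \o (fun s => (1 + h) * u s ^+ 2)) by exact: intgZ.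
    have I2 : mu.-integrable `[x k, x k.+1] (EFin \o (fun=> (h + 1) * G)) by exact: intg_cst.
    by rewrite RintegralD// RintegralZl// Rintegral_itv_cst ?xS// xd; ring.
  apply: le_Rintegral => //; first exact: intg_cst.
    by apply: intgD => //; [exact: intgZ|exact: intg_cst].
  move=> s; rewrite /= in_itv/= => /andP[xs sx].
  have [_ _ P] := A.
  have : (u s - u (x k)) ^+ 2 <= h * G.
    apply: le_trans (primitive_le Lg P xs) _; apply: ler_pM.
    - by rewrite subr_ge0.
    - by apply: Rintegral_ge0 => t _; exact: sqr_ge0.
    - by move: (xd k) sx => <-; lra.
    - apply: Rintegral_subset => //; last by move=> t _; exact: sqr_ge0.
      by move=> t /=; rewrite !in_itv/= => /andP[-> /le_trans ->].
  set d := u s - u (x k) => Hd.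
  have -> : u (x k) = u s - d by rewrite /d; ring.
  have : 0 <= (h * u s + d) ^+ 2 by exact: sqr_ge0.
  have hp := h0; move=> H.
  rewrite -(ler_pM2l hp).
  have : (h + 1) * d ^+ 2 <= (h + 1) * (h * G) by apply: ler_wpM2l => //; lra.
  nra.
rewrite mulr_sumr; apply: le_trans (ler_sum _ (fun (k : 'I_n) _ => cellle k)) _.
rewrite big_split/= -!mulr_sumr.
have h0'' := h0'.
apply: lerD; apply: ler_wpM2l; try by rewrite addr_ge0// exprn_ge0.
all: by apply: sum_le => [|s]; [case: Lu => //; case: Lg|exact: sqr_ge0].
Qed.

End Sampling.

(** * Sharpness of the limit constant by sampling on the cycle *)

Section CycleSample.
Context {R : realType}.
Local Notation mu := (@lebesgue_measure R).
Variables (q b : R).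
Hypotheses (q2 : 2 <= q) (b0 : 0 < b).
Implicit Types (z g : R -> R).

(* Shrinking makes the samples of a decaying function vanish near the ends of the
   cycle, so that closing the cycle costs no energy. *)
Definition shrink (e t : R) : R := Num.max (`|t| - e) 0.

Lemma shrink_ge0 e t : 0 <= shrink e t.
Proof. by rewrite /shrink le_max lexx orbT. Qed.

Lemma shrink_le e t : 0 <= e -> shrink e t <= `|t|.
Proof. by move=> e0; rewrite /shrink ge_max normr_ge0 andbT lerBlDr lerDl. Qed.

Lemma shrink_eq0 e t : `|t| <= e -> shrink e t = 0.
Proof. by move=> te; rewrite /shrink; apply/max_idPr; rewrite subr_le0. Qed.

Lemma shrink_lip e s t : (shrink e s - shrink e t) ^+ 2 <= (s - t) ^+ 2.
Proof.
rewrite -[leRHS]real_normK ?num_real// -[leLHS]real_normK ?num_real//.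
rewrite ler_sqr ?nnegrE//.
have h1 : `|s| - `|t| <= `|s - t| by exact: lerB_dist.
have h2 : `|t| - `|s| <= `|s - t| by rewrite distrC; exact: lerB_dist.
have h3 := normr_ge0 (s - t).
rewrite /shrink ler_norml; case: (leP (`|s| - e) 0) => h4; case: (leP (`|t| - e) 0) => h5; lra.
Qed.

Lemma shrink_cvg (T : Type) (F : set_system T) (f : T -> R) (e : T -> R) (l d : R) : Filter F ->
  f @ F --> l -> e @ F --> d -> (fun x => shrink (e x) (f x)) @ F --> shrink d l.
Proof.
have shrinkE (c t : R) : shrink c t = (`|t| - c + `| `|t| - c |) / 2.
  rewrite /shrink; case: (leP (`|t| - c) 0) => h.
    by rewrite (ler0_norm h) subrr mul0r.
  by rewrite (gtr0_norm h); field.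
move=> FF fl ed; rewrite shrinkE; under eq_fun do rewrite shrinkE.
have c : (fun x => `|f x| - e x) @ F --> `|l| - d.
  by apply: cvgB => //; exact: cvg_norm.
by apply: cvgM; [apply: cvgD => //; exact: cvg_norm|exact: cvg_cst].
Qed.

Definition mesh (n : nat) : R := n.+1%:R^-1.
(** With mesh 1 / (n+1) and half-length n + 1, the lattice refines and exhausts the line at the same
    time. *)
Definition half (n : nat) : nat := (n.+1 * n.+1)%N.
Local Notation M n := ((half n).*2).+1.

Lemma mesh_gt0 n : 0 < mesh n. Proof. by rewrite invr_gt0. Qed.
Lemma half_gt0 n : (0 < half n)%N. Proof. by []. Qed.

Lemma half_mesh n : (half n)%:R * mesh n = n.+1%:R.
Proof. by rewrite /half /mesh natrM mulfK. Qed.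

(** Sites run from -(n+1) to n+1, so that the cycle closes far out. Index 0 is the left end here,
    not the centre of symmetry; [quad] and [Fh] are invariant under rotations of the cycle. *)
Definition site n (k : nat) : R := - n.+1%:R + k%:R * mesh n.

Definition sample e n z (x : 'I_(M n)) : R := shrink e (z (site n x)).

Arguments sample : clear implicits.

(** Both ends of the closing edge carry the value 0 after shrinking, and [shrink] increases neither
    values nor differences. *)
Lemma quad_sample e n a z g : 0 <= a -> 0 <= e -> AC z g ->
  (forall s, n.+1%:R <= `|s| -> `|z s| <= e) ->
  quad (mesh n) a (sample e n z) <=
   a * ((1 + mesh n) * \int[mu]_s (z s ^+ 2) + (mesh n ^+ 2 + mesh n) * \int[mu]_s (g s ^+ 2)) +
   \int[mu]_s (g s ^+ 2).
Proof.
move=> a0 e0 A ze; have h0 := mesh_gt0 n; set h := mesh n in h0 *.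
have end0 : sample e n z ord_max = 0.
  rewrite /sample /site /= -mul2n natrM -mulrA half_mesh; apply: shrink_eq0; apply: ze.
  by rewrite (_ : - _ + _ = n.+1%:R) ?ger0_norm//; ring.
have beg0 : sample e n z ord0 = 0.
  by rewrite /sample /site /= mul0r addr0; apply: shrink_eq0; apply: ze; rewrite normrN ger0_norm.
have nxt_max : nxt (ord_max : 'I_(M n)) = ord0.
  by apply: ord_inj; rewrite val_nxt//= ltnn.
have nxt_wid (i : 'I_((half n).*2)) : nxt (widen_ord (leqnSn _) i) = i.+1 :> nat.
  by rewrite val_nxt//= ltnS ltn_ord.
rewrite /quad; apply: lerD.
  rewrite -mulr_sumr mulrCA; apply: ler_wpM2l => //.
  apply: le_trans (sample_mass A (- n.+1%:R) ((half n).*2) h0); apply: ler_wpM2l; first exact: ltW.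
  rewrite big_ord_recr/= end0 expr0n/= addr0; apply: ler_sum => i _.
  rewrite -[leRHS]real_normK ?num_real//; apply: lerXn2r; rewrite ?nnegrE ?shrink_ge0//.
  exact: shrink_le.
rewrite mulrC ler_pdivrMr// mulrC.
apply: le_trans (sample_gradient A (- n.+1%:R) ((half n).*2) h0).
rewrite big_ord_recr/= nxt_max end0 beg0 subrr expr0n/= addr0; apply: ler_sum => i _.
by rewrite /sample nxt_wid; exact: shrink_lip.
Qed.

Definition sample_density e n z1 z2 (k : nat) : R :=
  coupling q b (shrink e (z1 (site n k))) (shrink e (z2 (site n k))).

Lemma Fh_sample e n z1 z2 :
  Fh q b (mesh n) (sample e n z1) (sample e n z2) =
  mesh n * \sum_(k < M n) sample_density e n z1 z2 k.
Proof. by []. Qed.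

Lemma mesh_cvg (s : nat -> nat) : (forall j, (j <= s j)%N) -> (fun j => mesh (s j)) @ \oo --> (0 : R).
Proof.
move=> sj; apply/cvgrPdist_le => /= e e0.
near=> j; rewrite sub0r normrN gtr0_norm ?mesh_gt0//.
apply: (@le_trans _ _ j.+1%:R^-1); last by near: j; apply: filterS (near_infty_natSinv_lt (PosNum e0)) => k /ltW.
by rewrite lef_pV2 ?posrE// ler_nat ltnS.
Unshelve. all: by end_near. Qed.

Lemma near_ge_nat (s : nat -> nat) (x : R) : (forall j, (j <= s j)%N) ->
  \forall j \near \oo, x < (s j).+1%:R.
Proof.
move=> sj; near=> j; apply: (@le_lt_trans _ _ j%:R).
  by near: j; exact: nbhs_infty_ger.
by rewrite ltr_nat ltnS.
Unshelve. all: by end_near. Qed.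

Lemma sample_density_cvg (s : nat -> nat) e z1 z2 x : (forall j, (j <= s j)%N) ->
  continuous z1 -> continuous z2 ->
  (fun j => stepf (- (s j).+1%:R) (mesh (s j)) (M (s j)) (sample_density e (s j) z1 z2) x)
    @ \oo --> coupling q b (shrink e (z1 x)) (shrink e (z2 x)).
Proof.
move=> sj c1 c2.
pose idx j := Num.truncn ((x + (s j).+1%:R) / mesh (s j)).
have cs : (fun j => site (s j) (idx j)) @ \oo --> x.
  apply/cvgrPdist_le => /= d d0; near=> j.
  have xj : - (s j).+1%:R <= x.
    rewrite lerNl; apply: ltW; near: j; exact: near_ge_nat.
  have := cell_index (mesh_gt0 (s j)) xj; rewrite opprK -/(idx j) -/(site _ _) => /andP[h1 h2].
  have {}h2 : x < site (s j) (idx j) + mesh (s j).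
    by apply: lt_le_trans h2 _; rewrite /site -natr1; lra.
  rewrite ger0_norm ?subr_ge0//.
  apply: (@le_trans _ _ (mesh (s j))); first by lra.
  near: j; have /cvgrPdist_le /(_ d d0) := mesh_cvg sj.
  by apply: filterS => j /=; rewrite sub0r normrN gtr0_norm ?mesh_gt0.
have cc : (fun j => sample_density e (s j) z1 z2 (idx j)) @ \oo -->
   coupling q b (shrink e (z1 x)) (shrink e (z2 x)).
  apply: coupling_cvg => //; apply: shrink_cvg; try exact: cvg_cst.
    exact: (cvg_comp _ _ cs (c1 x)).
  exact: (cvg_comp _ _ cs (c2 x)).
apply: cvg_trans cc; apply: near_eq_cvg; near=> j.
have xj : - (s j).+1%:R <= x.
  rewrite lerNl; apply: ltW; near: j; exact: near_ge_nat.
have xj' : x < (s j).+1%:R by near: j; exact: near_ge_nat.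
have ci := cell_index (mesh_gt0 (s j)) xj; rewrite opprK -/(idx j) in ci.
symmetry; apply: stepfE => //; first exact: mesh_gt0.
rewrite -(ltr_nat R) -(ltr_pM2r (mesh_gt0 (s j))).
case/andP: ci => h1 _.
rewrite -natr1 -mul2n natrM mulrDl -mulrA half_mesh mul1r.
have := mesh_gt0 (s j); lra.
Unshelve. all: by end_near. Qed.

Definition sq_norm a z g := a * \int[mu]_s (z s ^+ 2) + \int[mu]_s (g s ^+ 2).

Lemma sq_norm_ge0 a z g : 0 <= a -> 0 <= sq_norm a z g.
Proof.
by move=> a0; rewrite addr_ge0// ?mulr_ge0//; apply: Rintegral_ge0 => s _; exact: sqr_ge0.
Qed.

(** The lattice inequality is applied to shrunk samples; Fatou lets the mesh tend to 0 at a fixed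
    shrinking level, and a second use of Fatou lets that level tend to 0. The general sequences [s]
    and [sg] serve both the boundedness of the levels and the sharpness of their limit. *)
Theorem comparison (al be : R) (s : nat -> nat) (sg : nat -> R) (sigma : R) z1 g1 z2 g2 :
  0 <= al -> 0 <= be -> (forall j, (j <= s j)%N) -> (forall j, 0 < sg j) -> 0 < sigma ->
  sg @ \oo --> sigma ->
  (forall j (u v : 'I_(M (s j)) -> R), (forall x, 0 <= u x) -> (forall x, 0 <= v x) ->
     sg j * Fh q b (mesh (s j)) u v `^ q^-1 <= quad (mesh (s j)) al u + quad (mesh (s j)) be v) ->
  AC z1 g1 -> AC z2 g2 ->
  mu.-integrable setT (EFin \o (fun x => coupling q b (z1 x) (z2 x))) /\
  sigma * (\int[mu]_x coupling q b (z1 x) (z2 x)) `^ q^-1 <= sq_norm al z1 g1 + sq_norm be z2 g2.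
Proof.
move=> al0 be0 sj sg0 sigma0 csg Hmin A1 A2.
have q0 : 0 < q by move: q2; lra.
set N := _ + sq_norm be _ _.
have N0 : 0 <= N by rewrite addr_ge0// sq_norm_ge0.
have c1 : continuous z1 by case: A1 => _ L P; exact: primitive_continuous L P.
have c2 : continuous z2 by case: A2 => _ L P; exact: primitive_continuous L P.
have powK (x : R) : 0 <= x -> (x `^ q^-1) `^ q = x.
  by move=> x0; rewrite -powRrM mulVf ?gt_eqF// powRr1.
have Heps e : 0 < e ->
    (\int[mu]_x (coupling q b (shrink e (z1 x)) (shrink e (z2 x)))%:E <= ((N / sigma) `^ q)%:E)%E.
  move=> e0.
  have [B1 B10 HB1] := AC_vanish A1 e0; have [B2 B20 HB2] := AC_vanish A2 e0.
  have [J _ HJ] : \forall j \near \oo, B1 + B2 < (s j).+1%:R by exact: near_ge_nat.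
  (* From index J on, the lattice reaches beyond the region where z1 or z2 exceeds e, so the
     hypothesis of [quad_sample] holds for every term of the shifted sequence. *)
  pose t j := s (j + J)%N.
  have tj j : (j <= t j)%N by apply: leq_trans (sj _); exact: leq_addr.
  pose Nq a z g n := a * ((1 + mesh n) * \int[mu]_s (z s ^+ 2) + (mesh n ^+ 2 + mesh n) *
     \int[mu]_s (g s ^+ 2)) + \int[mu]_s (g s ^+ 2).
  have cNq a z g : (fun j => Nq a z g (t j)) @ \oo --> sq_norm a z g.
    have cm := mesh_cvg tj.
    have -> : sq_norm a z g = a * ((1 + 0) * \int[mu]_s (z s ^+ 2) + (0 * 0 + 0) *
     \int[mu]_s (g s ^+ 2)) + \int[mu]_s (g s ^+ 2) by rewrite /sq_norm; ring.
    apply: cvgD; last exact: cvg_cst.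
    apply: cvgM; first exact: cvg_cst.
    apply: cvgD; apply: cvgM; try exact: cvg_cst.
      by apply: cvgD => //; exact: cvg_cst.
    by apply: cvgD => //; exact: cvgM.
  pose Bj j := (`|(Nq al z1 g1 (t j) + Nq be z2 g2 (t j)) * (sg (j + J)%N)^-1|) `^ q.
  have cB : Bj @ \oo --> (N / sigma) `^ q.
    have -> : N / sigma = `|N / sigma| by rewrite ger0_norm// divr_ge0// ltW.
    have c : (fun j => (Nq al z1 g1 (t j) + Nq be z2 g2 (t j)) * (sg (j + J)%N)^-1) @ \oo -->
       N / sigma.
      apply: cvgM; first by apply: cvgD; exact: cNq.
      apply: cvgV; first by rewrite gt_eqF.
      by have := csg; rewrite -(cvg_shiftn J).
    by apply: (@cvg_comp _ _ _ _ (fun x => `|x| `^ q) _ _ _ c); exact: continuous_norm_powR.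
  have [|||||I1 I2] := @Rfatou _ (fun j => stepf (- (t j).+1%:R) (mesh (t j)) (M (t j))
     (sample_density e (t j) z1 z2)) (fun x => coupling q b (shrink e (z1 x)) (shrink e (z2 x)))
     Bj ((N / sigma) `^ q).
  - by move=> j; exact: measurable_stepf.
  - move=> j x; apply: stepf_ge0 => k; exact: coupling_ge0.
  - by move=> x; apply: sample_density_cvg.
  - move=> j; rewrite integral_stepf; [|exact: mesh_gt0|by move=> k; exact: coupling_ge0].
    rewrite -Fh_sample lee_fin.
    have vz : B1 + B2 < (t j).+1%:R by apply: HJ => /=; exact: leq_addl.
    have Q1 : quad (mesh (t j)) al (sample e (t j) z1) <= Nq al z1 g1 (t j).
      by apply: quad_sample => //; [exact: ltW|move=> x hx; apply: HB1; lra].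
    have Q2 : quad (mesh (t j)) be (sample e (t j) z2) <= Nq be z2 g2 (t j).
      by apply: quad_sample => //; [exact: ltW|move=> x hx; apply: HB2; lra].
    have := Hmin (j + J)%N (sample e (t j) z1) (sample e (t j) z2).
    move=> /(_ (fun x => shrink_ge0 _ _) (fun x => shrink_ge0 _ _)) H.
    rewrite -[leLHS]powK; last by apply: Fh_ge0 => //; exact: mesh_gt0.
    apply: ge0_ler_powR; rewrite ?nnegrE ?powR_ge0 ?(ltW q0)//.
    apply: le_trans (ler_norm _); rewrite ler_pdivlMr// mulrC.
    by apply: le_trans H _; exact: lerD.
  - exact: cB.
  by rewrite -lee_fin in I2; move: I2; rewrite /Rintegral fineK// integrable_fin_num.
have [||||| I1 I2] := @Rfatou _ (fun k x => coupling q b (shrink (mesh k) (z1 x)) (shrink (mesh k) (z2 x)))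
   (fun x => coupling q b (z1 x) (z2 x)) (fun=> (N / sigma) `^ q) ((N / sigma) `^ q).
- move=> k; apply: continuous_measurable_fun => x; apply: coupling_cvg => //;
  apply: shrink_cvg; try exact: cvg_cst; [exact: c1|exact: c2].
- by move=> k x; exact: coupling_ge0.
- move=> x.
  have E (t : R) : coupling q b (z1 x) t = coupling q b (shrink 0 (z1 x)) t.
    by rewrite /shrink subr0 (max_idPl _)// /coupling normr_id.
  have E' (t : R) : coupling q b t (z2 x) = coupling q b t (shrink 0 (z2 x)).
    by rewrite /shrink subr0 (max_idPl _)// /coupling normr_id.
  rewrite E E'; apply: coupling_cvg => //; apply: shrink_cvg; try exact: cvg_cst.
    exact: (mesh_cvg (s := id)).
  exact: (mesh_cvg (s := id)).
- by move=> k; apply: Heps; exact: mesh_gt0.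
- exact: cvg_cst.
split => //; rewrite mulrC -ler_pdivlMr//.
have NS0 : 0 <= N / sigma by rewrite divr_ge0// ltW.
have -> : N / sigma = ((N / sigma) `^ q) `^ q^-1.
  by rewrite -powRrM mulfV ?gt_eqF// powRr1.
apply: ge0_ler_powR; rewrite ?nnegrE ?invr_ge0 ?powR_ge0 ?(ltW q0)//.
by apply: Rintegral_ge0 => x _; exact: coupling_ge0.
Qed.

End CycleSample.

(** * Half-line profiles *)

Section HalfCycle.
Context {R : realType}.
Variable (K : nat).
Hypothesis K0 : (0 < K)%N.
Local Notation M := (K.*2).+1.
Local Notation T := 'I_M.
Implicit Types (u v g : T -> R) (k : nat).

Definition dist_decreasing u := forall x y : T, (dist0 x < dist0 y)%N -> u y <= u x.

(* The values at distances 0, 1, ..., K from the origin, then constant. *)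
Definition profile u k : R := u (inord (minn k K)).

Lemma profileE u k : (k <= K)%N -> profile u k = u (inord k).
Proof. by move=> kK; rewrite /profile (minn_idPl kK). Qed.

Lemma dist0_inord k : (k <= K)%N -> dist0 (inord k : T) = k.
Proof. by move=> kK; rewrite /dist0 inordK; lia. Qed.

Lemma dist0_inord_rev k : (k < K)%N -> dist0 (inord (K.*2 - k) : T) = k.+1.
Proof. by move=> kK; rewrite /dist0 inordK; lia. Qed.

Lemma profile_le u k : dist_decreasing u -> profile u k.+1 <= profile u k.
Proof.
move=> D; have [kK|Kk] := ltnP k K; last by rewrite /profile !(minn_idPr _)// leqW.
by rewrite !profileE// 1?ltnW//; apply: D; rewrite !dist0_inord// ltnW.
Qed.

Lemma nxt_inord k : (k < K.*2)%N -> nxt (inord k : T) = inord k.+1.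
Proof.
move=> kK; apply: ord_inj; have e : nat_of_ord (inord k : T) = k by rewrite inordK//; lia.
by rewrite val_nxt// e inordK ?ifT; lia.
Qed.

Lemma sum_cycle g : \sum_x g x = \sum_(0 <= k < M) g (inord k).
Proof. by rewrite big_mkord; apply: eq_bigr => x _; rewrite inord_val. Qed.

Lemma sum_half_le g : (forall x, 0 <= g x) -> \sum_(k < K) g (inord k) <= \sum_x g x.
Proof.
move=> g0; rewrite sum_cycle (@big_cat_nat _ _ _ K)//=; last by lia.
by rewrite -(big_mkord xpredT (fun k => g (inord k)))/= lerDl sumr_ge0.
Qed.

Lemma sum_fold g :
  \sum_x g x = g (inord 0) + \sum_(k < K) g (inord k.+1) + \sum_(k < K) g (inord (K.*2 - k)).
Proof.
rewrite sum_cycle big_nat_recl//= -addrA; congr (_ + _).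
rewrite (@big_cat_nat _ _ _ K)//=; last by lia.
congr (_ + _); first by rewrite big_mkord.
rewrite -{1}[K]add0n big_addn (_ : K.*2 - K = K)%N; last by lia.
rewrite big_mkord.
rewrite (reindex_inj rev_ord_inj)/=; apply: eq_bigr => k _.
by congr (g (inord _)); have := ltn_ord k; lia.
Qed.

(** Sites at equal distances are not comparable. The value at distance k + 2 on the right is
    therefore bounded by the one at distance k + 1 on the left, and the value at distance 1 by the
    one at the origin. *)
Lemma sum_fold_le g : dist_decreasing g -> (forall x, 0 <= g x) ->
  2 * \sum_(k < K) g (inord k.+1) <= \sum_x g x.
Proof.
move=> D g0; rewrite sum_fold mulr2n mulrDl !mul1r addrAC lerD2r.
have : \sum_(k < K) g (inord k.+1) <= g (inord 0) + \sum_(k < K.-1) g (inord (K.*2 - k)).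
  have -> : \sum_(k < K) g (inord k.+1) = \sum_(k < K.-1.+1) g (inord k.+1) by rewrite prednK.
  rewrite big_ord_recl; apply: lerD; first by apply: D; rewrite !dist0_inord.
  apply: ler_sum => k _; apply: D; have := ltn_ord k => kK.
  by rewrite lift0 dist0_inord_rev ?dist0_inord//; lia.
move=> /le_trans -> //; rewrite lerD2l -[X in \sum_(k < X) _ <= _]/(K.-1).
have -> : \sum_(k < K) g (inord (K.*2 - k)) = \sum_(k < K.-1.+1) g (inord (K.*2 - k)) by rewrite prednK.
by rewrite big_ord_recr/= lerDl.
Qed.

Lemma profile_quad (h a : R) u : 0 < h -> 0 <= a ->
  h * \sum_(k < K) a * profile u k ^+ 2 +
  h^-1 * \sum_(k < K) (profile u k.+1 - profile u k) ^+ 2 <= quad h a u.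
Proof.
move=> h0 a0; apply: lerD.
  apply: ler_wpM2l; first exact: ltW.
  have := @sum_half_le (fun x => a * u x ^+ 2) (fun x => mulr_ge0 a0 (sqr_ge0 _)).
  by congr (_ <= _); apply: eq_bigr => k _; rewrite profileE// ltnW.
apply: ler_wpM2l; first by rewrite invr_ge0 ltW.
have := @sum_half_le (fun x => (u (nxt x) - u x) ^+ 2) (fun x => sqr_ge0 _).
by congr (_ <= _); apply: eq_bigr => k _; have := ltn_ord k => kK;
  rewrite !profileE ?(ltnW kK)// nxt_inord//; lia.
Qed.

Lemma profile_second_difference u k : (k.+1 < K)%N ->
  profile u k.+2 - 2 * profile u k.+1 + profile u k =
  u (nxt (inord k.+1)) - 2 * u (inord k.+1) + u (prv (inord k.+1)).
Proof.
move=> kK; have kK2 : (k < K.*2)%N by lia.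
by rewrite -(nxt_inord kK2) nxtK !profileE ?nxt_inord//; lia.
Qed.

End HalfCycle.

(** * A uniform bound for monotone profiles *)

Section ProfileBound.
Context {R : realType}.

(** A discrete form of the bound of w(0)^2 by w(L)^2 + int (w^2 + w'^2). Telescoping reduces w(0) to
    the last value, and that value is bounded by the average of w^2 because w is decreasing and the
    half-length is at least 1. *)
Lemma profile_sup (h a S : R) (K : nat) (w : nat -> R) : 0 < h -> 0 < a -> 1 <= K%:R * h ->
  (forall k, 0 <= w k) -> (forall k, w k.+1 <= w k) ->
  h * \sum_(k < K) a * w k ^+ 2 + h^-1 * \sum_(k < K) (w k.+1 - w k) ^+ 2 <= S ->
  w 0%N ^+ 2 <= S + 2 * (S / a).
Proof.
move=> h0 a0 Kh w0 wd HS.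
set X := \sum_(k < K) w k ^+ 2; set Y := \sum_(k < K) (w k.+1 - w k) ^+ 2.
have {}HS : a * (h * X) + h^-1 * Y <= S by move: HS; rewrite -mulr_sumr mulrCA.
have X0 : 0 <= X by apply: sumr_ge0 => k _; exact: sqr_ge0.
have Y0 : 0 <= Y by apply: sumr_ge0 => k _; exact: sqr_ge0.
have hX0 : 0 <= h * X by rewrite mulr_ge0 ?(ltW h0).
have hY0 : 0 <= h^-1 * Y by rewrite mulr_ge0 ?invr_ge0 ?(ltW h0).
have wK n : w n ^+ 2 <= w 0%N ^+ 2 /\ (forall k, (k <= n)%N -> w n ^+ 2 <= w k ^+ 2).
  have H k : (k <= n)%N -> w n ^+ 2 <= w k ^+ 2.
    elim: n => [|n IH]; first by rewrite leqn0 => /eqP ->.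
    rewrite leq_eqVlt => /predU1P[->//|kn]; apply: le_trans (IH kn).
    by apply: lerXn2r; rewrite ?nnegrE.
  by split => //; exact: H.
have tail : w K ^+ 2 <= h * X.
  have w20 : 0 <= w K ^+ 2 by exact: sqr_ge0.
  apply: (@le_trans _ _ (K%:R * h * w K ^+ 2)); first by rewrite ler_peMl.
  rewrite mulrAC mulrC; apply: ler_wpM2l; first exact: ltW.
  have -> : K%:R * w K ^+ 2 = \sum_(k < K) w K ^+ 2 by rewrite sumr_const card_ord mulr_natl.
  apply: ler_sum => k _.
  by apply: (wK K).2; exact: ltnW.
have tele n : w 0%N ^+ 2 <= w n ^+ 2 + (h * \sum_(k < n) w k ^+ 2 + h^-1 * \sum_(k < n) (w k.+1 - w k) ^+ 2).
  elim: n => [|n IH]; first by rewrite !big_ord0 !mulr0 !addr0.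
  rewrite !big_ord_recr/= !mulrDr.
  suff : w n ^+ 2 <= w n.+1 ^+ 2 + (h * w n ^+ 2 + h^-1 * (w n.+1 - w n) ^+ 2) by move: IH; lra.
  have h1 := wd n; have h2 := w0 n.+1; move: (w n) (w n.+1) h1 h2 => s t ts t0.
  have -> : h^-1 * (t - s) ^+ 2 = h * ((s - t) / h) ^+ 2 by field; rewrite gt_eqF.
  have {1}-> : s ^+ 2 = t ^+ 2 + h * (((s - t) / h) * (s + t)) by field; rewrite gt_eqF.
  rewrite lerD2l -mulrDr; apply: ler_wpM2l; first exact: ltW.
  have d0 : 0 <= (s - t) / h by rewrite divr_ge0 ?(ltW h0)// subr_ge0.
  move: (_ / h) d0 => d d0.
  apply: (@le_trans _ _ (d * (2 * s))); first by apply: ler_wpM2l => //; lra.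
  by have := sqr_ge0 (s - d); rewrite sqrrB; lra.
have SX : h * X <= S / a by rewrite ler_pdivlMr// mulrC; move: HS hY0; lra.
have := tele K; rewrite -/X -/Y.
have : 0 <= a * (h * X) by rewrite mulr_ge0// ltW.
by move: HS tail SX; lra.
Qed.

End ProfileBound.

(** * Right halves of the lattice minimisers *)

Section DiscreteProfile.
Context {R : realType}.
Variables (q b al be : R).
Hypotheses (q2 : 2 <= q) (b0 : 0 < b) (al0 : 0 < al) (be0 : 0 < be).
Local Notation G := (coupling q b).
Local Notation f := (force q b).

(** Euler's identity for a function homogeneous of degree 2 q. *)
Lemma coupling_force (s t : R) : 0 <= s -> 0 <= t -> G s t = s * f s t + t * f t s.
Proof.
move=> s0 t0; have p1 (x r : R) : 1 < r -> 0 <= x -> x * x `^ (r - 1) = x `^ r.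
  move=> r1 x0; have [->|xn] := eqVneq x 0.
    by rewrite mul0r powR0// gt_eqF// (lt_trans ltr01 r1).
  by rewrite -{1}(powRr1 x0) -powRD ?xn ?implybT//; congr (_ `^ _); ring.
have q1 : 1 < q by move: q2; lra.
have q1' : 1 < 2 * q by move: q2; lra.
rewrite /coupling /force !ger0_norm// !mulrDr !p1//.
rewrite [s * (_ * _)]mulrCA [t * (_ * _)]mulrCA !p1//; ring.
Qed.

Lemma coupling_le_sq (B s t : R) : 0 <= s <= B -> 0 <= t <= B ->
  G s t <= (1 + b) * B `^ (2 * q - 2) * (s ^+ 2 + t ^+ 2).
Proof.
move=> hs ht; have h1 := force_lin q2 b0 hs ht; have h2 := force_lin q2 b0 ht hs.
case/andP: hs => s0 _; case/andP: ht => t0 _.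
rewrite coupling_force//; move: (_ * B `^ _) h1 h2 => C h1 h2.
have := ler_wpM2l s0 h1; have := ler_wpM2l t0 h2; lra.
Qed.

(** What is retained of a minimiser on its right half: monotonicity, the Euler-Lagrange equations
    away from the origin, one-sided substitutes at the origin, half of the unit mass with a lower
    bound on the amplitude, and energy bounds. The mass sum starts at index 1 because of
    [sum_fold_le]. *)
Definition is_profile (n : nat) (S : R) (a c : nat -> R) : Prop := [/\
  forall k, [/\ 0 <= a k, 0 <= c k, a k.+1 <= a k & c k.+1 <= c k],
  forall k, (k.+1 < half n)%N ->
    a k.+2 - 2 * a k.+1 + a k = mesh n ^+ 2 * (al * a k.+1 - S * f (a k.+1) (c k.+1)) /\
    c k.+2 - 2 * c k.+1 + c k = mesh n ^+ 2 * (be * c k.+1 - S * f (c k.+1) (a k.+1)),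
  a 0%N - a 1%N <= mesh n ^+ 2 * (S * f (a 0%N) (c 0%N)) /\
  c 0%N - c 1%N <= mesh n ^+ 2 * (S * f (c 0%N) (a 0%N)),
  (mesh n * \sum_(k < half n) G (a k.+1) (c k.+1) <= 2^-1 /\
   1 <= (1 + b) * (a 0%N + c 0%N) `^ (2 * q - 2) * (S / al + S / be)) &
  mesh n * \sum_(k < half n) al * a k ^+ 2 +
     (mesh n)^-1 * \sum_(k < half n) (a k.+1 - a k) ^+ 2 <= S /\
  mesh n * \sum_(k < half n) be * c k ^+ 2 +
     (mesh n)^-1 * \sum_(k < half n) (c k.+1 - c k) ^+ 2 <= S].

Lemma exists_profile n : exists S a c, is_profile n S a c /\
  forall u v : 'I_((half n).*2).+1 -> R, (forall x, 0 <= u x) -> (forall x, 0 <= v x) ->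
     S * Fh q b (mesh n) u v `^ q^-1 <= quad (mesh n) al u + quad (mesh n) be v.
Proof.
have h0 : 0 < mesh n :> R by exact: mesh_gt0.
have K0 := half_gt0 n.
have [u [v [S [[u0 v0] F1 QS Hmin Hd]]]] := discrete_minimizer q2 b0 K0 h0 al0 be0.
exists S, (profile u), (profile v); split => //.
have Du : dist_decreasing u by move=> x y /Hd [].
have Dv : dist_decreasing v by move=> x y /Hd [].
have Qu0 := quad_ge0 h0 u (ltW al0); have Qv0 := quad_ge0 h0 v (ltW be0).
have S0 : 0 <= S by rewrite -QS addr_ge0.
have minu u' : (forall x, 0 <= u' x) ->
    S * Fh q b (mesh n) u' v `^ q^-1 <= quad (mesh n) al u' + quad (mesh n) be v.
  by move=> h; exact: Hmin.
have minv v' : (forall x, 0 <= v' x) ->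
    S * Fh q b (mesh n) v' u `^ q^-1 <= quad (mesh n) be v' + quad (mesh n) al u.
  by move=> h; rewrite FhC addrC; exact: Hmin.
have ELu := discrete_euler_lagrange q2 b0 h0 (ltW al0) S0 u0 v0 F1 QS minu.
have F1' : Fh q b (mesh n) v u = 1 by rewrite FhC.
have QS' : quad (mesh n) be v + quad (mesh n) al u = S by rewrite addrC.
have ELv := discrete_euler_lagrange q2 b0 h0 (ltW be0) S0 v0 u0 F1' QS' minv.
have Zle (w : 'I_((half n).*2).+1 -> R) x : dist_decreasing w -> w x <= w (inord 0 : 'I_((half n).*2).+1).
  move=> Dw; have [d0|d0] := posnP (dist0 x); last by apply: Dw; rewrite dist0_inord.
  suff -> : x = inord 0 by [].
  by apply: ord_inj; rewrite inordK//; move: d0 (ltn_ord x); rewrite /dist0; lia.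
(* The left neighbour of the origin need not equal the right one, but it is at most the value at the
   origin; this leaves a one-sided bound on the first difference. *)
have first (a : R) (w : 'I_((half n).*2).+1 -> R) (t : R) : dist_decreasing w -> (forall x, 0 <= w x) -> 0 <= a ->
    w (nxt (inord 0)) - 2 * w (inord 0) + w (prv (inord 0)) = mesh n ^+ 2 * (a * w (inord 0) - t) ->
    profile w 0 - profile w 1 <= mesh n ^+ 2 * t.
  move=> Dw w0 a0; rewrite nxt_inord//.
  rewrite !profileE// => E.
  have := Zle w (prv (inord 0)) Dw.
  have : 0 <= mesh n ^+ 2 * (a * w (inord 0)) by rewrite !mulr_ge0// ltW.
  by move: E; lra.
split.
- by move=> k; split; try exact: profile_le; rewrite /profile.
- move=> k kK; rewrite !profile_second_difference// ELu ELv.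
  by rewrite !profileE ?(ltnW kK).
- split; first by apply: (first al) => //; rewrite ?(ltW al0)// ELu !profileE.
  by apply: (first be) => //; rewrite ?(ltW be0)// ELv !profileE.
- split.
    pose g (x : 'I_((half n).*2).+1) := G (u x) (v x).
    have Dg : dist_decreasing g.
      move=> x y xy; apply: coupling_le => //; rewrite !ger0_norm//; [exact: Du|exact: Dv].
    have := sum_fold_le K0 Dg (fun x => coupling_ge0 q b0 _ _).
    rewrite -(ler_pM2l h0) -/(Fh q b (mesh n) u v) F1 => H.
    have -> : \sum_(k < half n) G (profile u k.+1) (profile v k.+1) =
              \sum_(k < half n) g (inord k.+1).
      by apply: eq_bigr => k _; rewrite !profileE.
    by move: H; rewrite mulrCA; lra.
  (* The unit mass is at most (1 + b) B^(2q-2) times the sum of the squared l^2 norms, and these are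
     at most S / al and S / be. *)
  set B := profile u 0 + profile v 0; set C := (1 + b) * B `^ _.
  have C0 : 0 <= C by rewrite mulr_ge0 ?powR_ge0// addr_ge0// ltW.
  have uB x : 0 <= u x <= B /\ 0 <= v x <= B.
    have := Zle u x Du; have := Zle v x Dv; rewrite u0 v0 /= /B !profileE// => h1 h2.
    by have := u0 (inord 0); have := v0 (inord 0); lra.
  rewrite -F1; apply: (@le_trans _ _ (mesh n * \sum_x C * (u x ^+ 2 + v x ^+ 2))).
    apply: ler_wpM2l; first exact: ltW.
    by apply: ler_sum => x _; apply: coupling_le_sq; have [] := uB x.
  rewrite -mulr_sumr mulrCA; apply: ler_wpM2l => //.
  rewrite big_split/= mulrDr; apply: lerD.
    rewrite ler_pdivlMr// -mulrA [_ * al]mulrC mulr_sumr; move: QS Qv0; rewrite {1}/quad.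
    have : 0 <= (mesh n)^-1 * \sum_x (u (nxt x) - u x) ^+ 2.
      by rewrite mulr_ge0 ?invr_ge0 ?(ltW h0)// sumr_ge0// => x _; exact: sqr_ge0.
    by lra.
  rewrite ler_pdivlMr// -mulrA [_ * be]mulrC mulr_sumr; move: QS' Qu0; rewrite {1}/quad.
  have : 0 <= (mesh n)^-1 * \sum_x (v (nxt x) - v x) ^+ 2.
    by rewrite mulr_ge0 ?invr_ge0 ?(ltW h0)// sumr_ge0// => x _; exact: sqr_ge0.
  by lra.
- split; apply: le_trans (profile_quad _ _ _ _) _ => //; try exact: ltW.
    by move: QS Qv0; lra.
  by move: QS' Qu0; lra.
Qed.

End DiscreteProfile.

(** * Boundedness of the discrete levels *)

Section LevelBound.
Context {R : realType}.
Local Notation mu := (@lebesgue_measure R).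

Lemma continuous_support_L2 (f : R -> R) (A : R) : continuous f ->
  (forall s, A <= `|s| -> f s = 0) -> L2 f.
Proof.
move=> cf f0; split; first exact: continuous_measurable_fun.
apply: (@integrable_support _ `[- A, A]) => //.
  move=> s; rewrite /= in_itv/= -ler_norml => /negP; rewrite -ltNge => /ltW /f0 ->.
  by rewrite expr0n.
apply: intg_cont => x; exact: (cvg_comp _ _ (cf x) (@exprn_continuous R 2 (f x))).
Qed.

Lemma test_AC (phi : R -> R) : test_function phi -> AC phi phi^`().
Proof.
move=> tphi; have [dp cp] := test_C1 tphi; have [A A0 HA] := test_support tphi.
split; last exact: C1_primitive.
  by apply: (@continuous_support_L2 _ A) => [|s /HA[]//]; exact: C1_continuous.
by apply: (@continuous_support_L2 _ A) => [|s /HA[]//].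
Qed.

Variables (q b al be : R).
Hypotheses (q2 : 2 <= q) (b0 : 0 < b) (al0 : 0 < al) (be0 : 0 < be).

(** If the levels exceeded N + 1 along a subsequence, [comparison] would yield the inequality with
    constant N + 1 for a fixed pair of squared norm N and mass at least 1. *)
Lemma level_bounded (S : nat -> R) :
  (forall n (u v : 'I_((half n).*2).+1 -> R), (forall x, 0 <= u x) -> (forall x, 0 <= v x) ->
    S n * Fh q b (mesh n) u v `^ q^-1 <= quad (mesh n) al u + quad (mesh n) be v) ->
  exists2 C : R, 0 < C & \forall n \near \oo, S n <= C.
Proof.
move=> HS.
(* A bump equal to 1 on [0, 1], so that the pair (z, 0) has mass at least 1. *)
pose z := ramp (-1) 1 \- ramp 1 1 : R -> R.
have Az : AC z z^`() by apply: test_AC; apply: ramp_test => //; rewrite ltr1n.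
have A0 : AC (cst 0 : R -> R) (cst 0).
  have L0 : L2 (cst 0 : R -> R) by apply: (@continuous_support_L2 _ 0) => // s; exact: cvg_cst.
  by split => // x y xy; rewrite Rintegral_itv_cst// subrr mul0r.
set N := sq_norm al z z^`() + sq_norm be (cst 0) (cst 0).
have N0 : 0 <= N by rewrite addr_ge0// sq_norm_ge0// ltW.
exists (N + 1); first by rewrite ltr_wpDl.
apply: contrapT => H.
have Hs j : exists n, (j <= n)%N /\ N + 1 < S n.
  apply: contrapT => nH; apply: H; exists j => // n /= jn; rewrite leNgt; apply/negP => Sn.
  by apply: nH; exists n.
have [s Hs'] := choice Hs.
have [|||||I1 I2] := @comparison R q b q2 b0 al be s (fun=> N + 1) (N + 1) z z^`() (cst 0) (cst 0)
   (ltW al0) (ltW be0) _ _ _ _ _ Az A0.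
- by move=> j; exact: (Hs' j).1.
- by move=> _; rewrite ltr_wpDl.
- by rewrite ltr_wpDl.
- exact: cvg_cst.
- move=> j u v u0 v0; apply: le_trans (HS _ u v u0 v0); apply: ler_wpM2r; first exact: powR_ge0.
  exact: ltW (Hs' j).2.
have q0 : 0 < q by move: q2; lra.
have : 1 <= (\int[mu]_x coupling q b (z x) (cst 0 x)) `^ q^-1.
  have p1 : (1 : R) `^ q^-1 = 1 by rewrite powR1.
  rewrite -[1 in leLHS]p1; apply: ge0_ler_powR; rewrite ?nnegrE ?invr_ge0 ?(ltW q0)//.
    by apply: Rintegral_ge0 => x _; exact: coupling_ge0.
  apply: (@le_trans _ _ (\int[mu]_(x in `[0, 1]) coupling q b (z x) (cst 0 x))); last first.
    by apply: Rintegral_subset => // x _; exact: coupling_ge0.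
  have {1}-> : 1 = \int[mu]_(x in `[0, 1]) (1 : R) by rewrite Rintegral_itv_cst// mul1r subr0.
  apply: le_Rintegral => //; [exact: intg_cst|exact: intgS I1|].
  move=> x; rewrite /= in_itv/= => /andP[x0 x1].
  rewrite /z /= ramp_ge ?ramp_le//; last by rewrite addNr.
  rewrite subr0 /coupling normr1 normr0 !powR1 !powR0 ?gt_eqF ?mulr_gt0//.
  by rewrite !mulr0 !addr0.
move: I2; rewrite -/N => I2 h; have : (N + 1) * 1 <= N.
  by apply: le_trans I2; apply: ler_wpM2l => //; rewrite addr_ge0.
lra.
Qed.

End LevelBound.

(** * Extraction of a convergent subsequence *)

Section Subsequence.
Context {R : realType}.

Lemma fmap_ultra (S T : Type) (f : S -> T) (U : set_system S) :
  UltraFilter U -> UltraFilter (f @ U).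
Proof.
move=> UU; have FU : ProperFilter U by exact: ultra_proper.
split; first exact: fmap_proper_filter.
move=> G FG UG; apply/seteqP; split => // B GB.
have [//|nB] := in_ultra_setVsetC (f @^-1` B) UU.
have /UG GnB : (f @ U) (~` B) by [].
have : G set0 by rewrite -(setICr B); exact: filterI.
by move=> /(@filter_not_empty _ G FG).
Qed.

(** A form of Arzelà-Ascoli for step functions that are Lipschitz only up to the mesh size. An
    ultrafilter finer than \oo gives limits at all points at once; an ordinary subsequence, as
    needed for Fatou, is then recovered by matching these limits on finer and finer finite grids. *)
Lemma equicontinuous_subsequence (I : finType) (W : I -> nat -> R -> R) (L : R -> R) (Pr : nat -> Prop) :
  (forall A : R, 0 <= A -> 0 <= L A) ->
  (forall A : R, 0 <= A -> \forall n \near \oo, forall i (x y : R), 0 <= x <= A -> 0 <= y <= A ->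
     `|W i n x - W i n y| <= L A * (`|x - y| + 2 * mesh n)) ->
  (forall x : R, 0 <= x -> exists B : R, \forall n \near \oo, forall i, `|W i n x| <= B) ->
  (\forall n \near \oo, Pr n) ->
  exists s : nat -> nat, exists w : I -> R -> R, [/\ forall j, (j <= s j)%N, forall j, Pr (s j) &
    forall i (x : R), 0 <= x -> (fun j => W i (s j) x) @ \oo --> w i x].
Proof.
move=> L0 HL HB HPr.
have [U [UU ooU]] := ultraFilterLemma (eventually_filter : ProperFilter (\oo : set_system nat)).
have FU : ProperFilter U by exact: ultra_proper.
have cU (u : nat -> R) (l : R) : u @ \oo --> l -> u @ U --> l.
  by move=> h A /h; exact: ooU.
have ex i (x : R) : exists l : R, 0 <= x -> W i n x @[n --> U] --> l.
  have [x0|_] := leP 0 x; last by exists 0.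
  have [B nB] := HB x x0.
  have := @segment_compact R (- B) B; rewrite compact_ultra => /(_ (W i ^~ x @ U)) [].
    exact: fmap_ultra.
    apply: ooU; apply: filterS nB => n /(_ i); rewrite /= in_itv/= ler_norml//.
  by move=> l [_ cl]; exists l => _.
have [w Hw] := choice (fun ix : I * R => ex ix.1 ix.2).
have {}Hw i x : 0 <= x -> W i n x @[n --> U] --> w (i, x) := Hw (i, x).
have Lw i A x y : 0 <= x <= A -> 0 <= y <= A -> `|w (i, x) - w (i, y)| <= L A * `|x - y|.
  move=> hx hy; have x0 := proj1 (andP hx); have y0 := proj1 (andP hy).
  have A0 : 0 <= A by apply: le_trans x0 (proj2 (andP hx)).
  have c1 : `|W i n x - W i n y| @[n --> U] --> `|w (i, x) - w (i, y)|.
    by apply: cvg_norm; apply: cvgB; exact: Hw.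
  have c2 : L A * (`|x - y| + 2 * mesh n) @[n --> U] --> L A * (`|x - y| + 2 * 0).
    apply: cU; apply: cvgM; first exact: cvg_cst.
    apply: cvgD; first exact: cvg_cst.
    by apply: cvgM; [exact: cvg_cst|exact: (mesh_cvg (s := id))].
  rewrite mulr0 addr0 in c2.
  by apply: (ler_cvg_to c1 c2); apply: ooU; apply: filterS (HL A A0) => n /(_ i x y hx hy).
pose grid m (k : nat) : R := k%:R * mesh m.
(* Finitely many closeness conditions hold simultaneously along the ultrafilter, hence at some index
   n >= m. *)
have exs m : exists n, [/\ (m <= n)%N, Pr n & forall i (k : 'I_(half m)),
   `|W i n (grid m k) - w (i, grid m k)| <= mesh m].
  suff : \near U, [/\ (m <= U)%N, Pr U & forall i (k : 'I_(half m)),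
       `|W i U (grid m k) - w (i, grid m k)| <= mesh m] by exact: filter_ex.
  have h1 : \near U, (m <= U)%N by apply: ooU; exact: nbhs_infty_ge.
  have h2 : \near U, Pr U by exact: ooU.
  have h3 : \near U, forall i (k : 'I_(half m)), `|W i U (grid m k) - w (i, grid m k)| <= mesh m.
    apply: filter_forall => i; apply: filter_forall => k.
    have /cvgrPdist_le /(_ _ (mesh_gt0 m)) := Hw i (grid m k) (mulr_ge0 (ler0n _ _) (ltW (mesh_gt0 m))).
    by apply: filterS => n; rewrite distrC.
  by apply: filterS3 h1 h2 h3.
have [s Hs] := choice exs.
exists s, (fun i x => w (i, x)); split; try by move=> j; have [] := Hs j.
move=> i x x0; apply/cvgrPdist_le => /= e e0.
pose A := x; have A0 : 0 <= A by [].
have sj j : (j <= s j)%N by have [] := Hs j.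
have cm := @mesh_cvg R s sj; have cm0 : mesh n @[n --> \oo] --> (0 : R) by exact: (mesh_cvg (s := id)).
have cb : (fun j => L A * (mesh j + 2 * mesh (s j)) + mesh j + L A * mesh j) @ \oo -->
   L A * (0 + 2 * 0) + 0 + L A * 0.
  apply: cvgD; [apply: cvgD => //|]; (apply: cvgM; first exact: cvg_cst) => //.
  by apply: cvgD => //; apply: cvgM; [exact: cvg_cst|exact: cm].
rewrite !mulr0 !addr0 mulr0 in cb.
have HLs : \forall j \near \oo, forall i (x y : R), 0 <= x <= A -> 0 <= y <= A ->
     `|W i (s j) x - W i (s j) y| <= L A * (`|x - y| + 2 * mesh (s j)).
  have [N _ HN] := HL A A0; exists N => // j Nj; apply: HN; exact: leq_trans Nj (sj j).
have LA0 := L0 A A0.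
near=> j.
pose k := Num.truncn (x * j.+1%:R).
have xj : x < j.+1%:R by near: j; exact: (near_ge_nat (s := id)).
have := @truncn_itv R (x * j.+1%:R); rewrite mulr_ge0// => /(_ isT) /andP[k1 k2].
have kh : (k < half j)%N.
  rewrite -(ltr_nat R); apply: le_lt_trans k1 _; rewrite /half natrM ltr_pM2r//.
have [_ _ /(_ i (Ordinal kh)) /= Hk] := Hs j.
have y0 : 0 <= grid j k by rewrite mulr_ge0// ltW// mesh_gt0.
have yx : grid j k <= x by rewrite /grid /mesh ler_pdivrMr.
have xy : `|x - grid j k| <= mesh j.
  rewrite ger0_norm ?subr_ge0// lerBlDl /grid -{2}[mesh j]mul1r -mulrDl /mesh ler_pdivlMr//.
  by rewrite natr1 ltW.
have hx : 0 <= x <= A by rewrite x0 lexx.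
have hy : 0 <= grid j k <= A by rewrite y0 yx.
have H1 : `|W i (s j) x - W i (s j) (grid j k)| <= L A * (`|x - grid j k| + 2 * mesh (s j)).
  exact: (near HLs j).
have H2 := Lw i A x (grid j k) hx hy.
have H3 : L A * (mesh j + 2 * mesh (s j)) + mesh j + L A * mesh j <= e.
  near: j; have /cvgrPdist_le /(_ e e0) := cb; apply: filterS => j; rewrite sub0r normrN.
  by apply: le_trans; exact: ler_norm.
have H4 := ler_wpM2l LA0 xy.
move: H1; rewrite mulrDr => H1; rewrite mulrDr in H3.
have -> : w (i, x) - W i (s j) x = (w (i, x) - w (i, grid j k)) -
  (W i (s j) (grid j k) - w (i, grid j k)) - (W i (s j) x - W i (s j) (grid j k)) by ring.
apply: le_trans (ler_normB _ _) _; have := ler_normB (w (i, x) - w (i, grid j k))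
  (W i (s j) (grid j k) - w (i, grid j k)).
lra.
Unshelve. all: by end_near. Qed.

End Subsequence.

(** * Passage to the limit *)

Section Newton.
Context {R : realType}.
Variables (h D : R) (K : nat) (a p e : nat -> R).
Hypotheses (h0 : 0 < h) (D0 : 0 <= D).
Hypotheses (ap : forall k, a k.+1 - a k = h * p k) (p0 : `|p 0%N| <= h * D).
Hypotheses (pe : forall k, (k.+1 < K)%N -> p k.+1 - p k = h * e k.+1)
  (eD : forall k, `|e k| <= D).

Lemma slope_lip k m : (k + m < K)%N -> `|p (k + m) - p k| <= D * (h * m%:R).
Proof.
elim: m => [|m IH] kK; first by rewrite addn0 subrr normr0 !mulr0.
rewrite addnS in kK *; have {}IH := IH (ltnW kK).
have -> : p (k + m).+1 - p k = h * e (k + m).+1 + (p (k + m) - p k) by rewrite -pe//; ring.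
apply: le_trans (ler_normD _ _) _; rewrite normrM (gtr0_norm h0) -natr1.
have := ler_wpM2l (ltW h0) (eD (k + m).+1); lra.
Qed.

Lemma slope_le k : (k < K)%N -> `|p k| <= D * (h * k%:R + h).
Proof.
move=> kK; have := @slope_lip 0 k kK; rewrite add0n => H.
have -> : p k = (p k - p 0%N) + p 0%N by ring.
by apply: le_trans (ler_normD _ _) _; move: p0; lra.
Qed.

Lemma value_lip k m : (k + m <= K)%N ->
  `|a (k + m) - a k| <= D * (h * (k + m)%:R + h) * (h * m%:R).
Proof.
elim: m => [|m IH] kK; first by rewrite addn0 subrr normr0 !mulr0.
rewrite addnS in kK *; have {}IH := IH (ltnW kK).
have -> : a (k + m).+1 - a k = h * p (k + m) + (a (k + m) - a k) by rewrite -ap; ring.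
apply: le_trans (ler_normD _ _) _; rewrite normrM (gtr0_norm h0).
have H := ler_wpM2l (ltW h0) (slope_le kK); have h0' := ltW h0.
set X := (k + m)%:R in IH H *; rewrite -!natr1 -/X; set Y := m%:R in IH *.
have Y0 : 0 <= Y :> R by exact: ler0n.
have : 0 <= D * h * (h * (Y + 1)) by rewrite !mulr_ge0// addr_ge0.
lra.
Qed.

Lemma taylor k m : (k + m < K)%N ->
  `|a (k + m) - a k - h * m%:R * p k| <= D * (h * m%:R) ^+ 2.
Proof.
elim: m => [|m IH] kK; first by rewrite addn0 subrr !mulr0 mul0r subrr normr0 expr0n mulr0.
rewrite addnS in kK *; have {}IH := IH (ltnW kK).
have -> : a (k + m).+1 - a k - h * m.+1%:R * p k =
   h * (p (k + m) - p k) + (a (k + m) - a k - h * m%:R * p k) by rewrite mulrBr -ap -natr1; ring.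
apply: le_trans (ler_normD _ _) _; rewrite normrM (gtr0_norm h0).
have H := ler_wpM2l (ltW h0) (slope_lip (ltnW kK)); have h0' := ltW h0.
rewrite -!natr1; set Y := m%:R in IH H *.
have Y0 : 0 <= Y :> R by exact: ler0n.
have : 0 <= D * (h * (h * (Y + 1))) by rewrite !mulr_ge0// addr_ge0.
lra.
Qed.

(** The lower and upper bounds on the source are kept apart: with the monotonicity of the profiles
    they become values at the two ends of the interval, and they identify the derivative of the
    limiting slope. *)
Lemma slope_between k m lo hi : (k + m < K)%N ->
  (forall j, (k <= j <= k + m)%N -> lo <= e j <= hi) ->
  h * m%:R * lo <= p (k + m) - p k <= h * m%:R * hi.
Proof.
elim: m => [|m IH] kK H; first by rewrite addn0 subrr !mulr0 !mul0r lexx.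
rewrite addnS in kK H *.
have /IH : (k + m < K)%N by exact: ltnW.
case/(_ _)/andP.
  by move=> j /andP[h1 h2]; apply: H; rewrite h1 leqW.
move=> h1 h2; have /andP[h3 h4] : lo <= e (k + m).+1 <= hi by apply: H; rewrite leqnn andbT leqW// leq_addr.
have := ler_wpM2l (ltW h0) h3; have := ler_wpM2l (ltW h0) h4; have := pe kK.
rewrite -natr1; lra.
Qed.

End Newton.

Definition cell {R : realType} n (x : R) := Num.truncn (x * n.+1%:R).

Section Cells.
Context {R : realType}.
Implicit Types (x y : R).

Lemma cell_le n x : 0 <= x -> (cell n x)%:R * mesh n <= x < (cell n x).+1%:R * mesh n.
Proof.
move=> x0; have h := mesh_gt0 n (R := R).
have := @truncn_itv R (x * n.+1%:R); rewrite mulr_ge0// => /(_ isT) /andP[k1 k2].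
by rewrite /mesh ler_pdivrMr// ltr_pdivlMr// k1.
Qed.

Lemma cell_lt n x : 0 <= x -> x < n.+1%:R -> (cell n x < half n)%N.
Proof.
move=> x0 xn; have /andP[h1 _] := cell_le n x0.
rewrite -(ltr_nat R) -(ltr_pM2r (mesh_gt0 n)) half_mesh; exact: le_lt_trans h1 xn.
Qed.

Lemma cell_homo n x y : x <= y -> (cell n x <= cell n y)%N.
Proof. by move=> xy; apply: le_truncn; rewrite ler_pM2r. Qed.

Lemma cell_cvg (s : nat -> nat) x : (forall j, (j <= s j)%N) -> 0 <= x ->
  (fun j => (cell (s j) x)%:R * mesh (s j)) @ \oo --> x.
Proof.
move=> sj x0; apply/cvgrPdist_le => /= e e0; near=> j.
have /andP[h1 h2] := cell_le (s j) x0.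
rewrite ger0_norm ?subr_ge0//; apply: (@le_trans _ _ (mesh (s j))).
  by move: h2; rewrite -natr1; lra.
near: j; have /cvgrPdist_le /(_ e e0) := @mesh_cvg R s sj.
by apply: filterS => j /=; rewrite sub0r normrN gtr0_norm ?mesh_gt0.
Unshelve. all: by end_near. Qed.

Lemma mesh_le1 n : mesh n <= 1 :> R.
Proof. by rewrite invf_le1// ler1n. Qed.

Lemma cell0 n : cell n (0 : R) = 0%N.
Proof. by rewrite /cell mul0r truncn0. Qed.

End Cells.

(** * Uniform estimates for the profiles and their slopes *)

Section DiscreteEstimates.
Context {R : realType}.
Variables (q b al be : R).
Hypotheses (q2 : 2 <= q) (b0 : 0 < b) (al0 : 0 < al) (be0 : 0 < be).
Local Notation G := (coupling q b).
Local Notation f := (force q b).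

Lemma is_profileC n (S : R) a c : is_profile q b al be n S a c -> is_profile q b be al n S c a.
Proof.
move=> [H1 H2 [H3 H3'] [H4 H4'] [H5 H5']]; split => //.
- by move=> k; have [] := H1 k.
- by move=> k /H2[].
- rewrite [c 0%N + _]addrC [S / be + _]addrC; split => //.
  by rewrite (eq_bigr (fun k : 'I__ => G (a k.+1) (c k.+1))) => // k _; rewrite couplingC.
Qed.

Lemma is_profile_S n (S : R) a c : is_profile q b al be n S a c -> 0 < S.
Proof.
move=> [H1 _ _ [_ H] _]; rewrite ltNge; apply/negP => S0.
have h1 : S / al <= 0 by rewrite pmulr_lle0 ?invr_gt0.
have h2 : S / be <= 0 by rewrite pmulr_lle0 ?invr_gt0.
have : (1 + b) * (a 0%N + c 0%N) `^ (2 * q - 2) * (S / al + S / be) <= 0.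
  rewrite mulr_ge0_le0// ?mulr_ge0 ?powR_ge0 ?addr_ge0 ?(ltW b0)//; lra.
lra.
Qed.

Variables (B C : R).
Hypotheses (B0 : 0 <= B) (C0 : 0 <= C).

Definition slope n (a : nat -> R) k := (a k.+1 - a k) / mesh n.

Definition source_bound := al * B + C * f B B.

Local Notation D := source_bound.

Lemma source_bound_ge0 : 0 <= D.
Proof. by rewrite addr_ge0// mulr_ge0// ?(ltW al0)//; exact: force_ge0. Qed.

Variables (n : nat) (S : R) (a c : nat -> R).
Hypotheses (P : is_profile q b al be n S a c) (SC : S <= C) (aB : a 0%N <= B) (cB : c 0%N <= B).

Let e k := al * a k - S * f (a k) (c k).

Lemma profile_anti k l : (k <= l)%N -> 0 <= a l <= a k.
Proof.
have [H1 _ _ _ _] := P; have [a0 _ _ _] := H1 l; rewrite a0 /=.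
elim: l {a0} => [|l IH]; first by rewrite leqn0 => /eqP ->.
rewrite leq_eqVlt => /predU1P[->//|kl]; apply: le_trans (IH kl); by have [] := H1 l.
Qed.

Let c_anti k l : (k <= l)%N -> 0 <= c l <= c k.
Proof.
have [H1 _ _ _ _] := P; have [_ c0 _ _] := H1 l; rewrite c0 /=.
elim: l {c0} => [|l IH]; first by rewrite leqn0 => /eqP ->.
rewrite leq_eqVlt => /predU1P[->//|kl]; apply: le_trans (IH kl); by have [] := H1 l.
Qed.

Let force_anti k l : (k <= l)%N -> f (a l) (c l) <= f (a k) (c k).
Proof.
move=> kl; have /andP[h1 h2] := profile_anti kl; have /andP[h3 h4] := c_anti kl.
have ak := le_trans h1 h2; have ck := le_trans h3 h4.
by apply: force_le => //; rewrite !ger0_norm.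
Qed.

Let S0 : 0 < S. Proof. exact: is_profile_S P. Qed.

Let force_B k : 0 <= f (a k) (c k) <= f B B.
Proof.
rewrite force_ge0//=; have /andP[h1 h2] := profile_anti (leq0n k).
have /andP[h3 h4] := c_anti (leq0n k).
by apply: force_le => //; rewrite !ger0_norm//; [exact: le_trans h2 aB|exact: le_trans h4 cB].
Qed.

Let eD k : `|e k| <= D.
Proof.
have /andP[h1 h2] := profile_anti (leq0n k); have /andP[h3 h4] := force_B k.
have h5 := ler_wpM2l (ltW al0) (le_trans h2 aB).
have h6 : S * f (a k) (c k) <= C * f B B by apply: ler_pM => //; exact: ltW.
have h7 : 0 <= al * a k by rewrite mulr_ge0// ltW.
have h8 : 0 <= S * f (a k) (c k) by rewrite mulr_ge0// ltW.
have h9 : 0 <= al * B by rewrite mulr_ge0// ltW.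
rewrite /e /D ler_norml; lra.
Qed.

Let h0 : 0 < mesh n :> R. Proof. exact: mesh_gt0. Qed.

Let ap k : a k.+1 - a k = mesh n * slope n a k.
Proof. by rewrite /slope mulrC divfK// gt_eqF. Qed.

(** The slope at the origin is of the order of the mesh, so the limiting slope vanishes at 0 and the
    even extension is differentiable there. *)
Lemma profile_slope0 : `|slope n a 0| <= mesh n * D.
Proof.
have [H1 _ [H3 _] _ _] := P; have [_ _ h1 _] := H1 0%N.
rewrite /slope normrM normrV ?unitfE ?gt_eqF// (gtr0_norm h0) ler_pdivrMr//.
rewrite distrC ger0_norm ?subr_ge0//; apply: le_trans H3 _.
rewrite [leRHS]mulrAC; apply: ler_wpM2l; first exact: sqr_ge0.
have /andP[h3 h4] := force_B 0.
have h6 : S * f (a 0%N) (c 0%N) <= C * f B B by apply: ler_pM => //; exact: ltW.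
have h9 : 0 <= al * B by rewrite mulr_ge0// ltW.
rewrite /D; lra.
Qed.

Let p0 := profile_slope0.

Let pe k : (k.+1 < half n)%N -> slope n a k.+1 - slope n a k = mesh n * e k.+1.
Proof.
have [_ H2 _ _ _] := P => /H2[H _]; rewrite /slope -mulrBl.
apply: (canLR (mulfK _)); first by rewrite gt_eqF.
by move: H; rewrite /e expr2; lra.
Qed.

Let hcell (x : R) : 0 <= x -> mesh n * (cell n x)%:R + mesh n <= x + 1.
Proof.
move=> /cell_le - /(_ n) /andP[h1 _]; have := @mesh_le1 R n; lra.
Qed.

Lemma profile_slope_le (x A : R) : 0 <= x <= A -> A < n.+1%:R ->
  `|slope n a (cell n x)| <= D * (A + 1).
Proof.
move=> /andP[x0 xA] An; have D0 := source_bound_ge0.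
apply: le_trans (slope_le h0 p0 pe eD (cell_lt x0 (le_lt_trans xA An))) _.
by apply: ler_wpM2l => //; have := hcell x0; lra.
Qed.

Lemma profile_quasi_lip (x y A : R) : 0 <= x <= A -> 0 <= y <= A -> A < n.+1%:R ->
  `|a (cell n x) - a (cell n y)| <= D * (A + 1) * (`|x - y| + 2 * mesh n) /\
  `|slope n a (cell n x) - slope n a (cell n y)| <= D * (A + 1) * (`|x - y| + 2 * mesh n).
Proof.
have D0 := source_bound_ge0.
wlog xy : x y / x <= y => [H|] hx hy An.
  have [xy|/ltW yx] := leP x y; first exact: H.
  by rewrite distrC [`|slope _ _ _ - _|]distrC [`|x - y|]distrC; exact: H.
case/andP: hx => x0 xA; case/andP: hy => y0 yA; have A0 := le_trans x0 xA.
have kl := cell_homo n xy; have lK := cell_lt y0 (le_lt_trans yA An).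
have /andP[x1 x2] := cell_le n x0; have /andP[y1 y2] := cell_le n y0.
have hy := hcell y0.
move: kl lK x1 x2 y1 y2 hy; set k := cell n x; set l := cell n y => kl lK x1 x2 y1 y2 hy.
have Em : mesh n * (l - k)%:R = l%:R * mesh n - k%:R * mesh n :> R by rewrite natrB//; ring.
have hm : 0 <= (mesh n : R) * (l - k)%:R <= `|x - y| + 2 * mesh n.
  rewrite mulr_ge0 ?(ltW h0)//= Em distrC ger0_norm ?subr_ge0//.
  move: x2; rewrite -natr1; have := h0; lra.
case/andP: hm => hm0 hm; have DA0 : 0 <= D * (A + 1) by rewrite mulr_ge0// addr_ge0.
have lk : (k + (l - k) = l)%N by rewrite subnKC.
split.
  rewrite distrC.
  have := value_lip h0 D0 ap p0 pe eD (k := k) (m := l - k); rewrite lk => /(_ (ltnW lK)).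
  move=> /le_trans; apply; apply: ler_pM => //.
    by rewrite mulr_ge0// addr_ge0 ?mulr_ge0// ltW.
  by apply: ler_wpM2l => //; lra.
rewrite distrC; have := slope_lip h0 pe eD (k := k) (m := l - k); rewrite lk => /(_ lK).
move=> /le_trans; apply; apply: ler_pM => //.
by rewrite ler_peMr// lerDr.
Qed.

(** Between two sites both a and the force are decreasing, so the source al a - S f lies between the
    combinations of end values stated here; no modulus of continuity enters. *)
Lemma profile_taylor (x y : R) : 0 <= x -> x <= y -> y < n.+1%:R ->
  let d := (cell n y)%:R * mesh n - (cell n x)%:R * mesh n in
  let k := cell n x in let l := cell n y in
  [/\ `|a l - a k - d * slope n a k| <= D * d ^+ 2,
   `|slope n a l - slope n a k| <= D * d,
    d * (al * a l - S * f (a k) (c k)) <= slope n a l - slope n a k &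
    slope n a l - slope n a k <= d * (al * a k - S * f (a l) (c l))].
Proof.
move=> x0 xy yn d k l; have y0 := le_trans x0 xy.
have kl := cell_homo n xy; have lK := cell_lt y0 yn; rewrite -/k -/l in kl lK.
have Em : mesh n * (l - k)%:R = d by rewrite natrB// /d; ring.
have lk : (k + (l - k) = l)%N by rewrite subnKC.
have kK : (k + (l - k) < half n)%N by rewrite lk.
have := taylor h0 source_bound_ge0 ap pe eD kK; rewrite lk Em => T1.
have := slope_lip h0 pe eD kK; rewrite lk Em => T2.
have := slope_between h0 pe (lo := al * a l - S * f (a k) (c k))
  (hi := al * a k - S * f (a l) (c l)) kK; rewrite lk Em => H.
have /H/andP[? ?] : forall j, (k <= j <= l)%N ->
    al * a l - S * f (a k) (c k) <= e j <= al * a k - S * f (a l) (c l).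
  move=> j /andP[kj jl].
  have /andP[_ h1] := profile_anti kj; have /andP[_ h2] := profile_anti jl.
  have h3 := force_anti kj; have h4 := force_anti jl.
  by rewrite /e !lerB// ler_wpM2l// ltW.
by split.
Qed.

End DiscreteEstimates.

(** * Fatou's lemma for even extensions *)

Section EvenFatou.
Context {R : realType}.
Local Notation mu := (@lebesgue_measure R).

(** The sums run over the right half only. Fatou is applied on the half-line, and evenness of the
    limit doubles the bound. *)
Lemma even_fatou (s : nat -> nat) (w : nat -> nat -> R) (g : R -> R) (B_ : nat -> R) (B : R) :
  (forall j, (j <= s j)%N) -> (forall j k, 0 <= w j k) ->
  continuous g -> (forall x, 0 <= g x) -> (forall x, g (- x) = g x) ->
  (forall x, 0 <= x -> (fun j => w j (cell (s j) x)) @ \oo --> g x) ->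
  (forall j, mesh (s j) * \sum_(k < half (s j)) w j k <= B_ j) -> B_ @ \oo --> B ->
  mu.-integrable setT (EFin \o g) /\ \int[mu]_x g x <= 2 * B.
Proof.
move=> sj w0 cg g0 ge cw wB cB.
pose phi x := if 0 <= x then g x else 0.
have [|||||I1 I2] := @Rfatou _ (fun j => stepf 0 (mesh (s j)) (half (s j)) (w j)) phi B_ B.
- by move=> j; exact: measurable_stepf.
- by move=> j x; exact: stepf_ge0.
- move=> x; rewrite /phi; case: ifPn => [x0|]; last first.
    rewrite -ltNge => x0; apply: cvg_near_cst; apply: nearW => j.
    by rewrite stepf_out//; exact: mesh_gt0.
  apply: cvg_trans (cw x x0); apply: near_eq_cvg; near=> j; symmetry.
  apply: stepfE; first exact: mesh_gt0.
    by apply: cell_lt => //; near: j; exact: near_ge_nat.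
  by rewrite !add0r; exact: cell_le.
- by move=> j; rewrite integral_stepf ?lee_fin//; exact: mesh_gt0.
- exact: cB.
have gE : (\int[mu]_x (g x)%:E = 2 * \int[mu]_x (phi x)%:E)%E.
  rewrite ge0_symfun_integralT//; last by move=> x /=; rewrite ge.
  congr (_ * _)%E; rewrite integral_mkcond; apply: eq_integral => x _.
  rewrite patchE /phi; case: ifPn; rewrite ?notin_setE ?inE /= => h; first by rewrite h.
  by rewrite ifN//; apply/negP.
have fE := integrable_fin_num measurableT I1.
have gI : mu.-integrable setT (EFin \o g).
  apply/integrableP; split; first by apply/measurable_EFinP; exact: continuous_measurable_fun.
  under eq_integral => x _ do rewrite /= ger0_norm//.
  by rewrite gE -[X in (_ * X)%E](fineK fE) -EFinM ltry.
split => //; rewrite {1}/Rintegral gE -[X in (_ * X)%E](fineK fE) -EFinM /=.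
by apply: ler_wpM2l.
Unshelve. all: by end_near. Qed.

End EvenFatou.

(** * Regularity of even extensions *)

Section EvenExtension.
Context {R : realType}.
Variables (al S D : R) (U P F : R -> R).
Hypotheses (al0 : 0 < al) (S0 : 0 <= S) (D0 : 0 <= D) (P0 : P 0 = 0).
Hypothesis T1 : forall x y : R, 0 <= x -> x <= y -> `|U y - U x - (y - x) * P x| <= D * (y - x) ^+ 2.
Hypothesis T2 : forall x y : R, 0 <= x -> x <= y -> `|P y - P x| <= D * (y - x).
Hypothesis T3 : forall x y : R, 0 <= x -> x <= y ->
  (y - x) * (al * U y - S * F x) <= P y - P x <= (y - x) * (al * U x - S * F y).

Definition even_ext (x : R) := U `|x|.
Definition odd_ext (x : R) := if 0 <= x then P x else - P (- x).

Let T1' x y : 0 <= x -> 0 <= y -> `|U y - U x - (y - x) * P x| <= 2 * D * (y - x) ^+ 2.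
Proof.
move=> x0 y0; have [xy|/ltW yx] := leP x y.
  have := T1 x0 xy; have : 0 <= D * (y - x) ^+ 2 by rewrite mulr_ge0// sqr_ge0.
  lra.
have -> : U y - U x - (y - x) * P x = - (U x - U y - (x - y) * P y) + (x - y) * (P x - P y) by ring.
apply: le_trans (ler_normD _ _) _; rewrite normrN normrM (ger0_norm (_ : 0 <= x - y)) ?subr_ge0//.
have h1 := T1 y0 yx; have := ler_wpM2l (_ : 0 <= x - y) (T2 y0 yx); rewrite subr_ge0 => /(_ yx) h2.
have -> : (y - x) ^+ 2 = (x - y) ^+ 2 by ring.
by move: h1 h2; rewrite !expr2; lra.
Qed.

Let PD x : 0 <= x -> `|P x| <= D * x.
Proof. by move=> x0; have := T2 (lexx 0) x0; rewrite P0 !subr0. Qed.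

(** The only delicate increments cross the origin. There P(0) = 0 and the Lipschitz bound give
    |P(x)| <= D |x|, so the mismatch between the two sides is again quadratic. *)
Lemma is_derive_even_ext (x : R) : is_derive x 1 even_ext (odd_ext x).
Proof.
apply: (@is_derive_sq _ _ _ _ (4 * D)) => y; rewrite real_normK ?num_real// /even_ext /odd_ext.
have [x0|x0] := leP 0 x.
  have [y0|y0] := leP 0 y.
    rewrite (ger0_norm x0) (ger0_norm y0); apply: le_trans (T1' x0 y0) _.
    by rewrite ler_wpM2r ?sqr_ge0//; move: D0; lra.
  have Y0 : 0 <= - y by rewrite oppr_ge0 ltW.
  rewrite (ger0_norm x0) (ltr0_norm y0).
  have -> : U (- y) - U x - (y - x) * P x = (U (- y) - U x - (- y - x) * P x) + (- y) * 2 * P x by ring.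
  apply: le_trans (ler_normD _ _) _; rewrite [`|_ * P x|]normrM ger0_norm; last by rewrite mulr_ge0.
  have h1 := T1' x0 Y0; have h2 := ler_wpM2l (_ : 0 <= - y * 2) (PD x0).
  have {}h2 := h2 (mulr_ge0 Y0 (ler0n _ 2)).
  have h3 : 0 <= D * (- y * x) by rewrite !mulr_ge0.
  have h4 : 0 <= D * (- y) ^+ 2 by rewrite mulr_ge0// sqr_ge0.
  have h5 : 0 <= D * x ^+ 2 by rewrite mulr_ge0// sqr_ge0.
  by move: h1 h2 h3 h4 h5; rewrite !sqrrB !sqrrN; lra.
have X0 : 0 <= - x by rewrite oppr_ge0 ltW.
have [y0|y0] := leP 0 y.
  rewrite (ltr0_norm x0) (ger0_norm y0).
  have -> : U y - U (- x) - (y - x) * - P (- x) =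
     (U y - U (- x) - (y - - x) * P (- x)) + y * 2 * P (- x) by ring.
  apply: le_trans (ler_normD _ _) _; rewrite [`|_ * P _|]normrM ger0_norm; last by rewrite mulr_ge0.
  have h1 := T1' X0 y0; have h2 := ler_wpM2l (_ : 0 <= y * 2) (PD X0).
  have {}h2 := h2 (mulr_ge0 y0 (ler0n _ 2)).
  have h3 : 0 <= D * (y * - x) by rewrite !mulr_ge0.
  have h4 : 0 <= D * (- x) ^+ 2 by rewrite mulr_ge0// sqr_ge0.
  have h5 : 0 <= D * y ^+ 2 by rewrite mulr_ge0// sqr_ge0.
  by move: h1 h2 h3 h4 h5; rewrite !sqrrB !sqrrN; lra.
have Y0 : 0 <= - y by rewrite oppr_ge0 ltW.
rewrite (ltr0_norm x0) (ltr0_norm y0).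
have -> : (y - x) * - P (- x) = (- y - - x) * P (- x) by ring.
apply: le_trans (T1' X0 Y0) _; have -> : (- y - - x) ^+ 2 = (y - x) ^+ 2 by ring.
by rewrite ler_wpM2r ?sqr_ge0//; move: D0; lra.
Qed.

Lemma continuous_even_ext : continuous even_ext.
Proof.
move=> x; apply: differentiable_continuous; apply/derivable1_diffP.
by have [] := is_derive_even_ext x.
Qed.

Let T3' x y : 0 <= x -> 0 <= y -> `|P y - P x - (y - x) * (al * U x - S * F x)| <=
  (al * `|U y - U x| + S * `|F y - F x|) * `|y - x|.
Proof.
move=> x0 y0.
have [h1 h2] := (ler_norm (U y - U x), ler_norm (- (U y - U x))).
have [h3 h4] := (ler_norm (F y - F x), ler_norm (- (F y - F x))).
rewrite !normrN in h2 h4.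
have {}h1 := ler_wpM2l (ltW al0) h1; have {}h2 := ler_wpM2l (ltW al0) h2.
have {}h3 := ler_wpM2l S0 h3; have {}h4 := ler_wpM2l S0 h4.
have n1 := mulr_ge0 (ltW al0) (normr_ge0 (U y - U x)).
have n2 := mulr_ge0 S0 (normr_ge0 (F y - F x)).
move: h1 h2 h3 h4 n1 n2; set A := al * `|_|; set B := S * `|_| => h1 h2 h3 h4 n1 n2.
have [xy|/ltW yx] := leP x y.
  have /andP[l1 l2] := T3 x0 xy; have d0 : 0 <= y - x by rewrite subr_ge0.
  rewrite (ger0_norm d0) [leRHS]mulrC ler_norml; apply/andP; split.
    have := ler_wpM2l d0 (_ : - (A + B) <= al * U y - S * F x - (al * U x - S * F x)).
    by move=> /(_ _)/[!mulrBr] H; have := H ltac:(lra); lra.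
  have := ler_wpM2l d0 (_ : al * U x - S * F y - (al * U x - S * F x) <= A + B).
  by move=> /(_ _)/[!mulrBr] H; have := H ltac:(lra); lra.
have /andP[l1 l2] := T3 y0 yx; have d0 : 0 <= x - y by rewrite subr_ge0.
rewrite distrC (distrC y) (ger0_norm d0) [leRHS]mulrC ler_norml; apply/andP; split.
  have := ler_wpM2l d0 (_ : - (A + B) <= (al * U x - S * F y) - (al * U x - S * F x)).
  by move=> /(_ _)/[!mulrBr] H; have := H ltac:(lra); lra.
have := ler_wpM2l d0 (_ : (al * U y - S * F x) - (al * U x - S * F x) <= A + B).
by move=> /(_ _)/[!mulrBr] H; have := H ltac:(lra); lra.
Qed.

Hypothesis cF : continuous (fun x : R => F `|x|).

Lemma is_derive_odd_ext (x : R) : is_derive x 1 odd_ext (al * even_ext x - S * F `|x|).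
Proof.
apply: is_derive_eps => e e0.
have ce : (fun y => al * `|even_ext y - even_ext x| + S * `|F `|y| - F `|x| |) @ x --> (0 : R).
  have -> : (0 : R) = al * `|even_ext x - even_ext x| + S * `|F `|x| - F `|x| |.
    by rewrite !subrr normr0 !mulr0 addr0.
  apply: cvgD; (apply: cvgM; first exact: cvg_cst); apply: cvg_norm; apply: cvgB; try exact: cvg_cst.
    exact: continuous_even_ext.
  exact: cF.
have /cvgrPdist_le /(_ e e0) [d /= d0 Hd] := ce.
have {}Hd y : `|y - x| < d -> al * `|even_ext y - even_ext x| + S * `|F `|y| - F `|x| | <= e.
  by rewrite distrC => /(Hd y) /=; rewrite sub0r normrN; apply: le_trans; exact: ler_norm.
(* Only pairs on the same side of 0 need an estimate: near x <> 0 the sign is constant, and x = 0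
   belongs to both sides. *)
have key y : `|y - x| < d -> (0 <= x /\ 0 <= y) \/ (x <= 0 /\ y <= 0) ->
    `|odd_ext y - odd_ext x - (y - x) * (al * even_ext x - S * F `|x|)| <= e * `|y - x|.
  move=> yd; case=> [[x0 y0]|[x0 y0]].
    rewrite /odd_ext x0 y0; apply: (@le_trans _ _ _ _ _ _ (ler_wpM2r (normr_ge0 _) (Hd y yd))).
    by rewrite /even_ext (ger0_norm x0) (ger0_norm y0); exact: T3'.
  have oE z : z <= 0 -> odd_ext z = - P (- z).
    rewrite /odd_ext le_eqVlt => /predU1P[->|z0]; first by rewrite lexx oppr0 P0 oppr0.
    by rewrite leNgt z0.
  rewrite !oE//; apply: (@le_trans _ _ _ _ _ _ (ler_wpM2r (normr_ge0 _) (Hd y yd))).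
  rewrite /even_ext (ler0_norm x0) (ler0_norm y0).
  have := @T3' (- x) (- y); rewrite !oppr_ge0 => /(_ x0 y0).
  have -> : - y - - x = - (y - x) by ring.
  rewrite normrN; apply: le_trans; rewrite -normrN le_eqVlt; apply/orP; left; apply/eqP.
  by congr `|_|; ring.
have [x0|x0|x0] := ltrgtP x 0.
- exists (Num.min d (- x)); first by rewrite lt_min d0 oppr_gt0.
  move=> y; rewrite lt_min => /andP[yd yx]; apply: key => //; right; split; first exact: ltW.
  by move: yx; rewrite ltr_norml; lra.
- exists (Num.min d x); first by rewrite lt_min d0.
  move=> y; rewrite lt_min => /andP[yd yx]; apply: key => //; left; split; first exact: ltW.
  by move: yx; rewrite ltr_norml; lra.
exists d => // y yd; apply: key => //; rewrite x0 lexx.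
by case: (leP 0 y) => h; [left|right; split => //; exact: ltW].
Qed.

End EvenExtension.

Lemma continuous_sq {R : realType} (f : R -> R) : continuous f -> continuous (fun x => f x ^+ 2).
Proof. by move=> cf x; under eq_fun do rewrite expr2; apply: cvgM; exact: cf. Qed.

(** * The limit of one component of the profiles *)

Section Component.
Context {R : realType}.
Local Notation mu := (@lebesgue_measure R).
Variables (q b al be B C : R).
Hypotheses (q2 : 2 <= q) (b0 : 0 < b) (al0 : 0 < al) (be0 : 0 < be) (B0 : 0 <= B) (C0 : 0 <= C).
Local Notation G := (coupling q b).
Local Notation f := (force q b).
Variables (s : nat -> nat) (S_ : nat -> R) (a_ c_ : nat -> nat -> R).
Variables (S : R) (U V P : R -> R).
Hypotheses (sj : forall j, (j <= s j)%N)
  (prof : forall j, is_profile q b al be (s j) (S_ j) (a_ j) (c_ j))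
  (SC : forall j, S_ j <= C) (aB : forall j, a_ j 0%N <= B) (cB : forall j, c_ j 0%N <= B)
  (cS : S_ @ \oo --> S)
  (cU : forall x, 0 <= x -> (fun j => a_ j (cell (s j) x)) @ \oo --> U x)
  (cV : forall x, 0 <= x -> (fun j => c_ j (cell (s j) x)) @ \oo --> V x)
  (cP : forall x, 0 <= x -> (fun j => slope (s j) (a_ j) (cell (s j) x)) @ \oo --> P x).
Local Notation D := (source_bound q b al B C).

Let D0 : 0 <= D. Proof. exact: source_bound_ge0. Qed.

Lemma limit_anti (x y : R) : 0 <= x -> x <= y -> 0 <= U y <= U x.
Proof.
move=> x0 xy; have y0 := le_trans x0 xy.
have H j : 0 <= a_ j (cell (s j) y) <= a_ j (cell (s j) x).
  by apply: (profile_anti (prof j)); exact: cell_homo.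
apply/andP; split.
  by apply: (cvgr_to_ge (cU y0)); apply: nearW => j; have /andP[] := H j.
by apply: (ler_cvg_to (cU y0) (cU x0)); apply: nearW => j; have /andP[] := H j.
Qed.

Lemma limit_S_ge0 : 0 <= S.
Proof. by apply: (cvgr_to_ge cS); apply: nearW => j; apply: ltW (is_profile_S _ _ _ (prof j)). Qed.

Let dist (x y : R) j : R := (cell (s j) y)%:R * mesh (s j) - (cell (s j) x)%:R * mesh (s j).

Let cdist (x y : R) : 0 <= x -> 0 <= y -> dist x y @ \oo --> y - x.
Proof. by move=> x0 y0; apply: cvgB; exact: cell_cvg. Qed.

Let TT (x y : R) : 0 <= x -> x <= y -> \forall j \near \oo,
  [/\ `|a_ j (cell (s j) y) - a_ j (cell (s j) x) - dist x y j * slope (s j) (a_ j) (cell (s j) x)|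
        <= D * dist x y j ^+ 2,
   `|slope (s j) (a_ j) (cell (s j) y) - slope (s j) (a_ j) (cell (s j) x)| <= D * dist x y j,
    dist x y j * (al * a_ j (cell (s j) y) - S_ j * f (a_ j (cell (s j) x)) (c_ j (cell (s j) x))) <=
     slope (s j) (a_ j) (cell (s j) y) - slope (s j) (a_ j) (cell (s j) x) &
    slope (s j) (a_ j) (cell (s j) y) - slope (s j) (a_ j) (cell (s j) x) <=
    dist x y j * (al * a_ j (cell (s j) x) - S_ j * f (a_ j (cell (s j) y)) (c_ j (cell (s j) y)))].
Proof.
move=> x0 xy; have := @near_ge_nat R s y sj; apply: filterS => j yj.
exact: (profile_taylor q2 b0 al0 be0 B0 C0 (prof j) (SC j) (aB j) (cB j) x0 xy yj).
Qed.

Lemma limit_taylor (x y : R) : 0 <= x -> x <= y ->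
  `|U y - U x - (y - x) * P x| <= D * (y - x) ^+ 2.
Proof.
move=> x0 xy; have y0 := le_trans x0 xy; have cd := cdist x0 y0.
have c1 : (fun j => `|a_ j (cell (s j) y) - a_ j (cell (s j) x) -
    dist x y j * slope (s j) (a_ j) (cell (s j) x)|) @ \oo --> `|U y - U x - (y - x) * P x|.
  apply: cvg_norm; apply: cvgB; last by apply: cvgM => //; exact: cP.
  by apply: cvgB; exact: cU.
have c2 : (fun j => D * dist x y j ^+ 2) @ \oo --> D * (y - x) ^+ 2.
  by apply: cvgM; [exact: cvg_cst|rewrite expr2; apply: cvgM].
by apply: (ler_cvg_to c1 c2); apply: filterS (TT x0 xy) => j [].
Qed.

Lemma limit_slope_lip (x y : R) : 0 <= x -> x <= y -> `|P y - P x| <= D * (y - x).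
Proof.
move=> x0 xy; have y0 := le_trans x0 xy; have cd := cdist x0 y0.
have c1 : (fun j => `|slope (s j) (a_ j) (cell (s j) y) - slope (s j) (a_ j) (cell (s j) x)|)
    @ \oo --> `|P y - P x| by apply: cvg_norm; apply: cvgB; exact: cP.
have c2 : (fun j => D * dist x y j) @ \oo --> D * (y - x) by apply: cvgM => //; exact: cvg_cst.
by apply: (ler_cvg_to c1 c2); apply: filterS (TT x0 xy) => j [].
Qed.

(** Dividing by y - x and letting y tend to x squeezes the quotient to al U - S f(U, V), once U and
    V are known to be continuous. *)
Lemma limit_slope (x y : R) : 0 <= x -> x <= y ->
  (y - x) * (al * U y - S * f (U x) (V x)) <= P y - P x <=
  (y - x) * (al * U x - S * f (U y) (V y)).
Proof.
move=> x0 xy; have y0 := le_trans x0 xy; have cd := cdist x0 y0.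
have c1 (z t : R) : 0 <= z -> 0 <= t ->
   (fun j => dist x y j * (al * a_ j (cell (s j) z) -
      S_ j * f (a_ j (cell (s j) t)) (c_ j (cell (s j) t)))) @ \oo -->
   (y - x) * (al * U z - S * f (U t) (V t)).
  move=> z0 t0; apply: cvgM => //; apply: cvgB; apply: cvgM => //; try exact: cvg_cst.
    exact: cU.
  by apply: force_cvg => //; [exact: cU|exact: cV].
have c2 : (fun j => slope (s j) (a_ j) (cell (s j) y) - slope (s j) (a_ j) (cell (s j) x)) @ \oo
   --> P y - P x by apply: cvgB; exact: cP.
apply/andP; split.
  by apply: (ler_cvg_to (c1 y x y0 x0) c2); apply: filterS (TT x0 xy) => j [].
by apply: (ler_cvg_to c2 (c1 x y x0 y0)); apply: filterS (TT x0 xy) => j [].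
Qed.

Lemma limit_slope0 : P 0 = 0.
Proof.
apply: (@cvg_unique _ (@Rhausdorff R) _ _ _ _ (cP (lexx 0))).
apply/norm_cvg0P; apply: (@squeeze_cvgr _ _ _ _ (cst 0) (fun j => mesh (s j) * D)).
- apply: nearW => j; rewrite normr_ge0 cell0 /=.
  exact: (profile_slope0 q2 b0 al0 be0 B0 (prof j) (SC j) (aB j) (cB j)).
- exact: cvg_cst.
- by rewrite -[X in _ --> X](mul0r D); apply: cvgM; [exact: mesh_cvg|exact: cvg_cst].
Qed.

Hypothesis cF : continuous (fun x : R => f (U `|x|) (V `|x|)).
Local Notation u := (even_ext U).
Local Notation p := (odd_ext P).

Lemma limit_continuous : continuous u.
Proof. exact: (continuous_even_ext D0 limit_slope0 limit_taylor limit_slope_lip). Qed.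

Lemma limit_is_derive (x : R) : is_derive x 1 u (p x).
Proof. exact: (is_derive_even_ext D0 limit_slope0 limit_taylor limit_slope_lip). Qed.

Lemma limit_is_derive2 (x : R) : is_derive x 1 p (al * u x - S * f (U `|x|) (V `|x|)).
Proof.
exact: (is_derive_odd_ext al0 limit_S_ge0 D0 limit_slope0 limit_taylor limit_slope_lip limit_slope).
Qed.

Let cp : continuous p.
Proof.
move=> x; apply: differentiable_continuous; apply/derivable1_diffP.
by have [] := limit_is_derive2 x.
Qed.

Lemma limit_L2 : L2 u.
Proof.
split; first by apply: continuous_measurable_fun; exact: limit_continuous.
have [|||||||//] := @even_fatou _ s (fun j k => a_ j k ^+ 2) (fun x => u x ^+ 2)
   (fun j => S_ j / al) (S / al) sj.
- by move=> j k; exact: sqr_ge0.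
- exact: continuous_sq limit_continuous.
- by move=> x; exact: sqr_ge0.
- by move=> x; rewrite /even_ext normrN.
- move=> x x0; rewrite /even_ext ger0_norm// expr2.
  by apply: cvgM; exact: cU.
- move=> j; have [_ _ _ _ [H _]] := prof j; rewrite ler_pdivlMr// -mulrA [_ * al]mulrC mulr_sumr.
  apply: le_trans H; rewrite lerDl mulr_ge0// ?invr_ge0 ?(ltW (mesh_gt0 _))// sumr_ge0// => k _.
  exact: sqr_ge0.
- by apply: cvgM => //; exact: cvg_cst.
Qed.

Lemma limit_slope_L2 : L2 p.
Proof.
split; first by apply: continuous_measurable_fun.
have h0 j := @mesh_gt0 R (s j).
have [|||||||//] := @even_fatou _ s (fun j k => slope (s j) (a_ j) k ^+ 2) (fun x => p x ^+ 2) S_ S sj.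
- by move=> j k; exact: sqr_ge0.
- exact: continuous_sq cp.
- by move=> x; exact: sqr_ge0.
- move=> x; rewrite /odd_ext oppr_ge0 opprK; case: ltgtP => [x0|x0|->]; rewrite ?sqrrN//.
  by rewrite oppr0.
- by move=> x x0; rewrite /odd_ext x0 expr2; apply: cvgM; exact: cP.
- move=> j; have [_ _ _ _ [H _]] := prof j; apply: le_trans H.
  rewrite ler_wpDl//.
    by rewrite mulr_ge0 ?(ltW (h0 j))// sumr_ge0// => k _; rewrite mulr_ge0 ?sqr_ge0// ltW.
  rewrite !mulr_sumr; apply: ler_sum => k _; rewrite /slope le_eqVlt; apply/orP; left.
  by apply/eqP; field; rewrite gt_eqF.
- exact: cS.
Qed.

End Component.

(** * The limit pair on the line *)

Section Minimizer.
Context {R : realType}.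
Local Notation mu := (@lebesgue_measure R).
Variables (q b al be : R).
Hypotheses (q2 : 2 <= q) (b0 : 0 < b) (al0 : 0 < al) (be0 : 0 < be).
Local Notation G := (coupling q b).
Local Notation f := (force q b).

(** The level is treated as a fifth function, constant in x, so that a single extraction makes the
    two profiles, their slopes and the levels converge together. *)
Let source (n : nat) (S_ : nat -> R) (a_ c_ : nat -> nat -> R) (i : option (bool * bool)) (x : R) : R :=
  match i with
  | None => S_ n
  | Some (true, true) => a_ n (cell n x)
  | Some (true, false) => slope n (a_ n) (cell n x)
  | Some (false, true) => c_ n (cell n x)
  | Some (false, false) => slope n (c_ n) (cell n x)
  end.

Lemma profile_subsequence : exists (s : nat -> nat) (S_ : nat -> R) (a_ c_ : nat -> nat -> R)
    (S B C : R) (U V P Q : R -> R),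
  [/\ (forall j, (j <= s j)%N) /\ (0 <= B /\ 0 <= C),
   forall j, is_profile q b al be (s j) (S_ j) (a_ j) (c_ j) /\
    (forall u v : 'I_((half (s j)).*2).+1 -> R, (forall x, 0 <= u x) -> (forall x, 0 <= v x) ->
     S_ j * Fh q b (mesh (s j)) u v `^ q^-1 <= quad (mesh (s j)) al u + quad (mesh (s j)) be v),
   forall j, [/\ S_ j <= C, a_ j 0%N <= B & c_ j 0%N <= B],
   S_ @ \oo --> S &
   forall x, 0 <= x -> [/\ (fun j => a_ j (cell (s j) x)) @ \oo --> U x,
     (fun j => c_ j (cell (s j) x)) @ \oo --> V x,
     (fun j => slope (s j) (a_ j) (cell (s j) x)) @ \oo --> P x &
     (fun j => slope (s j) (c_ j) (cell (s j) x)) @ \oo --> Q x]].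
Proof.
have ex n : exists X : R * ((nat -> R) * (nat -> R)), is_profile q b al be n X.1 X.2.1 X.2.2 /\
  forall u v : 'I_((half n).*2).+1 -> R, (forall x, 0 <= u x) -> (forall x, 0 <= v x) ->
     X.1 * Fh q b (mesh n) u v `^ q^-1 <= quad (mesh n) al u + quad (mesh n) be v.
  by have [S [a [c H]]] := exists_profile q2 b0 al0 be0 n; exists (S, (a, c)).
have [X HX] := choice ex.
pose S_ n := (X n).1; pose a_ n := (X n).2.1; pose c_ n := (X n).2.2.
have HP n : is_profile q b al be n (S_ n) (a_ n) (c_ n) by have [] := HX n.
have HS n : forall u v : 'I_((half n).*2).+1 -> R, (forall x, 0 <= u x) -> (forall x, 0 <= v x) ->
     S_ n * Fh q b (mesh n) u v `^ q^-1 <= quad (mesh n) al u + quad (mesh n) be v.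
  by have [] := HX n.
have [C C0 nC] := level_bounded q2 b0 al0 be0 HS.
(* Obtained from [profile_sup], where w(0)^2 <= S + 2 S / a, together with 2 w <= 1 + w^2; the terms
   for al and be are added to serve both components. *)
pose B := 1 + C + 2 * (C / al) + 2 * (C / be).
have Ca : 0 <= C / al by rewrite divr_ge0// ltW.
have Cb : 0 <= C / be by rewrite divr_ge0// ltW.
have B0 : 0 <= B by rewrite /B; lra.
have sup n (al' : R) (w : nat -> R) : 0 < al' -> S_ n <= C -> (forall k, 0 <= w k) ->
    (forall k, w k.+1 <= w k) ->
    mesh n * \sum_(k < half n) al' * w k ^+ 2 + (mesh n)^-1 * \sum_(k < half n) (w k.+1 - w k) ^+ 2
      <= S_ n -> w 0%N <= 1 + C + 2 * (C / al').
  move=> al'0 SC w0 wd H; have Kh : 1 <= (half n)%:R * mesh n :> R by rewrite half_mesh ler1n.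
  have := profile_sup (mesh_gt0 n) al'0 Kh w0 wd H.
  have : S_ n / al' <= C / al' by rewrite ler_pM2r ?invr_gt0.
  by have := sqr_ge0 (w 0%N - 1); rewrite sqrrB; have := w0 0%N; move: SC; lra.
have nPr : \forall n \near \oo, [/\ S_ n <= C, a_ n 0%N <= B & c_ n 0%N <= B].
  apply: filterS nC => n SC; have [H1 _ _ _ [H5 H6]] := HP n; split => //.
    have := @sup n al (a_ n) al0 SC _ _ H5; rewrite /B => H.
    have : a_ n 0%N <= 1 + C + 2 * (C / al) by apply: H => k; have [] := H1 k.
    by move: Cb; lra.
  have := @sup n be (c_ n) be0 SC _ _ H6; rewrite /B => H.
  have : c_ n 0%N <= 1 + C + 2 * (C / be) by apply: H => k; have [] := H1 k.
  by move: Ca; lra.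
pose Da := source_bound q b al B C; pose Db := source_bound q b be B C.
have Da0 : 0 <= Da by apply: source_bound_ge0 => //; exact: ltW.
have Db0 : 0 <= Db by apply: source_bound_ge0 => //; exact: ltW.
have [|||s [w [sj Prs cw]]] := @equicontinuous_subsequence R _ (fun i n x => source n S_ a_ c_ i x)
    (fun A => (Da + Db) * (A + 1)) _ _ _ _ nPr.
- by move=> A A0; rewrite mulr_ge0// addr_ge0.
- move=> A A0; apply: filterS2 nPr (@near_ge_nat R id A _) => // n [SC aB cB] An i x y hx hy.
  have X0 : 0 <= `|x - y| + 2 * mesh n.
    by rewrite addr_ge0// mulr_ge0// ltW// mesh_gt0.
  have Y0 : 0 <= (A + 1) * (`|x - y| + 2 * mesh n) by rewrite mulr_ge0// addr_ge0.
  have Z1 := mulr_ge0 Da0 Y0; have Z2 := mulr_ge0 Db0 Y0.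
  have [h1 h2] := profile_quasi_lip q2 b0 al0 be0 B0 (ltW C0) (HP n) SC aB cB hx hy An.
  have [h3 h4] := profile_quasi_lip q2 b0 be0 al0 B0 (ltW C0) (is_profileC (HP n)) SC cB aB hx hy An.
  rewrite -/Da -mulrA in h1 h2; rewrite -/Db -mulrA in h3 h4; rewrite -mulrA mulrDl.
  by case: i => [[[] []]|] /=; rewrite ?subrr ?normr0; lra.
- move=> x x0; exists (C + B + Da * (x + 1) + Db * (x + 1)).
  apply: filterS2 nPr (@near_ge_nat R id x _) => // n [SC aB cB] An i.
  have Z1 : 0 <= Da * (x + 1) by rewrite mulr_ge0// addr_ge0.
  have Z2 : 0 <= Db * (x + 1) by rewrite mulr_ge0// addr_ge0.
  have hx : 0 <= x <= x by rewrite x0 lexx.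
  have h1 := profile_slope_le q2 b0 al0 be0 B0 (ltW C0) (HP n) SC aB cB hx An.
  have h2 := profile_slope_le q2 b0 be0 al0 B0 (ltW C0) (is_profileC (HP n)) SC cB aB hx An.
  have /andP[h3 h4] := profile_anti (HP n) (leq0n (cell n x)).
  have /andP[h5 h6] := profile_anti (is_profileC (HP n)) (leq0n (cell n x)).
  have h7 := is_profile_S b0 al0 be0 (HP n).
  have C0' := ltW C0.
  case: i => [[[] []]|] /=; rewrite -?/Da -?/Db in h1 h2 *; rewrite ?(ger0_norm h3) ?(ger0_norm h5) ?(gtr0_norm h7); lra.
exists s, (S_ \o s), (a_ \o s), (c_ \o s), (w None 0), B, C, (w (Some (true, true))),
  (w (Some (false, true))), (w (Some (true, false))), (w (Some (false, false))).
split; [by split => //; split => //; exact: ltW|by move=> j; split; [exact: HP|exact: HS]|exact: Prs| |].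
  exact: (cw None 0 (lexx 0)).
move=> x x0; split; [exact: (cw (Some (true, true)))|exact: (cw (Some (false, true)))|
  exact: (cw (Some (true, false)))|exact: (cw (Some (false, false)))].
Qed.

(** Mass could be lost in the limit, so only int G <= 1 is asserted here; the sharp inequality for
    all pairs is carried along to recover equality later. *)
Theorem minimizer_exists : exists (u p v r : R -> R) (S : R), [/\
  0 < S,
  nonneg_radially_decreasing u /\ nonneg_radially_decreasing v,
  [/\ L2 u, L2 p, L2 v & L2 r],
  forall x : R, [/\ is_derive x 1 u (p x), is_derive x 1 p (al * u x - S * f (u x) (v x)),
    is_derive x 1 v (r x) & is_derive x 1 r (be * v x - S * f (v x) (u x))] &
  [/\ 0 < u 0 + v 0,
    mu.-integrable setT (EFin \o (fun x => G (u x) (v x))) /\ \int[mu]_x G (u x) (v x) <= 1 &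
    forall z1 g1 z2 g2, AC z1 g1 -> AC z2 g2 ->
      mu.-integrable setT (EFin \o (fun x => G (z1 x) (z2 x))) /\
      S * (\int[mu]_x G (z1 x) (z2 x)) `^ q^-1 <= sq_norm al z1 g1 + sq_norm be z2 g2]].
Proof.
have [s [S_ [a_ [c_ [S [B [C [U [V [P [Q [[sj [B0 C0]] H1 H2 cS cw]]]]]]]]]]]] := profile_subsequence.
have prof j := (H1 j).1; have prof' j := is_profileC (prof j).
have SC j : S_ j <= C by have [] := H2 j.
have aB j : a_ j 0%N <= B by have [] := H2 j.
have cB j : c_ j 0%N <= B by have [] := H2 j.
have cU (x : R) : 0 <= x -> (fun j => a_ j (cell (s j) x)) @ \oo --> U x by move=> /cw[].
have cV (x : R) : 0 <= x -> (fun j => c_ j (cell (s j) x)) @ \oo --> V x by move=> /cw[].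
have cP (x : R) : 0 <= x -> (fun j => slope (s j) (a_ j) (cell (s j) x)) @ \oo --> P x by move=> /cw[].
have cQ (x : R) : 0 <= x -> (fun j => slope (s j) (c_ j) (cell (s j) x)) @ \oo --> Q x by move=> /cw[].
have cu : continuous (even_ext U).
  exact: (limit_continuous q2 b0 al0 be0 B0 C0 sj prof SC aB cB cU cP).
have cv : continuous (even_ext V).
  exact: (limit_continuous q2 b0 be0 al0 B0 C0 sj prof' SC cB aB cV cQ).
have cFu : continuous (fun x : R => f (U `|x|) (V `|x|)).
  by move=> x; apply: force_cvg => //; [exact: cu|exact: cv].
have cFv : continuous (fun x : R => f (V `|x|) (U `|x|)).
  by move=> x; apply: force_cvg => //; [exact: cv|exact: cu].
have antiU (x y : R) : 0 <= x -> x <= y -> 0 <= U y <= U x by exact: (limit_anti prof cU).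
have antiV (x y : R) : 0 <= x -> x <= y -> 0 <= V y <= V x by exact: (limit_anti prof' cV).
have nrd (W : R -> R) : (forall x y : R, 0 <= x -> x <= y -> 0 <= W y <= W x) ->
    nonneg_radially_decreasing (even_ext W).
  move=> aW; split => [x|x|x y xy]; rewrite /even_ext ?normrN//.
    by have /andP[] := aW `|x| `|x| (normr_ge0 x) (lexx _).
  by have /andP[] := aW `|x| `|y| (normr_ge0 x) xy.
have nu := nrd U antiU; have nv := nrd V antiV.
exists (even_ext U), (odd_ext P), (even_ext V), (odd_ext Q), S.
have S0 : 0 <= S by exact: (limit_S_ge0 b0 al0 be0 prof cS).
have [q22 b1] : 0 < 2 * q - 2 /\ 0 < 1 + b by move: q2 b0; lra.
(* The amplitude bound passes to the limit; a zero level or a pair vanishing at the origin would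
   make its right-hand side 0. *)
have lim1 : 1 <= (1 + b) * `|U 0 + V 0| `^ (2 * q - 2) * (S / al + S / be).
  have c : (fun j => (1 + b) * `|a_ j (cell (s j) (0 : R)) + c_ j (cell (s j) (0 : R))| `^ (2 * q - 2) *
     (S_ j / al + S_ j / be)) @ \oo --> (1 + b) * `|U 0 + V 0| `^ (2 * q - 2) * (S / al + S / be).
    have c1 : (fun j => S_ j / al + S_ j / be) @ \oo --> S / al + S / be.
      by apply: cvgD; (apply: cvgM => //; exact: cvg_cst).
    have c2 : (fun j => a_ j (cell (s j) (0 : R)) + c_ j (cell (s j) (0 : R))) @ \oo --> U 0 + V 0.
      exact: (cvgD (cU 0 (lexx 0)) (cV 0 (lexx 0))).
    have c3 : (fun j => `|a_ j (cell (s j) (0 : R)) + c_ j (cell (s j) (0 : R))| `^ (2 * q - 2)) @ \oo -->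
        `|U 0 + V 0| `^ (2 * q - 2).
      by apply: (@cvg_comp _ _ _ _ (fun x : R => `|x| `^ (2 * q - 2)) _ _ _ c2); exact: continuous_norm_powR.
    have c4 : (fun=> 1 + b) @ \oo --> (1 + b : R) by exact: cvg_cst.
    exact: (cvgM (cvgM c4 c3) c1).
  apply: (cvgr_to_ge c); apply: nearW => j; rewrite cell0.
  have [H _ _ [_ H'] _] := prof j; have [? ? _ _] := H 0%N.
  by rewrite ger0_norm// addr_ge0.
have Spos : 0 < S.
  rewrite lt_neqAle S0 andbT eq_sym; apply/eqP => SE; move: lim1.
  by rewrite SE !mul0r addr0 mulr0 lt_geF.
have UV0 : 0 < U 0 + V 0.
  have /andP[U0 _] := antiU 0 0 (lexx 0) (lexx 0); have /andP[V0 _] := antiV 0 0 (lexx 0) (lexx 0).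
  rewrite lt_neqAle addr_ge0// andbT eq_sym; apply/eqP => E; move: lim1.
  by rewrite E normr0 powR0 ?gt_eqF// mulr0 mul0r lt_geF.
split => //.
- split.
  + exact: (limit_L2 q2 b0 al0 be0 B0 C0 sj prof SC aB cB cS cU cP).
  + exact: (limit_slope_L2 q2 b0 al0 be0 B0 C0 sj prof SC aB cB cS cU cV cP cFu).
  + exact: (limit_L2 q2 b0 be0 al0 B0 C0 sj prof' SC cB aB cS cV cQ).
  + exact: (limit_slope_L2 q2 b0 be0 al0 B0 C0 sj prof' SC cB aB cS cV cU cQ cFv).
- move=> x; split.
  + exact: (limit_is_derive q2 b0 al0 be0 B0 C0 sj prof SC aB cB cU cP).
  + exact: (limit_is_derive2 q2 b0 al0 be0 B0 C0 sj prof SC aB cB cS cU cV cP cFu).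
  + exact: (limit_is_derive q2 b0 be0 al0 B0 C0 sj prof' SC cB aB cV cQ).
  + exact: (limit_is_derive2 q2 b0 be0 al0 B0 C0 sj prof' SC cB aB cS cV cU cQ cFv).
- split; first by rewrite /even_ext normr0.
    have [|||||||I1 I2] := @even_fatou _ s (fun j k => G (a_ j k.+1) (c_ j k.+1))
      (fun x => G (even_ext U x) (even_ext V x)) (fun=> 2^-1) 2^-1 sj.
    + by move=> j k; exact: coupling_ge0.
    + by move=> x; apply: coupling_cvg => //; [exact: cu|exact: cv].
    + by move=> x; exact: coupling_ge0.
    + by move=> x; rewrite /even_ext normrN.
    + move=> x x0; rewrite /even_ext (ger0_norm x0).
      (* The mass sums use the site after the cell of x; the difference is the mesh times a
         convergent slope. *)
      have shift (w : nat -> nat -> R) (W Z : R) : (fun j => w j (cell (s j) x)) @ \oo --> W ->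
          (fun j => slope (s j) (w j) (cell (s j) x)) @ \oo --> Z ->
          (fun j => w j (cell (s j) x).+1) @ \oo --> W.
        move=> h1 h2; have -> : W = W + 0 * Z by rewrite mul0r addr0.
        have -> : (fun j => w j (cell (s j) x).+1) =
           (fun j => w j (cell (s j) x) + mesh (s j) * slope (s j) (w j) (cell (s j) x)).
          by apply/funext => j; rewrite /slope mulrC divfK ?gt_eqF ?mesh_gt0//; ring.
        by apply: cvgD => //; apply: cvgM => //; exact: mesh_cvg.
      by apply: coupling_cvg => //; [apply: (shift _ _ _ (cU x x0) (cP x x0))|
        apply: (shift _ _ _ (cV x x0) (cQ x x0))].
    + by move=> j; have [_ _ _ [H _] _] := prof j.
    + exact: cvg_cst.
    by split => //; move: I2; rewrite mulfV.
  move=> z1 g1 z2 g2 A1 A2.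
  apply: (@comparison R q b q2 b0 al be s S_ S) => //; try exact: ltW.
    by move=> j; exact: is_profile_S (prof j).
  by move=> j; exact: (H1 j).2.
Qed.

End Minimizer.

(** * Weak form and positivity *)

Section WeakForm.
Context {R : realType}.
Local Notation mu := (@lebesgue_measure R).
Implicit Types (u p k g phi : R -> R).

Lemma is_derive_continuous u p : (forall x : R, is_derive x 1 u (p x)) -> continuous u.
Proof.
by move=> H x; apply: differentiable_continuous; apply/derivable1_diffP; have [] := H x.
Qed.

Lemma is_derive_C1 u p : (forall x : R, is_derive x 1 u (p x)) -> continuous p ->
  C1 u /\ u^`() = p.
Proof.
move=> H cp; have E : u^`() = p by apply/funext => x; rewrite derive1E; have [_ ->] := H x.
by split => //; split; [move=> x; have [] := H x|rewrite E].
Qed.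

Lemma Rintegral_sym_cvg F : mu.-integrable setT (EFin \o F) ->
  (fun n => \int[mu]_(x in `[- n%:R, n%:R]) F x) @ \oo --> \int[mu]_x F x.
Proof.
move=> IF.
have E n : \int[mu]_(x in `[- n%:R, n%:R]) F x = \int[mu]_x (F \_ `[- n%:R, n%:R]) x.
  by rewrite Rintegral_mkcond.
under eq_fun do rewrite E.
have mF : measurable_fun setT F by case/integrableP: IF => /measurable_EFinP.
apply: (proj2 (@Rdominated_convergence _ setT (fun n => F \_ `[- n%:R, n%:R]) F (fun x => `|F x|) _ _ _ _ _)) => //.
- by move=> n; apply/(measurable_restrictT F) => //; exact: measurable_funTS.
- move=> x _; apply: cvg_near_cst; near=> n; rewrite patchE ifT//.
  rewrite inE/= in_itv/= -ler_norml; near: n; exact: nbhs_infty_ger.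
- by have := integrable_norm IF.
- by move=> n x _; rewrite patchE; case: ifP => // _; rewrite normr0.
Unshelve. all: by end_near. Qed.

(** On [-n, n] the integral reduces to boundary terms, which vanish in the limit because phi tends
    to 0 at infinity and p is bounded. *)
Lemma AC_parts phi g p k : AC phi g -> AC p k -> C1 p -> p^`() = k ->
  \int[mu]_x (phi x * k x + g x * p x) = 0.
Proof.
move=> A1 A2 C1p Ek; have [L1 L2' P1'] := A1; have [L3 L4 P2'] := A2.
have I1 := L2_integrableM L1 L4; have I2 := L2_integrableM L2' L3.
have I : mu.-integrable setT (EFin \o (fun x => phi x * k x + g x * p x)) by exact: intgD.
have E n : \int[mu]_(x in `[- n%:R, n%:R]) (phi x * k x + g x * p x) =
    phi n%:R * p n%:R - phi (- n%:R) * p (- n%:R).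
  have n0 : - n%:R <= n%:R :> R by have := ler0n R n; lra.
  have := integration_by_parts_primitive L2' P1' C1p n0; rewrite Ek => H.
  rewrite RintegralD//; [rewrite H; ring|exact: intgS I1|exact: intgS I2].
suff c : (fun n => phi n%:R * p n%:R - phi (- n%:R) * p (- n%:R)) @ \oo --> (0 : R).
  by have := Rintegral_sym_cvg I; rewrite (funext E) => /(cvg_unique (@Rhausdorff R)) /(_ c).
have [B HB] := AC_bounded A2.
have B0 : 0 <= B by apply: le_trans (HB 0).
apply/cvgrPdist_le => /= e e0.
have e0' : 0 < e / (2 * (B + 1)) by rewrite divr_gt0// mulr_gt0// ltr_wpDl.
have [M M0 HM] := AC_vanish A1 e0'.
near=> n.
have nM : M <= n%:R by near: n; exact: nbhs_infty_ger.
have h1 := HM n%:R; have h2 := HM (- n%:R); rewrite normrN ger0_norm// in h1 h2.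
have {}h1 := h1 nM; have {}h2 := h2 nM.
have step1 (x : R) : `|phi x| <= e / (2 * (B + 1)) -> `|phi x * p x| <= e / 2.
  move=> h; rewrite normrM; apply: (@le_trans _ _ (e / (2 * (B + 1)) * (B + 1))).
    by apply: ler_pM => //; have := HB x; lra.
  by rewrite le_eqVlt; apply/orP; left; apply/eqP; field; rewrite gt_eqF// ltr_wpDl.
rewrite sub0r normrN; apply: le_trans (ler_normB _ _) _.
by have := step1 _ h1; have := step1 _ h2; lra.
Unshelve. all: by end_near. Qed.

Lemma L2_derive_AC u p : (forall x : R, is_derive x 1 u (p x)) -> continuous p ->
  L2 u -> L2 p -> AC u p.
Proof.
move=> H cp Lu Lp; have [C E] := is_derive_C1 H cp.
by split => //; rewrite -E; exact: C1_primitive.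
Qed.

Lemma L2_eq u v : (forall x, u x = v x) -> L2 u -> L2 v.
Proof. by move=> uv; have -> : v = u by apply/funext => x; rewrite uv. Qed.

Lemma H1_L2 phi : H1 phi -> L2 phi /\ L2 (weak_derivative phi).
Proof.
move=> hp; have [U [_ Lw _] _] := H1P hp; split => //.
by apply/L2P; case: hp.
Qed.

(** [weak_derivative u] and [phi] are first replaced by p and the continuous representative of phi,
    which changes the integrands only on null sets; then the test is an integration by parts over
    the line. *)
Lemma classical_weak (a : R) u p F phi :
  (forall x : R, is_derive x 1 u (p x)) -> (forall x : R, is_derive x 1 p (a * u x - F x)) ->
  continuous F -> L2 u -> L2 p -> L2 F -> H1 phi ->
  \int[mu]_x (weak_derivative u x * weak_derivative phi x + a * u x * phi x) =
  \int[mu]_x (F x * phi x).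
Proof.
move=> du dp cF Lu Lp LF hphi.
have cu := is_derive_continuous du; have cp := is_derive_continuous dp.
pose k x := a * u x - F x.
have ck : continuous k by move=> x; apply: cvgB; [apply: cvgM; [exact: cvg_cst|exact: cu]|exact: cF].
have Lk : L2 k.
  apply: (@L2_eq (fun x => a * u x + -1 * F x)); first by move=> x; rewrite /k; ring.
  by apply: L2D; exact: L2Z.
have Au := L2_derive_AC du cp Lu Lp.
have [C1p Ek] := is_derive_C1 dp ck; have Ap := L2_derive_AC dp ck Lp Lk.
have [[_ _] wu] := AC_H1 Au; have [Phi AP Pphi] := H1P hphi.
have [[mphi _] [mw _]] := H1_L2 hphi.
have [[mwu _] _] : L2 (weak_derivative u) /\ True by split => //; have [] := H1_L2 (AC_H1 Au).1.
have [LP Lw _] := AP.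
have mk : measurable_fun setT (fun x => a * u x * phi x).
  by apply: measurable_funM => //; apply: measurable_funM; [exact: measurable_cst|case: Lu].
transitivity (\int[mu]_x (p x * weak_derivative phi x + a * u x * Phi x)).
  apply: ae_Rintegral.
  - by apply: measurable_funD => //; exact: measurable_funM.
  - apply: measurable_funD; apply: measurable_funM => //; try by [case: Lp|case: LP].
    by apply: measurable_funM; [exact: measurable_cst|case: Lu].
  - by apply: aeS (aeI wu Pphi) => x [h1 h2] _; rewrite (h1 I) (h2 I).
transitivity (\int[mu]_x (F x * Phi x)); last first.
  apply: ae_Rintegral.
  - by apply: measurable_funM; [case: LF|case: LP].
  - by apply: measurable_funM => //; case: LF.
  - by apply: aeS Pphi => x h _; rewrite (h I).
have IF := L2_integrableM LF LP.
have I0 : mu.-integrable setT (EFin \o (fun x => Phi x * k x + weak_derivative phi x * p x)).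
  by apply: intgD => //; exact: L2_integrableM.
have := AC_parts AP Ap C1p Ek => H0.
transitivity (\int[mu]_x ((Phi x * k x + weak_derivative phi x * p x) + F x * Phi x)).
  by apply: eq_Rintegral => x _; rewrite /k; ring.
by rewrite RintegralD// H0 add0r.
Qed.

(* [(u ^ 2 + p ^ 2) exp ((1 + C) x)] is nondecreasing, and a zero of [u >= 0] is
   also a zero of [p]. *)
Lemma ode_positive (C : R) u p k (a b : R) :
  (forall x : R, is_derive x 1 u (p x)) -> (forall x : R, is_derive x 1 p (k x)) ->
  (forall x, 0 <= u x) -> 0 <= C -> (forall x, `|k x| <= C * u x) ->
  a <= b -> 0 < u a -> 0 < u b.
Proof.
move=> du dp u0 C0 kC ab ua; rewrite lt_neqAle u0 andbT eq_sym; apply/eqP => ub.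
have pb : p b = 0.
  by apply: (local_min_derive (du b)); exists 1 => //= y _; rewrite ub.
pose E : R -> R := fun x => (u x ^+ 2 + p x ^+ 2) * expR ((1 + C) * x).
have dE (x : R) : is_derive x 1 E ((2 * u x * p x + 2 * p x * k x) * expR ((1 + C) * x) +
    (u x ^+ 2 + p x ^+ 2) * ((1 + C) * expR ((1 + C) * x))).
  have d1 : is_derive x 1 (fun x => u x ^+ 2 + p x ^+ 2) (2 * u x * p x + 2 * p x * k x).
    have h1 := du x; have h2 := dp x.
    apply: (is_derive_eq (is_deriveD (is_deriveM h1 h1) (is_deriveM h2 h2))).
    by rewrite /GRing.scale/=; ring.
  have d2 : is_derive x 1 (fun x => expR ((1 + C) * x)) ((1 + C) * expR ((1 + C) * x)).
    have d3 : is_derive x 1 (fun x : R => (1 + C) * x) (1 + C).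
      have := is_deriveM (is_derive_cst (1 + C) x 1) (is_derive_id x 1).
      by move=> h; apply: (is_derive_eq h); rewrite /GRing.scale/=; ring.
    have := @is_derive1_comp _ (@expR R) (fun y : R => (1 + C) * y) _ _ _ (is_derive_expR ((1 + C) * x)) d3.
    by move=> h; apply: (is_derive_eq h); rewrite mulrC.
  apply: (is_derive_eq (is_deriveM d1 d2)); rewrite /GRing.scale/=; ring.
have mono : E a <= E b.
  apply: (@ger0_derive1_ndecr R E a b) => //.
  - move=> x _; rewrite derive1E; have [_ ->] := dE x.
    rewrite [X in _ + X]mulrA -mulrDl; apply: mulr_ge0; last exact: expR_ge0.
    have := kC x; rewrite ler_norml => /andP[k1 k2].
    (* Since 2 u p >= -(u^2 + p^2) and 2 p k >= -2 C |p| u >= -C (u^2 + p^2), the rate 1 + C of the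
       exponential absorbs both terms. *)
    have h1 := sqr_ge0 (u x + p x).
    have h2 : `|p x * k x| <= C * (`|p x| * u x).
      by rewrite normrM mulrCA; apply: ler_wpM2l.
    have h3 : 0 <= (`|p x| - u x) ^+ 2 by exact: sqr_ge0.
    rewrite sqrrB real_normK ?num_real// in h3; rewrite sqrrD in h1.
    have h4 := ler_wpM2l C0 (_ : `|p x| * u x *+ 2 <= p x ^+ 2 + u x ^+ 2).
    have {}h4 := h4 ltac:(move: h3; lra).
    move: h2; rewrite ler_norml => /andP[h2 _].
    by move: h1 h2 h4; rewrite !mulr2n; lra.
  - by apply: continuous_subspaceT; exact: is_derive_continuous dE.
move: mono; rewrite /E ub pb expr0n/= addr0 mul0r leNgt mulr_gt0 ?expR_gt0//.
by rewrite ltr_pwDl ?sqr_ge0// exprn_gt0.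
Qed.

End WeakForm.

(** * Dilations and vanishing integrals *)

Section Scaling.
Context {R : realType}.
Local Notation mu := (@lebesgue_measure R).
Implicit Types (g : R -> R).

Lemma Rintegral_scale (w : R) g : 0 < w -> continuous g -> (forall x, 0 <= g x) ->
  mu.-integrable setT (EFin \o g) ->
  mu.-integrable setT (EFin \o (fun x => g (w * x))) /\
  \int[mu]_x g (w * x) = w^-1 * \int[mu]_x g x.
Proof.
move=> w0 cg g0 Ig.
have dw (x : R) : is_derive x 1 (fun x : R => w * x) w.
  have := is_deriveM (is_derive_cst w x 1) (is_derive_id x 1).
  by move=> h; apply: (is_derive_eq h); rewrite /GRing.scale/=; ring.
have ccst : continuous (fun _ : R => w) by move=> x; exact: cvg_cst.
have [[dF _] FE] := is_derive_C1 dw ccst.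
have cgw : continuous (fun x => g (w * x)).
  move=> x; have cw : (fun x : R => w * x) @ x --> w * x by exact: (is_derive_continuous dw).
  exact: (cvg_comp _ _ cw (cg (w * x))).
have H : (\int[mu]_x (g x)%:E = w%:E * \int[mu]_x (g (w * x))%:E)%E.
  rewrite (@increasing_ge0_integration_by_substitutionT R (fun x : R => w * x) g).
  - under eq_integral => x _ do rewrite /GRing.mul/= FE/= mulrC EFinM.
    rewrite ge0_integralZl//; last by rewrite lee_fin ltW.
      by apply/measurable_EFinP; exact: continuous_measurable_fun.
    by move=> x _; rewrite lee_fin.
  - by move=> x y xy; rewrite ltr_pM2l.
  - by rewrite FE => x; exact: cvg_cst.
  - by rewrite FE; exact: is_cvg_cst.
  - by rewrite FE; exact: is_cvg_cst.
  - exact: dF.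
  - by apply: gt0_cvgMrNy => //; exact: cvg_id.
  - by apply: gt0_cvgMry => //; exact: cvg_id.
  - exact: cg.
  - exact: g0.
have fin := integrable_fin_num measurableT Ig.
have H' : (\int[mu]_x (g (w * x))%:E = (w^-1 * \int[mu]_x g x)%:E)%E.
  rewrite EFinM /Rintegral fineK// H muleA -EFinM mulVf ?gt_eqF// mul1e//.
split; last by rewrite {1}/Rintegral H'.
apply/integrableP; split; first by apply/measurable_EFinP; exact: continuous_measurable_fun.
by under eq_integral => x _ do rewrite /= ger0_norm//; rewrite H' ltry.
Qed.

Lemma continuous_Rintegral_eq0 g : continuous g -> (forall x, 0 <= g x) ->
  mu.-integrable setT (EFin \o g) -> \int[mu]_x g x <= 0 -> forall x, g x = 0.
Proof.
move=> cg g0 Ig gle x; apply/eqP; rewrite eq_le g0 andbT leNgt; apply/negP => gx.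
have g2 : 0 < g x / 2 by rewrite divr_gt0.
have /cvgrPdist_le /(_ _ g2) [d /= d0 Hd] := cg x.
have d2 : 0 < d / 2 by rewrite divr_gt0.
have : g x / 2 * (d / 2) <= \int[mu]_x g x.
  have -> : g x / 2 * (d / 2) = \int[mu]_(s in `[x, x + d / 2]) (g x / 2).
    by rewrite Rintegral_itv_cst ?lerDl ?ltW// addrC addKr.
  apply: (@le_trans _ _ (\int[mu]_(s in `[x, x + d / 2]) g s)); last exact: Rintegral_subset.
  apply: le_Rintegral => //; [exact: intg_cst|exact: intgS Ig|].
  move=> s; rewrite /= in_itv/= => /andP[xs sx].
  have : `|g x - g s| <= g x / 2.
    by apply: Hd; rewrite /ball_/= distrC ger0_norm ?subr_ge0//; move: d0; lra.
  by rewrite ler_norml => /andP[]; lra.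
move=> /le_trans /(_ gle); rewrite leNgt mulr_gt0//.
Qed.

End Scaling.

(** * Extremal pairs of unit mass *)

Section Extremal.
Context {R : realType}.
Local Notation mu := (@lebesgue_measure R).
Variables (q b : R).
Hypotheses (q2 : 2 <= q) (b0 : 0 < b).
Local Notation G := (coupling q b).
Local Notation f := (force q b).
Implicit Types (u p v r : R -> R) (al be S : R).

Let q0 : 0 < q. Proof. by move: q2; lra. Qed.

Definition sharp al be S := forall z1 g1 z2 g2, AC z1 g1 -> AC z2 g2 ->
  mu.-integrable setT (EFin \o (fun x => G (z1 x) (z2 x))) /\
  S * (\int[mu]_x G (z1 x) (z2 x)) `^ q^-1 <= sq_norm al z1 g1 + sq_norm be z2 g2.

(** One component of the limit system, with p the derivative of u and v the other component; the
    full system is this predicate together with its swapped version. *)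
Definition half_state al S u p v :=
  [/\ nonneg_radially_decreasing u, L2 u, L2 p, forall x : R, is_derive x 1 u (p x) &
    forall x : R, is_derive x 1 p (al * u x - S * f (u x) (v x))].

Definition unit_mass u v := mu.-integrable setT (EFin \o (fun x => G (u x) (v x))) /\
  \int[mu]_x G (u x) (v x) = 1.

Lemma nrd_le u x : nonneg_radially_decreasing u -> 0 <= u x <= u 0.
Proof. by move=> [u0 _ ud]; rewrite u0; apply: ud; rewrite normr0. Qed.

Section HalfState.
Variables (al S : R) (u p v : R -> R).
Hypotheses (S0 : 0 < S) (al0 : 0 < al) (H : half_state al S u p v).
Hypotheses (nv : nonneg_radially_decreasing v) (cv : continuous v).

Let F x := S * f (u x) (v x).
Let C := (1 + b) * (u 0 + v 0) `^ (2 * q - 2).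

Let C0 : 0 <= C. Proof. by rewrite mulr_ge0 ?powR_ge0// addr_ge0// ltW. Qed.

Let fC x : f (u x) (v x) <= C * u x.
Proof.
have [nu _ _ _ _] := H; have /andP[u0 u1] := nrd_le x nu; have /andP[v0 v1] := nrd_le x nv.
by apply: force_lin; rewrite // ?u0 ?v0; move: u0 u1 v0 v1; lra.
Qed.

Lemma half_state_continuous : continuous u.
Proof. by have [_ _ _ du _] := H; exact: is_derive_continuous du. Qed.

Lemma half_state_source_continuous : continuous F.
Proof.
move=> x; apply: cvgM; first exact: cvg_cst.
by apply: force_cvg => //; [exact: half_state_continuous|exact: cv].
Qed.

Lemma half_state_source_L2 : L2 F.
Proof.
have [[u0 _ _] Lu _ _ _] := H.
apply: (L2_le _ (L2Z (S * C) Lu)).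
  by apply: continuous_measurable_fun; exact: half_state_source_continuous.
move=> x; rewrite !ger0_norm; last 2 first.
- exact: mulr_ge0 (mulr_ge0 (ltW S0) C0) (u0 x).
- by rewrite mulr_ge0 ?(ltW S0)//; exact: force_ge0.
by rewrite -mulrA; apply: ler_wpM2l; [exact: ltW|exact: fC].
Qed.

Lemma half_state_AC : AC u p.
Proof.
have [_ Lu Lp du dp] := H.
by apply: L2_derive_AC => //; exact: is_derive_continuous dp.
Qed.

Lemma half_state_positive : 0 < u 0 -> forall x, 0 < u x.
Proof.
move=> u00 x; have [nu _ _ du dp] := H; have [u0 ue _] := nu.
wlog x0 : x / 0 <= x => [W|].
  have [/W//|x0] := leP 0 x; rewrite -ue; apply: W; rewrite oppr_ge0; exact: ltW.
apply: (ode_positive (C := al + S * C) du dp u0 _ _ x0 u00).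
  exact: addr_ge0 (ltW al0) (mulr_ge0 (ltW S0) C0).
move=> y; have h1 := ler_wpM2l (ltW S0) (fC y).
have h2 : 0 <= S * f (u y) (v y) by rewrite mulr_ge0 ?force_ge0// ltW.
have h3 : 0 <= al * u y by rewrite mulr_ge0// ltW.
have h4 : 0 <= S * (C * u y) := mulr_ge0 (ltW S0) (mulr_ge0 C0 (u0 y)).
by rewrite ler_norml; lra.
Qed.

(** The equation tested with u itself. The source is square integrable by [force_lin], so every
    product involved is integrable. *)
Lemma half_state_norm :
  mu.-integrable setT (EFin \o (fun x => u x * f (u x) (v x))) /\
  sq_norm al u p = S * \int[mu]_x (u x * f (u x) (v x)).
Proof.
have [nu Lu Lp du dp] := H; have A := half_state_AC.
have cF := half_state_source_continuous; have LF := half_state_source_L2.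
have I1 := L2_integrableM Lu LF.
have I : mu.-integrable setT (EFin \o (fun x => u x * f (u x) (v x))).
  have := @intgZ R setT S^-1 _ measurableT I1; apply: eq_integrable => // x _ /=.
  by congr (_%:E); rewrite /F; field; rewrite gt_eqF.
split => //.
pose k x := al * u x - F x.
have ck : continuous k.
  move=> x; apply: cvgB; last exact: cF.
  by apply: cvgM; [exact: cvg_cst|exact: half_state_continuous].
have Lk : L2 k.
  apply: (@L2_eq _ (fun x => al * u x + -1 * F x)); first by move=> x; rewrite /k; ring.
  by apply: L2D; exact: L2Z.
have [C1p Ek] := is_derive_C1 dp ck; have Ap := L2_derive_AC dp ck Lp Lk.
have E0 := AC_parts A Ap C1p Ek.
have [[_ Iu] [_ Ip]] := (Lu, Lp).
have Iau : mu.-integrable setT (EFin \o (fun x => al * u x ^+ 2)) by exact: intgZ.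
rewrite /sq_norm.
have <- : \int[mu]_s (al * u s ^+ 2) = al * \int[mu]_s (u s ^+ 2) by rewrite RintegralZl.
rewrite -RintegralD//.
have <- : \int[mu]_x (S * (u x * f (u x) (v x))) = S * \int[mu]_x (u x * f (u x) (v x)).
  by rewrite RintegralZl.
have E1 : \int[mu]_x (u x * k x + p x * p x) =
   \int[mu]_x ((al * u x ^+ 2 + p x ^+ 2) - S * (u x * f (u x) (v x))).
  by apply: eq_Rintegral => x _; rewrite /k /F; ring.
have I2 : mu.-integrable setT (EFin \o (fun x => al * u x ^+ 2 + p x ^+ 2)) by exact: intgD.
have I3 : mu.-integrable setT (EFin \o (fun x => S * (u x * f (u x) (v x)))) by exact: intgZ.
move: E0; rewrite E1 RintegralB// => /eqP; rewrite subr_eq0 => /eqP ->.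
by [].
Qed.

End HalfState.

Lemma mass_norm al be S u p v r : 0 < S ->
  half_state al S u p v -> half_state be S v r u ->
  sq_norm al u p + sq_norm be v r = S * \int[mu]_x G (u x) (v x).
Proof.
move=> S0 Hu Hv.
have [nu _ _ du _] := Hu; have [nv _ _ dv _] := Hv.
have cu := is_derive_continuous du; have cv := is_derive_continuous dv.
have [I1 ->] := half_state_norm S0 Hu nv cv.
have [I2 ->] := half_state_norm S0 Hv nu cu.
rewrite -mulrDr -RintegralD//; congr (_ * _); apply: eq_Rintegral => x _.
by rewrite coupling_force//; [case: nu|case: nv].
Qed.

Lemma extremal_exists al be : 0 < al -> 0 < be -> exists u p v r S, [/\ 0 < S, sharp al be S,
  half_state al S u p v, half_state be S v r u & 0 < u 0 + v 0 /\ unit_mass u v].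
Proof.
move=> al0 be0; have [u [p [v [r [S [S0 [nu nv] [Lu Lp Lv Lr] D [uv [IG GI] sh]]]]]]] :=
  minimizer_exists q2 b0 al0 be0.
have Hu : half_state al S u p v by split => // x; have [] := D x.
have Hv : half_state be S v r u by split => // x; have [] := D x.
exists u, p, v, r, S; split => //; split => //; split => //.
have E := mass_norm S0 Hu Hv.
have Au := half_state_AC Hu; have Av := half_state_AC Hv.
(* Here the squared norm is S m, so sharpness reads m^(1/q) <= m. With m <= 1 this leaves m = 0,
   excluded by the values at the origin, or m = 1. *)
have [_] := sh _ _ _ _ Au Av; rewrite E ler_pM2l//.
set m := \int[mu]_x G (u x) (v x) => Hm.
have m0 : 0 <= m by apply: Rintegral_ge0 => x _; exact: coupling_ge0.
have mn0 : m != 0.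
  apply/eqP => mE; have cu := half_state_continuous Hu; have cv := half_state_continuous Hv.
  have G0 : G (u 0) (v 0) = 0.
    apply: (continuous_Rintegral_eq0 _ _ IG); rewrite -/m ?mE//.
      by move=> x; apply: coupling_cvg => //; [exact: cu|exact: cv].
    by move=> x; exact: coupling_ge0.
  have /andP[u0 _] := nrd_le 0 nu; have /andP[v0 _] := nrd_le 0 nv.
  move: G0; rewrite /coupling !ger0_norm//.
  have h1 := powR_ge0 (u 0) (2 * q); have h2 := powR_ge0 (v 0) (2 * q).
  have h3 : 0 <= 2 * b * (u 0 `^ q * v 0 `^ q) by rewrite !mulr_ge0 ?powR_ge0// ltW.
  move=> G0; have e1 : u 0 `^ (2 * q) = 0 by lra.
  have e2 : v 0 `^ (2 * q) = 0 by lra.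
  by move: uv; rewrite (powR_eq0_eq0 e1) (powR_eq0_eq0 e2) addr0 ltxx.
have mpos : 0 < m by rewrite lt_neqAle eq_sym mn0.
apply/eqP; rewrite eq_le GI /= leNgt; apply/negP => m1.
have : m < m `^ q^-1.
  have l0 : ln m < 0 by rewrite ln_lt0// mpos.
  rewrite /powR gt_eqF// -{1}(lnK mpos) ltr_expR -subr_gt0.
  have -> : q^-1 * ln m - ln m = (1 - q^-1) * - ln m by ring.
  rewrite mulr_gt0// ?oppr_gt0// subr_gt0 invf_lt1//; move: q2; lra.
by rewrite ltNge Hm.
Qed.

End Extremal.

(** * Semitrivial minimisers *)

Section Semitrivial.
Context {R : realType}.
Local Notation mu := (@lebesgue_measure R).
Variables (q b omega : R).
Hypotheses (q2 : 2 <= q) (b0 : 0 < b) (om1 : 1 <= omega) (hD : D_threshold omega q <= b).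
Local Notation G := (coupling q b).
Local Notation f := (force q b).
Local Notation zero := (cst 0 : R -> R).
Implicit Types (u p v r : R -> R) (S : R).

Let q0 : 0 < q. Proof. by move: q2; lra. Qed.
Let om0 : 0 < omega. Proof. by move: om1; lra. Qed.

Lemma is_deriveZl (c : R) u p (x : R) : is_derive x 1 u (p x) -> is_derive x 1 (fun x => c * u x) (c * p x).
Proof.
move=> h; apply: (is_derive_eq (is_deriveM (is_derive_cst c x 1) h)).
by rewrite /GRing.scale/=; ring.
Qed.

Lemma is_derive_scale (w : R) u p (x : R) : (forall x : R, is_derive x 1 u (p x)) ->
  is_derive x 1 (fun x => u (w * x)) (w * p (w * x)).
Proof.
move=> h; have d : is_derive x 1 (fun x : R => w * x) w.
  by apply: (is_derive_eq (is_deriveZl w (is_derive_id x 1))); rewrite mulr1.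
have := @is_derive1_comp _ u (fun y : R => w * y) _ _ _ (h (w * x)) d.
by move=> h'; apply: (is_derive_eq h'); rewrite mulrC.
Qed.

Lemma nrd_zero : nonneg_radially_decreasing zero.
Proof. by split. Qed.

Lemma continuous_zero : continuous zero.
Proof. by move=> x; exact: cvg_cst. Qed.

Lemma AC_zero : AC zero zero.
Proof.
have L0 : L2 zero by apply: (@continuous_support_L2 _ zero 0) => //; exact: continuous_zero.
by split => // x y xy; rewrite Rintegral_itv_cst// subrr mul0r.
Qed.

Lemma sq_norm_zero (a : R) : sq_norm a zero zero = 0.
Proof.
rewrite /sq_norm; have -> : \int[mu]_s (zero s ^+ 2) = 0.
  have <- : \int[mu]_(s in (set0 : set R)) (0 : R) = 0 by rewrite Rintegral_set0.
  have := @Rintegral_support _ set0 (fun s => zero s ^+ 2); rewrite !Rintegral_set0; apply.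
  by move=> s _; rewrite expr0n.
by rewrite mulr0 addr0.
Qed.

Lemma coupling0r (s : R) : G s 0 = `|s| `^ (2 * q).
Proof. by rewrite /coupling normr0 !powR0 ?gt_eqF ?mulr_gt0//; ring. Qed.

Lemma force0r (s : R) : f s 0 = `|s| `^ (2 * q - 1).
Proof. by rewrite /force normr0 [0 `^ q]powR0 ?gt_eqF//; ring. Qed.

Lemma semitrivial_norm (a : R) S u p : 0 < S -> half_state q b a S u p zero -> unit_mass q b u zero ->
  sq_norm a u p = S.
Proof.
move=> S0 H [_ M]; have [nu _ _ _ _] := H.
have [_ ->] := half_state_norm q2 b0 S0 H nrd_zero continuous_zero.
have <- : \int[mu]_x G (u x) (zero x) = \int[mu]_x (u x * f (u x) (zero x)).
  by apply: eq_Rintegral => x _; rewrite coupling_force//= ?mul0r ?addr0//; case: nu.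
by rewrite M mulr1.
Qed.

Lemma sharp_mass_le S (m N : R) : 0 < S -> 0 <= m -> 0 <= N -> S * m `^ q^-1 <= N * S -> m <= N `^ q.
Proof.
move=> S0 m0 N0; rewrite [N * S]mulrC ler_pM2l// => H.
have -> : m = (m `^ q^-1) `^ q by rewrite -powRrM mulVf ?gt_eqF// powRr1.
by apply: ge0_ler_powR; rewrite ?nnegrE ?powR_ge0// ltW.
Qed.

(* Comparison with the pair [(u, omega ^ (-1/2) u (omega x))], of squared norm [2 S]. *)
Lemma semitrivial_threshold S u p : 0 < S -> sharp q b 1 (omega ^+ 2) S ->
  half_state q b 1 S u p zero -> 0 < u 0 -> unit_mass q b u zero ->
  omega = 1 /\ 2 + 2 * b = 2 `^ q.
Proof.
move=> S0 sh H u00 M; have [nu Lu Lp du dp] := H.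
have N1 := semitrivial_norm S0 H M.
have cu := is_derive_continuous du; have cp := is_derive_continuous dp.
have [u0 ue ud] := nu.
have upos := half_state_positive q2 b0 S0 ltr01 H nrd_zero u00.
pose c := omega `^ (- 2^-1); pose X := omega `^ (q / 2).
have X0 : 0 < X by exact: powR_gt0.
have c0 : 0 < c by exact: powR_gt0.
have c2 : c ^+ 2 = omega^-1.
  by rewrite -powR_mulrn ?ltW// -powRrM mulNr mulVf// powR_inv1// ltW.
have cq : c `^ q = X^-1 by rewrite -powRN -powRrM; congr (_ `^ _); field.
have c2q : c `^ (2 * q) = X^-1 ^+ 2 by rewrite mulrC powRrM powR_mulrn ?powR_ge0// cq.
have oX : omega `^ (1 + q / 2) = omega * X.
  have on0 : omega != 0 by rewrite gt_eqF.
  by rewrite powRD ?on0 ?implybT// powRr1// ltW.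
have hT : (2 `^ q - 1) / 2 * (omega * X) - 2^-1 * X^-1 <= b.
  by move: hD; rewrite /D_threshold oX powRN.
pose z x := c * u (omega * x); pose k x := c * (omega * p (omega * x)).
have dz (x : R) : is_derive x 1 z (k x).
  exact: (@is_deriveZl c (fun x => u (omega * x)) (fun x => omega * p (omega * x)) x
    (is_derive_scale omega x du)).
have cw : continuous (fun x : R => omega * x).
  by move=> x; apply: cvgM; [exact: cvg_cst|exact: cvg_id].
have ccomp (g : R -> R) : continuous g -> continuous (fun x => g (omega * x)).
  by move=> cg x; exact: (cvg_comp _ _ (cw x) (cg (omega * x))).
have ck : continuous k.
  move=> x; apply: cvgM; first exact: cvg_cst.
  by apply: cvgM; [exact: cvg_cst|exact: (ccomp p cp x)].
have cz := is_derive_continuous dz.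
have [Iu Eu] := Rintegral_scale om0 (continuous_sq cu) (fun x => sqr_ge0 (u x)) Lu.2.
have [Ip Ep] := Rintegral_scale om0 (continuous_sq cp) (fun x => sqr_ge0 (p x)) Lp.2.
have zE x : z x ^+ 2 = c ^+ 2 * u (omega * x) ^+ 2 by rewrite /z; ring.
have kE x : k x ^+ 2 = (c ^+ 2 * omega ^+ 2) * p (omega * x) ^+ 2 by rewrite /k; ring.
have Lz : L2 z.
  split; first exact: continuous_measurable_fun.
  by under eq_fun do rewrite zE; exact: intgZ.
have Lk : L2 k.
  split; first exact: continuous_measurable_fun.
  by under eq_fun do rewrite kE; exact: intgZ.
have Az : AC z k by exact: L2_derive_AC.
have N2 : sq_norm (omega ^+ 2) z k = S.
  rewrite -N1 /sq_norm.
  have -> : \int[mu]_s (z s ^+ 2) = c ^+ 2 * (omega^-1 * \int[mu]_s (u s ^+ 2)).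
    by rewrite -Eu -RintegralZl//; apply: eq_Rintegral => x _; exact: zE.
  have -> : \int[mu]_s (k s ^+ 2) = (c ^+ 2 * omega ^+ 2) * (omega^-1 * \int[mu]_s (p s ^+ 2)).
    by rewrite -Ep -RintegralZl//; apply: eq_Rintegral => x _; exact: kE.
  by rewrite c2; field; rewrite gt_eqF.
have [IG] := sh _ _ _ _ (half_state_AC H) Az; rewrite N1 N2.
have -> : S + S = 2 * S by ring.
set m := \int[mu]_x _ => Hm.
have {}Hm : m <= 2 `^ q.
  by apply: (sharp_mass_le S0) Hm => //; apply: Rintegral_ge0 => x _; exact: coupling_ge0.
pose A x := `|u x| `^ (2 * q).
have q20 : 0 < 2 * q by rewrite mulr_gt0.
have cA : continuous A.
  move=> x; apply: (@cvg_comp _ _ _ _ (fun s : R => `|s| `^ (2 * q)) _ _ _ (cu x)).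
  exact: continuous_norm_powR.
have A0 x : 0 <= A x by exact: powR_ge0.
have [IA MA] : mu.-integrable setT (EFin \o A) /\ \int[mu]_x A x = 1.
  have [I1 I2] := M; have E x : G (u x) (zero x) = A x by rewrite coupling0r.
  split; first by apply: eq_integrable I1 => // x _ /=; rewrite -E.
  by rewrite -I2; apply: eq_Rintegral => x _; rewrite -E.
have [IAw EAw] := Rintegral_scale om0 cA A0 IA.
pose B x := `|u x| `^ q.
have cB : continuous B.
  move=> x; apply: (@cvg_comp _ _ _ _ (fun s : R => `|s| `^ q) _ _ _ (cu x)).
  exact: continuous_norm_powR.
have AB x : A x = B x ^+ 2 by rewrite /A mulrC powRrM powR_mulrn// powR_ge0.
have B0 x : 0 <= B x by exact: powR_ge0.
have Bw x : B (omega * x) <= B x.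
  apply: ge0_ler_powR; rewrite ?nnegrE ?(ltW q0)// !ger0_norm//; apply: ud.
  by rewrite normrM (gtr0_norm om0) ler_peMl.
(* The excess of the mixed product u^q u(omega x)^q over u(omega x)^(2q), nonnegative because u is
   decreasing and omega >= 1. *)
pose H2 x := B x * B (omega * x) - A (omega * x).
have H2E x : H2 x = B (omega * x) * (B x - B (omega * x)) by rewrite /H2 AB; ring.
have H20 x : 0 <= H2 x by rewrite H2E mulr_ge0// subr_ge0.
have cH2 : continuous H2.
  move=> x; apply: cvgB; last exact: (ccomp A cA x).
  by apply: cvgM; [exact: cB|exact: (ccomp B cB x)].
have IH2 : mu.-integrable setT (EFin \o H2).
  apply: (integrable_le _ IA); first exact: continuous_measurable_fun.
  move=> x; rewrite ger0_norm// /H2 [A x]AB expr2.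
  have : B x * B (omega * x) <= B x * B x by apply: ler_wpM2l.
  by have := A0 (omega * x); lra.
have GE x : G (u x) (z x) = A x + ((X^-1 ^+ 2 + 2 * b * X^-1) * A (omega * x) + 2 * b * X^-1 * H2 x).
  rewrite /coupling /z !normrM (gtr0_norm c0) !powRM ?(ltW c0)// c2q cq -/(A x) -/(B x).
  by rewrite -/(A (omega * x)) -/(B (omega * x)) /H2; ring.
have mE : m = 1 + ((X^-1 ^+ 2 + 2 * b * X^-1) * omega^-1 + 2 * b * X^-1 * \int[mu]_x H2 x).
  rewrite /m (@eq_Rintegral _ _ _ mu setT (fun x => A x + ((X^-1 ^+ 2 + 2 * b * X^-1) * A (omega * x) +
    2 * b * X^-1 * H2 x))); last by move=> x _; exact: GE.
  have I1 : mu.-integrable setT (EFin \o (fun x => (X^-1 ^+ 2 + 2 * b * X^-1) * A (omega * x))).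
    by apply: intgZ.
  have I2 : mu.-integrable setT (EFin \o (fun x => 2 * b * X^-1 * H2 x)) by apply: intgZ.
  rewrite RintegralD//; last by apply: intgD.
  by rewrite RintegralD// !RintegralZl// EAw MA mulr1.
have h0 : 0 <= \int[mu]_x H2 x by apply: Rintegral_ge0 => x _.
set h := \int[mu]_x H2 x in mE h0.
set Q := 2 `^ q in hT Hm *.
have Xv0 : 0 < X^-1 by rewrite invr_gt0.
have ov0 : 0 < omega^-1 by rewrite invr_gt0.
(* This is the hypothesis on b, multiplied by omega^(-1 - q/2). Together with m <= 2^q it leaves no
   room for the integral of [H2]. *)
have key : Q - 1 <= (X^-1 ^+ 2 + 2 * b * X^-1) * omega^-1.
  have := ler_wpM2l (ltW (mulr_gt0 Xv0 ov0)) hT.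
  have -> : X^-1 * omega^-1 * ((Q - 1) / 2 * (omega * X) - 2^-1 * X^-1) =
     (Q - 1) / 2 - 2^-1 * X^-1 ^+ 2 * omega^-1 by field; rewrite !gt_eqF.
  lra.
have hle : h <= 0.
  have h2 : 0 < 2 * b * X^-1 by rewrite !mulr_gt0.
  rewrite -(ler_pM2l h2) mulr0; move: Hm; rewrite mE; lra.
have H2z := continuous_Rintegral_eq0 cH2 H20 IH2 hle.
(* As u is positive, [H2 = 0] makes u^(2q) invariant under dilation by omega; its integral is then
   both 1 and 1 / omega. *)
have AA x : A (omega * x) = A x.
  have : B (omega * x) != 0 by rewrite gt_eqF// powR_gt0// normr_gt0 gt_eqF.
  move=> Bn; have := H2z x; rewrite H2E => /eqP; rewrite mulf_eq0 (negPf Bn)/= subr_eq0 => /eqP E.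
  by rewrite !AB E.
have om : omega = 1.
  move: EAw; have -> : \int[mu]_x A (omega * x) = \int[mu]_x A x.
    by apply: eq_Rintegral => x _; exact: AA.
  rewrite MA mulr1 => E; have := congr1 (fun t => t^-1) E.
  by rewrite invrK invr1.
split => //; have XE : X = 1 by rewrite /X om powR1.
move: Hm hT; rewrite mE XE om !invr1 => Hm hD'.
have h00 : h = 0 by apply/eqP; rewrite eq_le hle h0.
by move: Hm hD'; rewrite h00; lra.
Qed.

(** The same function placed in the first component has the same mass and a squared norm with weight
    1 instead of omega^2, strictly smaller if omega > 1. *)
Lemma second_semitrivial S v r : 0 < S -> sharp q b 1 (omega ^+ 2) S ->
  half_state q b (omega ^+ 2) S v r zero -> 0 < v 0 -> unit_mass q b v zero -> omega = 1.
Proof.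
move=> S0 sh H v00 M; have [nv [mv Iv] Lr dv dr] := H.
have N1 := semitrivial_norm S0 H M.
have [_] := sh _ _ _ _ (half_state_AC H) AC_zero.
have [_ ->] := M; rewrite powR1 mulr1 sq_norm_zero addr0 -{1}N1 /sq_norm mul1r lerD2r => Hle.
apply/eqP; rewrite eq_le om1 andbT leNgt; apply/negP => om.
have om2 : 0 < omega ^+ 2 - 1 by rewrite subr_gt0 expr2; move: om; nra.
have cv := is_derive_continuous dv.
have V0 : \int[mu]_s (v s ^+ 2) <= 0.
  by rewrite -(ler_pM2l om2) mulr0 mulrBl mul1r subr_le0.
have := continuous_Rintegral_eq0 (continuous_sq cv) (fun x => sqr_ge0 (v x)) Iv V0 0.
by move/eqP; rewrite expf_eq0/= gt_eqF.
Qed.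

(* At the threshold with [omega = 1], the semitrivial minimiser can be split
   evenly between the two components without changing its level. *)
Lemma balanced_state S u p : 2 + 2 * b = 2 `^ q -> half_state q b 1 S u p zero ->
  unit_mass q b u zero -> let t := 2 `^ (- 2^-1) in
  half_state q b 1 S (fun x => t * u x) (fun x => t * p x) (fun x => t * u x) /\
  unit_mass q b (fun x => t * u x) (fun x => t * u x).
Proof.
move=> bE [[u0 ue ud] Lu Lp du dp] [I1 M] t; have t0 : 0 < t by exact: powR_gt0.
have t2 : t ^+ 2 = 2^-1.
  by rewrite -powR_mulrn ?ltW// -powRrM mulNr mulVf// powR_inv1.
have t2q : t `^ (2 * q) = (2 `^ q)^-1.
  by rewrite powRrM powR_mulrn ?ltW// t2 -powR_inv1// -powRrM mulN1r powRN.
have Q0 : 0 < 2 `^ q :> R by exact: powR_gt0.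
have GE x : G (t * u x) (t * u x) = G (u x) (zero x).
  rewrite coupling0r /coupling normrM (gtr0_norm t0) !powRM ?(ltW t0)// t2q.
  have E : t `^ q * `|u x| `^ q * (t `^ q * `|u x| `^ q) = t `^ (2 * q) * `|u x| `^ (2 * q).
    by rewrite ![2 * q]mulrC !powRrM !powR_mulrn ?powR_ge0//; ring.
  rewrite E t2q; move: (`|u x| `^ _) => y; have b' : b = 2 `^ q / 2 - 1 by move: bE; lra.
  by rewrite b'; field; rewrite gt_eqF.
split; last first.
  split; first by apply: eq_integrable I1 => // x _ /=; rewrite GE.
  by rewrite -M; apply: eq_Rintegral => x _; exact: GE.
split; [split|exact: L2Z|exact: L2Z| |].
- by move=> x; rewrite mulr_ge0// ltW.
- by move=> x; rewrite ue.
- by move=> x y /ud h; rewrite ler_pM2l.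
- by move=> x; exact: is_deriveZl.
move=> x; apply: (is_derive_eq (@is_deriveZl t p (fun x => 1 * u x - S * f (u x) (zero x)) x (dp x))).
(* With t^2 = 1/2 and 1 + b = 2^(q-1), one has (1 + b) t^(2q-1) = t, so the coupled force of the
   split pair is t times the original one. *)
rewrite force0r mul1r mul1r mulrBr mulrCA; congr (_ - _ * _).
have [->|un] := eqVneq (u x) 0.
  by rewrite !mulr0 force0// normr0 powR0 ?mulr0//; move: q2; lra.
have ux : 0 < u x by rewrite lt_neqAle eq_sym un u0.
have tux : 0 < t * u x by rewrite mulr_gt0.
rewrite /force (gtr0_norm tux) (gtr0_norm ux).
have pm (s r1 : R) : 0 < s -> s `^ (r1 - 1) = s `^ r1 / s.
  move=> s0; have sn0 : s != 0 by rewrite gt_eqF.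
  by rewrite powRD ?sn0 ?implybT// powR_inv1// ltW.
have E2 : (t * u x) `^ q * ((t * u x) `^ q / (t * u x)) = (t * u x) `^ (2 * q) / (t * u x).
  by rewrite [2 * q]mulrC powRrM powR_mulrn ?powR_ge0// expr2 mulrA.
rewrite !pm// -mulrA E2 !powRM ?(ltW t0)// t2q.
have b' : b = 2 `^ q / 2 - 1 by move: bE; lra.
move: (u x `^ _) => y; rewrite b'.
have -> : 2 `^ q / 2 - 1 = 2 `^ q * t ^+ 2 - 1 by rewrite t2.
by field; rewrite !gt_eqF.
Qed.

(** A component that vanishes at 0 vanishes identically by monotonicity. Any semitrivial extremal
    then forces omega = 1, where the components play symmetric roles and the split pair replaces it;
    otherwise the extremal is already positive. *)
Theorem positive_extremal : exists u p v r S, [/\ 0 < S, sharp q b 1 (omega ^+ 2) S,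
  half_state q b 1 S u p v, half_state q b (omega ^+ 2) S v r u & unit_mass q b u v /\
  forall x : R, 0 < u x /\ 0 < v x].
Proof.
have om2 : 0 < omega ^+ 2 by rewrite exprn_gt0.
have [u [p [v [r [S [S0 sh Hu Hv [uv M]]]]]]] := extremal_exists q2 b0 ltr01 om2.
have [nu _ _ _ _] := Hu; have [nv _ _ _ _] := Hv.
have vanish (w : R -> R) : nonneg_radially_decreasing w -> w 0 <= 0 -> w = zero.
  move=> nw w0; apply/funext => x; have /andP[h1 h2] := nrd_le x nw.
  by apply/eqP; rewrite eq_le h1 (le_trans h2 w0).
have balance (y k : R -> R) : omega = 1 -> half_state q b 1 S y k zero -> 0 < y 0 ->
    unit_mass q b y zero -> exists u p v r S, [/\ 0 < S, sharp q b 1 (omega ^+ 2) S,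
  half_state q b 1 S u p v, half_state q b (omega ^+ 2) S v r u & unit_mass q b u v /\
  forall x : R, 0 < u x /\ 0 < v x].
  move=> om Hy y0 My; have [_ bE] := semitrivial_threshold S0 sh Hy y0 My.
  have [Hb Mb] := balanced_state bE Hy My.
  set t := 2 `^ (- 2^-1) in Hb Mb; have t0 : 0 < t by exact: powR_gt0.
  exists (fun x => t * y x), (fun x => t * k x), (fun x => t * y x), (fun x => t * k x), S.
  split => //; first by rewrite om expr1n.
  split => // x; have := half_state_positive q2 b0 S0 ltr01 Hy nrd_zero y0 x.
  by move=> yx; split; exact: mulr_gt0.
have [u0|u0] := leP (u 0) 0.
  have v0 : 0 < v 0 by move: uv; lra.
  have uE := vanish u nu u0; rewrite uE in Hv M.
  have Mv : unit_mass q b v zero.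
    have E x : G (zero x) (v x) = G (v x) (zero x) by rewrite couplingC.
    have [I1 I2] := M; split; first by apply: eq_integrable I1 => // x _ /=; rewrite -E.
    by rewrite -I2; apply: eq_Rintegral => x _; rewrite -E.
  have om := second_semitrivial S0 sh Hv v0 Mv.
  by apply: (balance v r om _ v0 Mv); rewrite om expr1n in Hv.
have [v0|v0] := leP (v 0) 0.
  have vE := vanish v nv v0; rewrite vE in Hu M.
  have [om _] := semitrivial_threshold S0 sh Hu u0 M.
  exact: (balance u p om Hu u0 M).
exists u, p, v, r, S; split => //; split => // x; split.
  exact: (half_state_positive q2 b0 S0 ltr01 Hu nv u0).
exact: (half_state_positive q2 b0 S0 om2 Hv nu v0).
Qed.

End Semitrivial.

(** * Ground states *)

Section GroundState.
Context {R : realType}.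
Local Notation mu := (@lebesgue_measure R).
Variables (q b omega : R).
Hypotheses (q2 : 2 <= q) (b0 : 0 < b) (om1 : 1 <= omega).
Local Notation G := (coupling q b).
Local Notation f := (force q b).
Implicit Types (u p v r phi : R -> R) (S : R).

Let q0 : 0 < q. Proof. by move: q2; lra. Qed.
Let q20 : 0 < 2 * q. Proof. by rewrite mulr_gt0. Qed.

Lemma normL_powR (e : R) u : 0 < e -> mu.-integrable setT (EFin \o (fun x => `|u x| `^ e)) ->
  normL e u `^ e = \int[mu]_x (`|u x| `^ e).
Proof.
move=> e0 I; rewrite /normL unlock.
have -> : (\int[mu]_x (`|(EFin \o u) x| `^ e) = (\int[mu]_x (`|u x| `^ e))%:E)%E.
  rewrite /Rintegral fineK; last exact: (integrable_fin_num measurableT I).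
  by apply: eq_integral.
rewrite poweR_EFin /= -powRrM mulVf ?gt_eqF// powRr1//.
by apply: Rintegral_ge0 => x _; exact: powR_ge0.
Qed.

Lemma normL2 u : L2 u -> normL 2 u ^+ 2 = \int[mu]_x (u x ^+ 2).
Proof.
move=> [_ I].
have E x : `|u x| `^ 2 = u x ^+ 2 by rewrite powR_mulrn// real_normK// num_real.
have nL0 : 0 <= normL 2 u by apply: fine_ge0; exact: Lnorm_ge0.
rewrite -powR_mulrn// normL_powR//; first by apply: eq_Rintegral => x _; exact: E.
by apply: eq_integrable I => // x _ /=; rewrite E.
Qed.

Lemma signed_pow_mul (e s : R) : 2 <= e -> signed_pow e s * s = `|s| `^ e.
Proof.
move=> e2; rewrite /signed_pow -mulrA -expr2; have [->|s0] := eqVneq s 0.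
  by rewrite expr0n/= mulr0 normr0 powR0// gt_eqF//; move: e2; lra.
rewrite -[s ^+ 2]real_normK ?num_real// -powR_mulrn// -powRD ?normr_eq0 ?s0 ?implybT//.
by congr (_ `^ _); ring.
Qed.

Lemma force_signed (s t : R) : 0 <= s ->
  signed_pow (2 * q) s + b * `|t| `^ q * signed_pow q s = f s t.
Proof.
rewrite le_eqVlt => /predU1P[<-|s0].
  by rewrite force0// /signed_pow !mulr0 addr0.
have sn0 : s != 0 by rewrite gt_eqF.
rewrite /force /signed_pow (gtr0_norm s0); congr (_ + _ * _).
  by rewrite -{2}(powRr1 (ltW s0)) -powRD ?sn0 ?implybT//; congr (_ `^ _); ring.
by rewrite -{2}(powRr1 (ltW s0)) -powRD ?sn0 ?implybT//; congr (_ `^ _); ring.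
Qed.

Lemma forceZ (c s t : R) : 0 < c -> f (c * s) (c * t) = c `^ (2 * q - 1) * f s t.
Proof.
move=> c0; rewrite /force !normrM (gtr0_norm c0) !powRM ?(ltW c0)//.
have cn0 : c != 0 by rewrite gt_eqF.
have -> : c `^ (2 * q - 1) = c `^ q * c `^ (q - 1).
  by rewrite -powRD ?cn0 ?implybT//; congr (_ `^ _); ring.
by ring.
Qed.

(** The force is homogeneous of degree 2 q - 1, so scaling by c turns the multiplier S into S /
    c^(2q-2) = 1. *)
Lemma half_stateZ (a S c : R) u p v : 0 < c -> c `^ (2 * q - 2) = S -> half_state q b a S u p v ->
  half_state q b a 1 (fun x => c * u x) (fun x => c * p x) (fun x => c * v x).
Proof.
move=> c0 cS [[u0 ue ud] Lu Lp du dp]; split; [split|exact: L2Z|exact: L2Z| |].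
- by move=> x; rewrite mulr_ge0// ltW.
- by move=> x; rewrite ue.
- by move=> x y /ud h; rewrite ler_pM2l.
- by move=> x; exact: is_deriveZl.
move=> x; apply: (is_derive_eq (@is_deriveZl _ c p (fun x => a * u x - S * f (u x) (v x)) x (dp x))).
rewrite forceZ// mul1r -cS.
have cn0 : c != 0 by rewrite gt_eqF.
have -> : c `^ (2 * q - 1) = c * c `^ (2 * q - 2).
  by rewrite -{2}(powRr1 (ltW c0)) -powRD ?cn0 ?implybT//; congr (_ `^ _); ring.
by ring.
Qed.

Lemma sqnorm_omegaE (z1 z2 U1 U2 : R -> R) : H1 z1 -> H1 z2 ->
  AC U1 (weak_derivative z1) -> AC U2 (weak_derivative z2) ->
  U1 = z1 %[ae mu] -> U2 = z2 %[ae mu] ->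
  sqnorm_omega omega (z1, z2) =
    sq_norm 1 U1 (weak_derivative z1) + sq_norm (omega ^+ 2) U2 (weak_derivative z2).
Proof.
move=> H1z H2z A1 A2 E1 E2.
have [L1 L1'] := H1_L2 H1z; have [L2z L2z'] := H1_L2 H2z.
have [LU1 _ _] := A1; have [LU2 _ _] := A2.
have sqE (z U : R -> R) : L2 z -> L2 U -> U = z %[ae mu] ->
    \int[mu]_x (z x ^+ 2) = \int[mu]_x (U x ^+ 2).
  move=> [mz _] [mU _] E; apply: ae_Rintegral; [exact: measurable_funX..|].
  by apply: aeS E => x h _; rewrite (h I).
rewrite /sqnorm_omega /sq_norm [(z1, z2).1]/= [(z1, z2).2]/=.
rewrite (normL2 L1) (normL2 L1') (normL2 L2z) (normL2 L2z') (sqE _ _ L1 LU1 E1) (sqE _ _ L2z LU2 E2).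
by rewrite mul1r !addrA.
Qed.

(** [normL] passes through [fine], so each of the three powers must be shown integrable before the
    norms can be read as integrals; each is dominated by a multiple of G. *)
Lemma energyE (z1 z2 U1 U2 : R -> R) : L2 z1 -> L2 z2 -> L2 U1 -> L2 U2 ->
  U1 = z1 %[ae mu] -> U2 = z2 %[ae mu] ->
  mu.-integrable setT (EFin \o (fun x => G (U1 x) (U2 x))) ->
  energy omega q b (z1, z2) =
    2^-1 * sqnorm_omega omega (z1, z2) - (2 * q)^-1 * \int[mu]_x G (U1 x) (U2 x).
Proof.
move=> [mz1 _] [mz2 _] [mU1 _] [mU2 _] E1 E2 IG; rewrite /energy /=; congr (_ - _ * _).
have mpow (e : R) (w : R -> R) : measurable_fun setT w -> measurable_fun setT (fun x => `|w x| `^ e).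
  move=> mw; apply: (@measurableT_comp _ _ _ _ _ _ (fun x : R => x `^ e)) => //.
  exact: measurableT_comp.
have G1 x : `|U1 x| `^ (2 * q) <= G (U1 x) (U2 x).
  by rewrite /coupling -addrA lerDl addr_ge0 ?mulr_ge0 ?powR_ge0// ltW.
have G2 x : `|U2 x| `^ (2 * q) <= G (U1 x) (U2 x) by rewrite couplingC /coupling -addrA lerDl
   addr_ge0 ?mulr_ge0 ?powR_ge0// ltW.
have G3 x : `|U1 x| `^ q * `|U2 x| `^ q <= (2 * b)^-1 * G (U1 x) (U2 x).
  have b2 : 0 < 2 * b by rewrite mulr_gt0.
  rewrite -[leLHS](mulKf (lt0r_neq0 b2)); apply: ler_wpM2l; first by rewrite invr_ge0 ltW.
  by rewrite /coupling lerDr addr_ge0 ?powR_ge0.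
have I1 : mu.-integrable setT (EFin \o (fun x => `|U1 x| `^ (2 * q))).
  by apply: (integrable_le _ IG) => [|x]; [exact: mpow|rewrite ger0_norm ?powR_ge0].
have I2 : mu.-integrable setT (EFin \o (fun x => `|U2 x| `^ (2 * q))).
  by apply: (integrable_le _ IG) => [|x]; [exact: mpow|rewrite ger0_norm ?powR_ge0].
have I3 : mu.-integrable setT (EFin \o (fun x => `|U1 x| `^ q * `|U2 x| `^ q)).
  apply: (integrable_le _ (intgZ (2 * b)^-1 measurableT IG)) => [|x].
    by apply: measurable_funM; exact: mpow.
  by rewrite ger0_norm ?mulr_ge0 ?powR_ge0.
have ae1 : (fun x => `|z1 x| `^ (2 * q)) = (fun x => `|U1 x| `^ (2 * q)) %[ae mu].
  by apply: aeS E1 => x h _; rewrite (h I).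
have ae2 : (fun x => `|z2 x| `^ (2 * q)) = (fun x => `|U2 x| `^ (2 * q)) %[ae mu].
  by apply: aeS E2 => x h _; rewrite (h I).
have ae3 : (fun x => `|(z1 \* z2) x| `^ q) = (fun x => `|U1 x| `^ q * `|U2 x| `^ q) %[ae mu].
  by apply: aeS (aeI E1 E2) => x [h1 h2] _; rewrite /= (h1 I) (h2 I) normrM powRM.
have m3 : measurable_fun setT (fun x => `|(z1 \* z2) x| `^ q).
  by apply: mpow; exact: measurable_funM.
rewrite !normL_powR//; [|exact: intg_ae m3 I3 ae3|exact: intg_ae (mpow _ _ mz2) I2 ae2|
  exact: intg_ae (mpow _ _ mz1) I1 ae1].
rewrite (ae_Rintegral (mpow _ _ mz1) (mpow _ _ mU1) ae1) (ae_Rintegral (mpow _ _ mz2) (mpow _ _ mU2) ae2).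
rewrite (ae_Rintegral m3 _ ae3); last by apply: measurable_funM; exact: mpow.
rewrite -RintegralD// -RintegralZl// -RintegralD//; first by apply: intgD.
by apply: intgZ.
Qed.

(** The Nehari identity: each equation is tested with its own component and the results are
    added. *)
Lemma solution_norm (z1 z2 U1 U2 : R -> R) : weak_solution omega q b (z1, z2) -> H1 z1 -> H1 z2 ->
  AC U1 (weak_derivative z1) -> AC U2 (weak_derivative z2) ->
  U1 = z1 %[ae mu] -> U2 = z2 %[ae mu] ->
  mu.-integrable setT (EFin \o (fun x => G (U1 x) (U2 x))) ->
  sq_norm 1 U1 (weak_derivative z1) + sq_norm (omega ^+ 2) U2 (weak_derivative z2) =
  \int[mu]_x G (U1 x) (U2 x).
Proof.
move=> W H1z H2z A1 A2 E1 E2 IG.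
have [[mU1 I1] [mg1 Ig1] P1] := A1; have [[mU2 I2] [mg2 Ig2] P2] := A2.
have [[mz1 _] _] := H1_L2 H1z; have [[mz2 _] _] := H1_L2 H2z.
have mpow (e : R) (w : R -> R) : measurable_fun setT w -> measurable_fun setT (fun x => `|w x| `^ e).
  move=> mw; apply: (@measurableT_comp _ _ _ _ _ _ (fun x : R => x `^ e)) => //.
  exact: measurableT_comp.
pose F (U V : R -> R) x := `|U x| `^ (2 * q) + b * `|V x| `^ q * `|U x| `^ q.
have mF U V : measurable_fun setT U -> measurable_fun setT V -> measurable_fun setT (F U V).
  move=> mU mV; apply: measurable_funD; first exact: mpow.
  by apply: measurable_funM; [apply: measurable_funM => //; exact: mpow|exact: mpow].
have F0 U V x : 0 <= F U V x by rewrite addr_ge0 ?mulr_ge0 ?powR_ge0// ltW.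
have GE x : G (U1 x) (U2 x) = F U1 U2 x + F U2 U1 x by rewrite /coupling /F; ring.
have IF1 : mu.-integrable setT (EFin \o F U1 U2).
  by apply: (integrable_le _ IG) => [|x]; [exact: mF|rewrite ger0_norm// GE lerDl].
have IF2 : mu.-integrable setT (EFin \o F U2 U1).
  by apply: (integrable_le _ IG) => [|x]; [exact: mF|rewrite ger0_norm// GE lerDr].
have lhs (a : R) (z U g : R -> R) : measurable_fun setT z -> measurable_fun setT U -> measurable_fun setT g ->
    U = z %[ae mu] -> mu.-integrable setT (EFin \o (fun x => U x ^+ 2)) ->
    mu.-integrable setT (EFin \o (fun x => g x ^+ 2)) ->
    \int[mu]_x (g x * g x + a * z x * z x) = sq_norm a U g.
  move=> mz mU mg E IU Ig; transitivity (\int[mu]_x (a * U x ^+ 2 + g x ^+ 2)).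
    apply: ae_Rintegral.
    - apply: measurable_funD; apply: measurable_funM => //.
      by apply: measurable_funM => //; exact: measurable_cst.
    - by apply: measurable_funD; [apply: measurable_funM; [exact: measurable_cst|exact: measurable_funX]|
        exact: measurable_funX].
    - by apply: aeS E => x h _; rewrite (h I); ring.
  have IU' : mu.-integrable setT (EFin \o (fun x => a * U x ^+ 2)) by exact: intgZ.
  by rewrite RintegralD// RintegralZl.
have rhs (z w U V : R -> R) : measurable_fun setT z -> measurable_fun setT w ->
    measurable_fun setT U -> measurable_fun setT V -> U = z %[ae mu] -> V = w %[ae mu] ->
    \int[mu]_x ((signed_pow (2 * q) (z x) + b * `|w x| `^ q * signed_pow q (z x)) * z x) =
    \int[mu]_x F U V x.
  move=> mz mw mU mV EU EV; transitivity (\int[mu]_x F z w x).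
    apply: eq_Rintegral => x _; rewrite mulrDl -mulrA !signed_pow_mul//; move: q2; lra.
  apply: ae_Rintegral; [exact: mF..|].
  by apply: aeS (aeI EU EV) => x [h1 h2] _; rewrite /F (h1 I) (h2 I).
have [W1 _] := W z1 H1z; have [_ W2] := W z2 H2z.
have {}W1 : sq_norm 1 U1 (weak_derivative z1) = \int[mu]_x F U1 U2 x.
  rewrite -(lhs 1 z1 U1 _ mz1 mU1 mg1 E1 I1 Ig1) -(rhs z1 z2 U1 U2 mz1 mz2 mU1 mU2 E1 E2) -W1.
  by apply: eq_Rintegral => x _; rewrite mul1r.
have {}W2 : sq_norm (omega ^+ 2) U2 (weak_derivative z2) = \int[mu]_x F U2 U1 x.
  rewrite -(lhs (omega ^+ 2) z2 U2 _ mz2 mU2 mg2 E2 I2 Ig2).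
  by rewrite -(rhs z2 z1 U2 U1 mz2 mz1 mU2 mU1 E2 E1) -W2.
rewrite W1 W2 -RintegralD//; apply: eq_Rintegral => x _; exact: esym (GE x).
Qed.

Lemma measurable_coupling (U V : R -> R) : measurable_fun setT U -> measurable_fun setT V ->
  measurable_fun setT (fun x => G (U x) (V x)).
Proof.
move=> mU mV.
have mpow (e : R) (w : R -> R) : measurable_fun setT w -> measurable_fun setT (fun x => `|w x| `^ e).
  move=> mw; apply: (@measurableT_comp _ _ _ _ _ _ (fun x : R => x `^ e)) => //.
  exact: measurableT_comp.
apply: measurable_funD; first by apply: measurable_funD; exact: mpow.
apply: measurable_funM; first exact: measurable_cst.
by apply: measurable_funM; exact: mpow.
Qed.

Let sum_eq0 (w x1 x2 x3 x4 : R) : 0 < w -> 0 <= x1 -> 0 <= x2 -> 0 <= x3 -> 0 <= x4 ->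
  x1 + x2 + (w * x3 + x4) = 0 -> x1 <= 0 /\ x3 <= 0.
Proof.
move=> w0 h1 h2 h3 h4 E; have h5 : 0 <= w * x3 by rewrite mulr_ge0// ltW.
by split; [lra|rewrite -(ler_pM2l w0) mulr0; lra].
Qed.

(** By the Nehari identity norm and mass coincide, so the energy is a fixed multiple of m, and the
    sharp inequality becomes a condition on m alone; m = 0 would make both L^2 norms vanish. The
    last clause allows m to be computed from any measurable representatives. *)
Lemma solution_energy S z : 0 < S -> sharp q b 1 (omega ^+ 2) S ->
  nontrivial_solution omega q b z -> exists m, [/\ 0 < m, S * m `^ q^-1 <= m,
    energy omega q b z = (2^-1 - (2 * q)^-1) * m &
    forall V1 V2, measurable_fun setT V1 -> measurable_fun setT V2 ->
      V1 = z.1 %[ae mu] -> V2 = z.2 %[ae mu] -> \int[mu]_x G (V1 x) (V2 x) = m].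
Proof.
case: z => z1 z2 S0 sh [[/= H1z H2z] nz W].
have [U1 A1 E1] := H1P H1z; have [U2 A2 E2] := H1P H2z.
have [IG] := sh _ _ _ _ A1 A2.
have [L1 _] := H1_L2 H1z; have [L2z _] := H1_L2 H2z.
have [LU1 Lg1 P1] := A1; have [LU2 Lg2 P2] := A2.
have N := solution_norm W H1z H2z A1 A2 E1 E2 IG; rewrite N => Hm.
set m := \int[mu]_x G (U1 x) (U2 x) in N Hm.
exists m; split; [|exact: Hm| |].
- have m0 : 0 <= m by apply: Rintegral_ge0 => x _; exact: coupling_ge0.
  rewrite lt_neqAle m0 andbT eq_sym; apply/eqP => mE; apply: nz.
  have c1 := primitive_continuous Lg1 P1; have c2 := primitive_continuous Lg2 P2.
  have om2 : 0 < omega ^+ 2 by apply: exprn_gt0; exact: lt_le_trans ltr01 om1.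
  have sq0 (w : R -> R) : 0 <= \int[mu]_x (w x ^+ 2).
    by apply: Rintegral_ge0 => x _; exact: sqr_ge0.
  move: N; rewrite mE /sq_norm mul1r => N.
  have p1 := sq0 U1; have p2 := sq0 (weak_derivative z1); have p4 := sq0 (weak_derivative z2).
  have [Z1 Z2] := sum_eq0 om2 p1 p2 (sq0 U2) p4 N.
  have V1 := continuous_Rintegral_eq0 (continuous_sq c1) (fun x => sqr_ge0 (U1 x)) LU1.2 Z1.
  have V2 := continuous_Rintegral_eq0 (continuous_sq c2) (fun x => sqr_ge0 (U2 x)) LU2.2 Z2.
  have ker (w : R -> R) x : w x ^+ 2 = 0 -> w x = 0 by move/eqP; rewrite expf_eq0 => /eqP.
  by split; [apply: aeS E1 => x h _ /=; rewrite -(h I) (ker _ _ (V1 x))|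
             apply: aeS E2 => x h _ /=; rewrite -(h I) (ker _ _ (V2 x))].
- rewrite (energyE L1 L2z LU1 LU2 E1 E2 IG) (sqnorm_omegaE H1z H2z A1 A2 E1 E2) N -/m; ring.
- move=> V1 V2 mV1 mV2 F1 F2; apply: ae_Rintegral.
  + exact: measurable_coupling.
  + by apply: measurable_coupling; [case: LU1|case: LU2].
  + by apply: aeS (aeI (aeI E1 E2) (aeI F1 F2)) => x [[e1 e2] [f1 f2]] _;
      rewrite (e1 I) (e2 I) (f1 I) (f2 I).
Qed.

(* [c ^ 2 S] is the only positive fixed point of [m |-> S m ^ (1 / q)]. *)
Lemma level_le S (c m : R) : 0 < c -> c `^ (2 * q - 2) = S -> 0 < m -> S * m `^ q^-1 <= m ->
  c `^ (2 * q) <= m.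
Proof.
move=> c0 cS m0 H; rewrite leNgt; apply/negP => mc.
have cn0 : c != 0 by rewrite gt_eqF.
have mn0 : m != 0 by rewrite gt_eqF.
have e0 : 0 < 1 - q^-1 by rewrite subr_gt0 invf_lt1//; move: q2; lra.
have : m `^ (1 - q^-1) < (c `^ (2 * q)) `^ (1 - q^-1).
  by apply: gt0_ltr_powR; rewrite // nnegrE ?powR_ge0// ltW.
have -> : (c `^ (2 * q)) `^ (1 - q^-1) = S.
  by rewrite -powRrM -cS; congr (_ `^ _); field; rewrite gt_eqF.
have -> : m `^ (1 - q^-1) = m / m `^ q^-1.
  by rewrite powRD ?mn0 ?implybT// powRr1 ?ltW// powRN.
by rewrite ltr_pdivrMr ?powR_gt0// ltNge H.
Qed.

End GroundState.

Theorem theorem1p3 (R : realType) (q omega b : R)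
    (hq : 2 <= q) (homega : 1 <= omega) (hb : 0 < b)
    (hD : D_threshold omega q <= b) :
  exists u v : R -> R,
    [/\ ground_state omega q b (u, v), E_rd (u, v),
        forall x : R, 0 < u x & forall x : R, 0 < v x].
Proof.
have [u0 [p0 [v0 [r0 [S [S0 sh Hu0 Hv0 [M pos]]]]]]] := positive_extremal hq hb homega hD.
have q22 : 0 < 2 * q - 2 by move: hq; lra.
have q0 : 0 < q by move: hq; lra.
pose c := S `^ (2 * q - 2)^-1; have c0 : 0 < c by exact: powR_gt0.
have cS : c `^ (2 * q - 2) = S by rewrite -powRrM mulVf ?gt_eqF// powRr1// ltW.
have Hu := half_stateZ c0 cS Hu0; have Hv := half_stateZ c0 cS Hv0.
pose u x := c * u0 x; pose v x := c * v0 x; pose p x := c * p0 x; pose r x := c * r0 x.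
rewrite -/u -/v -/p -/r in Hu Hv.
have upos x : 0 < u x by rewrite mulr_gt0//; have [] := pos x.
have vpos x : 0 < v x by rewrite mulr_gt0//; have [] := pos x.
have [nu Lu Lp du dp] := Hu; have [nv Lv Lr dv dr] := Hv.
have cu := is_derive_continuous du; have cv := is_derive_continuous dv.
have Au := half_state_AC Hu; have Av := half_state_AC Hv.
have [H1u _] := AC_H1 Au; have [H1v _] := AC_H1 Av.
have sol : nontrivial_solution omega q b (u, v).
  split => //.
    move=> [/= E _]; have [x /(_ Logic.I) ux] := ae_exists E.
    by have := upos x; rewrite ux ltxx.
  move=> phi Hphi; split.
    transitivity (\int[lebesgue_measure]_x (weak_derivative u x * weak_derivative phi x + 1 * u x * phi x)).
      by apply: eq_Rintegral => x _; rewrite mul1r.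
    rewrite (classical_weak du dp (half_state_source_continuous hq Hu cv) Lu Lp
      (half_state_source_L2 hq hb ltr01 Hu nv cv) Hphi).
    by apply: eq_Rintegral => x _; rewrite force_signed ?mul1r//; exact: ltW.
  rewrite (classical_weak dv dr (half_state_source_continuous hq Hv cu) Lv Lr
      (half_state_source_L2 hq hb ltr01 Hv nu cu) Hphi).
  by apply: eq_Rintegral => x _; rewrite force_signed ?mul1r//; exact: ltW.
exists u, v; split => //.
split => // z solz.
(* Both energies are the same nonnegative multiple of the masses. The scaled extremal has mass
   c^(2q), by unit mass and homogeneity, and [level_le] shows that no nontrivial solution has
   less. *)
have [m [m0 mS -> _]] := solution_energy hq hb homega S0 sh solz.
have [m' [_ _ -> Em]] := solution_energy hq hb homega S0 sh sol.
have e0 : 0 <= 2^-1 - (2 * q)^-1.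
  by rewrite subr_ge0 lef_pV2 ?posrE ?mulr_gt0//; move: hq; lra.
apply: ler_wpM2l => //.
have aeR (w : R -> R) : w = w %[ae lebesgue_measure] by exact: ae_eq_refl.
rewrite -(Em u v Lu.1 Lv.1 (aeR u) (aeR v)).
have -> : \int[lebesgue_measure]_x coupling q b (u x) (v x) = c `^ (2 * q).
  have [I1 I2] := M; rewrite -[RHS]mulr1 -[X in _ = _ * X]I2 -RintegralZl//.
  by apply: eq_Rintegral => x _; rewrite couplingZ ?(ltW c0).
exact: (level_le hq c0 cS m0 mS).
Qed.
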